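(* Let $N\ge2$ and $K\in\mathcal K^{ss}_{(o)}$. Then, for every $u\in C_c^\infty(\mathbb R^N\setminus\{o\})$, $$\text{(1)}\quad\int_{\mathbb R^N}|\mathcal R_K(u)|^2dx+\int_{\mathbb R^N}\|x\|_K^2u^2dx\ \ge\ N\int_{\mathbb R^N}u^2dx,$$ $$\text{(2)}\quad\Big(\int_{\mathbb R^N}|\mathcal R_K(u)|^2dx\Big)^{\frac12}\Big(\int_{\mathbb R^N}\|x\|_K^2u^2dx\Big)^{\frac12}\ \ge\ \frac N2\int_{\mathbb R^N}u^2dx.$$ The sharp constants are $N$ and $\frac N2$, respectively, and they are achieved in $\mathcal C_{K,-1,0}$. Equality in (1) is attained by $$u(x)=\Phi(\sigma_K(x))\exp\Big(-\frac12\|x\|_K^2\Big),$$ while equality in (2) is attained by $$u(x)=\Phi(\sigma_K(x))\exp\Big(-\frac1{2\lambda^2}\|x\|_K^2\Big),\qquad\lambda>0,$$ where $\Phi\in L^2(\partial K,d\mu_K)$.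
   Context: $o$ is the origin of $\mathbb R^N$. A convex body is a compact convex subset of $\mathbb R^N$ with non-empty interior. $\mathcal K^{ss}_{(o)}$ is the set of convex bodies $K\subset\mathbb R^N$ that contain $o$ in their interior, are smooth (each boundary point has a unique outer unit normal vector) and strictly convex ($\partial K$ contains no line segment). $K$ is not assumed origin-symmetric. The Minkowski functional of $K$ is $\|x\|_K=\inf\{\lambda\ge0:x\in\lambda K\}$. For $x\ne o$, $\sigma_K(x)=x/\|x\|_K\in\partial K$, and the anisotropic radial derivative is $\mathcal R_K(u)(x)=\nabla u(x)\cdot\sigma_K(x)=\frac{x\cdot\nabla u(x)}{\|x\|_K}$. $\mu_K$ is the finite Borel measure on $\partial K$ determined by the polar formula $\int_{\mathbb R^N}u\,dx=\int_0^\infty\int_{\partial K}u(r\sigma)r^{N-1}d\mu_K(\sigma)dr$ for all non-negative measurable $u$. $\mathcal C_{K,-1,0}$ is the completion of $C_c^\infty(\mathbb R^N\setminus\{o\})$ under the norm $\big(\int_{\mathbb R^N}|\mathcal R_K(u)|^2dx+\int_{\mathbb R^N}\|x\|_K^2u^2dx\big)^{1/2}$. ''Sharp'' means that the constant cannot be replaced by a larger one; ''achieved in $\mathcal C_{K,-1,0}$'' means that the extremal functions belong to this space and give equality. *)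

(* Defs.v *)
From HB Require Import structures.
From mathcomp Require Import all_boot all_order all_algebra.
From mathcomp Require Import all_classical all_reals all_analysis.
From mathcomp Require Import measurable_realfun.
Set Implicit Arguments.
Unset Strict Implicit.
Unset Printing Implicit Defensive.
Import Order.TTheory GRing.Theory Num.Theory.
Import numFieldNormedType.Exports.
Local Open Scope classical_set_scope.
Local Open Scope ring_scope.

(** R^n is 'rV[R]_n, with the Borel sigma-algebra of its library topology.
    The library norm is the sup norm; only the topology it induces, which is
    the Euclidean one, is used. *)

Definition measure_rV_display : measure_display.
Proof. exact. Qed.

Section borel_rV.
Variables (R : realType) (n : nat).

Let borel : set (set 'rV[R]_n) := <<s open >>.

Let borel0 : borel set0.
Proof. exact: sigma_algebra0. Qed.

Let borelC A : borel A -> borel (~` A).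
Proof. exact: sigma_algebraC. Qed.

Let borel_bigcup (F : (set 'rV[R]_n)^nat) :
  (forall i, borel (F i)) -> borel (\bigcup_i F i).
Proof. exact: sigma_algebra_bigcup. Qed.

HB.instance Definition _ := @isMeasurable.Build measure_rV_display
  'rV[R]_n borel borel0 borelC borel_bigcup.

End borel_rV.

Section measurable_rV.
Variable R : realType.

Lemma rV_measurableE n : @measurable _ 'rV[R]_n = <<s open >>.
Proof. by []. Qed.

Lemma rV_open_measurable n (U : set 'rV[R]_n) : open U -> measurable U.
Proof. by move=> oU; exact: sub_sigma_algebra. Qed.

Lemma measurable_rV_coord n (i : 'I_n) :
  measurable_fun [set: 'rV[R]_n] (fun x : 'rV[R]_n => x ord0 i).
Proof.
apply: (measurability _ (RGenOInfty.measurableE R)) => _ [_ [r ->] <-].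
rewrite setTI; apply: rV_open_measurable; apply: open_comp; last first.
  exact: rray_open.
by move=> x _; exact: coord_continuous.
Qed.

Lemma measurable_rVP d (T : measurableType d) n (f : T -> 'rV[R]_n) :
  (forall i, measurable_fun [set: T] (fun t => f t ord0 i)) ->
  measurable_fun [set: T] f.
Proof.
move=> mf; apply: (measurability _ (rV_measurableE n)) => _ [U oU <-].
rewrite setTI.
pose B (q : 'rV[rat]_n * rat) : set 'rV[R]_n :=
  [set y | forall i, `|ratr (q.1 ord0 i) - y ord0 i| < ratr q.2].
pose F q : set T := if `[< B q `<=` U >] then f @^-1` (B q) else set0.
suff -> : f @^-1` U = \bigcup_q F q.
  apply: countable_bigcupT_measurable => [|q]; first exact: countableP.
  rewrite /F; case: ifPn => // _.
  have -> : f @^-1` B q = \bigcap_i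
      ((fun t => f t ord0 i) @^-1` ball (ratr (q.1 ord0 i) : R) (ratr q.2 : R)).
    by apply/seteqP; split=> [t Bt i _|t Bt i]; [exact: Bt|exact: (Bt i I)].
  apply: fin_bigcap_measurable; first exact: finite_finset.
  by move=> i _; rewrite -[X in measurable X]setTI; apply: mf => //;
    exact: measurable_ball.
apply/seteqP; split=> [t Ut|t [q _]]; last first.
  by rewrite /F; case: asboolP => // BU Bt; exact: BU.
have /nbhs_ballP[e /= e0 eU] := open_nbhs_nbhs (conj oU Ut).
have e2 : 0 < e / 2 by rewrite divr_gt0.
have [r] := rat_in_itvoo e2; rewrite in_itv /= => /andP[r0 re].
have H i : exists q : rat, `|ratr q - f t ord0 i| < ratr r.
  have : f t ord0 i - ratr r < f t ord0 i + ratr r by rewrite ltrD2l gtrN.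
  by move=> /rat_in_itvoo[q]; rewrite in_itv /= => qr; exists q; rewrite ltr_distl.
exists (\row_i xget 0 [set q : rat | `|ratr q - f t ord0 i| < ratr r], r) => //.
rewrite /F; case: asboolP => [_ i|]; rewrite ?mxE /=.
  by have [q Hq] := H i; exact: (@xgetPex _ 0 [set q : rat | _] (ex_intro _ q Hq)).
case=> y By; apply: eU; split=> // i j; rewrite (ord1 i) /ball /=.
have := By j; rewrite mxE /= => By_j.
have [q Hq] := H j.
have Bx := @xgetPex _ 0 [set q : rat | `|ratr q - f t ord0 j| < ratr r] (ex_intro _ q Hq).
set p := xget _ _ in By_j Bx.
rewrite (splitr e) -(subrKA (ratr p)) (le_lt_trans (ler_normD _ _))//.
rewrite ltrD//; last exact: (lt_trans By_j).
by rewrite distrC; exact: (lt_trans Bx).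
Qed.

Definition rV_cons n (p : 'rV[R]_n * R) : 'rV[R]_n.+1 :=
  row_mx (const_mx p.2 : 'rV_1) p.1.

Lemma measurable_rV_cons n : measurable_fun [set: 'rV[R]_n * R] (@rV_cons n).
Proof.
apply: measurable_rVP => i; rewrite /rV_cons.
case: (split_ordP (i : 'I_(1 + n))) => j ->.
  apply: (@eq_measurable_fun _ _ _ _ _ snd) => [p _|//].
  by rewrite [RHS](row_mxEl _ _ _ _) mxE.
apply: (@eq_measurable_fun _ _ _ _ _ 
  ((fun x : 'rV[R]_n => x ord0 j) \o fst)) => [p _|].
  by rewrite [RHS](row_mxEr _ _ _ _).
exact: measurableT_comp (measurable_rV_coord j) _.
Qed.

End measurable_rV.

Section lebesgue_rV_step.
Variables (R : realType) (n : nat) (mu : {measure set 'rV[R]_n -> \bar R}).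

Definition lebesgue_rV_step : set 'rV[R]_n.+1 -> \bar R :=
  pushforward (mu \x @lebesgue_measure R)%E (@rV_cons R n).

HB.instance Definition _ := Measure.copy lebesgue_rV_step
  (measure_function_pushforward__canonical__measure_function_Measure
    (mu \x @lebesgue_measure R)%E (@measurable_rV_cons R n)).

End lebesgue_rV_step.

Fixpoint lebesgue_rV (R : realType) (n : nat) :
    {measure set 'rV[R]_n -> \bar R} :=
  if n is n'.+1 then lebesgue_rV_step (lebesgue_rV R n') else \d_(0 : 'rV[R]_0).

Section definitions.
Variables (R : realType) (N : nat).
Local Notation E := 'rV[R]_N.
Implicit Types (K : set E) (u g : E -> R) (x y nu : E).

Definition dot x y : R := \sum_(i < N) x ord0 i * y ord0 i.

Definition frontier K : set E := closure K `\` interior K.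

Definition convex_body K : Prop :=
  [/\ compact K, convex_set (K : set (convex_lmodType E)) &
      interior K !=set0].

Definition outer_unit_normal K x nu : Prop :=
  dot nu nu = 1 /\ forall y, K y -> dot (y - x) nu <= 0.

Definition smooth_body K : Prop :=
  forall x, frontier K x -> exists! nu, outer_unit_normal K x nu.

Definition strictly_convex_body K : Prop :=
  forall x y, x != y ->
    ~ (forall t : R, 0 <= t <= 1 -> frontier K ((1 - t) *: x + t *: y)).

Definition Kss_o K : Prop :=
  [/\ convex_body K, interior K 0, smooth_body K & strictly_convex_body K].

Definition minkowski_functional K x : R :=
  inf [set l : R | 0 <= l /\ exists2 y, K y & x = l *: y].

Definition sigma K x : E := (minkowski_functional K x)^-1 *: x.

Definition partial (i : 'I_N) u x : R := 'D_(delta_mx ord0 i : E) u x.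

Definition gradient u x : E := \row_i partial i u x.

Definition radial_derivative K u x : R := dot (gradient u x) (sigma K x).

Fixpoint class_C (k : nat) u : Prop :=
  continuous u /\
  if k is k'.+1 then
    forall i : 'I_N,
      (forall x, derivable u x (delta_mx ord0 i)) /\ class_C k' (partial i u)
  else True.

(** Functions in C_c^oo(R^N \ {o}), extended by zero at the origin. *)
Definition Cc_infty u : Prop :=
  [/\ forall k, class_C k u,
      compact (closure [set x | u x != 0]) &
      ~ closure [set x | u x != 0] 0].

Local Open Scope ereal_scope.

Definition sq_integral g : \bar R :=
  \int[lebesgue_rV R N]_x ((`|g x| ^+ 2)%R)%:E.

Definition weighted_sq_integral K u : \bar R :=
  \int[lebesgue_rV R N]_x ((minkowski_functional K x ^+ 2 * u x ^+ 2)%R)%:E.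

(** The polar formula, which determines the measure mu_K on the boundary of K;
    such a measure is represented by a measure on R^N that is carried by that
    boundary. *)
Definition polar_measure K (mu : {finite_measure set E -> \bar R}) : Prop :=
  mu (~` frontier K) = 0 /\
  forall f : E -> \bar R,
    measurable_fun [set: E] f -> (forall x, 0 <= f x) ->
    \int[lebesgue_rV R N]_x f x =
    \int[@lebesgue_measure R]_(r in `]0%R, +oo[)
      \int[mu]_(s in frontier K) (f (r *: s) * (r ^+ N.-1)%R%:E).

(** The norm of C_{K,-1,0} makes u |-> (u, R_K u) an isometry of
    C_c^oo(R^N \ {o}) into the Hilbert space L^2(|x|_K^2 dx) x L^2(dx), so
    that the completion is the closure of the range.
    [in_completion K u g] says that the pair (u, g) is in that closure; g is
    then the extension of R_K to the element u of the completion, and the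
    squared norm of u is [sq_integral g + weighted_sq_integral K u]. *)
Definition in_completion K u g : Prop :=
  [/\ measurable_fun [set: E] u, measurable_fun [set: E] g &
      exists v : nat -> E -> R,
        [/\ forall n, Cc_infty (v n),
            weighted_sq_integral K (fun x => v n x - u x)%R @[n --> \oo] --> 0 &
            sq_integral (fun x => radial_derivative K (v n) x - g x)%R
              @[n --> \oo] --> 0]].

End definitions.

(* Main.v *)
From HB Require Import structures.
Require Import Defs.
From mathcomp Require Import all_boot all_order all_algebra.
From mathcomp Require Import all_classical all_reals all_analysis.
From mathcomp Require Import measurable_realfun.
From mathcomp Require Import ring lra.
Set Implicit Arguments.
Unset Strict Implicit.
Unset Printing Implicit Defensive.
Import Order.TTheory GRing.Theory Num.Theory.
Import numFieldNormedType.Exports.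
Local Open Scope classical_set_scope.
Local Open Scope ring_scope.

(** Write [h] for the Minkowski functional of [K] and [R_K u] for the radial
    derivative, so that [h * R_K u] is the derivative of [u] along [x], that is
    [euler u x], in which [K] no longer occurs.  For a test function and a real
    [t], expand the square in

      [0 <= \int (R_K u + t h u)^2 = A + t^2 B + t \int euler (u^2)]

    with [A] the integral of [(R_K u)^2] and [B] that of [h^2 u^2].  Lebesgue
    measure scales by the power [N] under dilations, so the last integral is
    [- N S] with [S] the integral of [u^2] ([integral_euler]), and
    [A + t^2 B - t N S >= 0] for every [t] ([integral_sqr_family]).  The value
    [t = 1] is the inequality for the sum; the discriminant is the inequality
    for the product.

    Equality forces [R_K u = - t h u], that is [u = m * exp (- c h^2)] with [m]
    constant along rays and [t = 2 c].  For these functions [R_K u] is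
    [- 2 c h u], so that [A = 4 c^2 B], and the virial identity
    [N S = 4 c B] ([virial]) gives equality for the product, and for the sum
    when [c = 1 / 2].  The virial identity is an identity in [[0, +oo]]:
    the gaussian is written as the integral of its derivatives at larger scales,
    and the order of integration is exchanged.  It therefore also
    shows that an extremal function in [L^2] has finite energy; for
    [m x = Phi (sigma K x)] it is in [L^2] by the polar formula.

    The hard part is that these functions, which need not be continuous, belong to
    the completion ([extremal_approximable]).  Here it matters that the norm
    contains the radial derivative only.  A multiplier that is constant along
    rays commutes with [R_K], whence the closure of the test functions is stable
    under bounded such multipliers: smooth ones at once, then indicators of
    Borel sets of directions by a Dynkin argument ([approximable_indic]), then
    every multiplier that leaves the energy finite
    ([approximable_homogeneous]).  Moreover, one element of the closure may be
    used on each piece of a finite partition of the directions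
    ([approximable_glue]).  A Euclidean gaussian is in the closure, by
    logarithmic cutoffs; this is where the dimension has to be at least 2
    ([gaussian_approximable]).  On a ray, [exp (- c h^2)] is a Euclidean
    gaussian, with a parameter that depends on the direction; replacing the
    parameter by simple functions of the direction shows that it is in the
    closure ([gauge_gaussian_approximable]), and multiplication by [m] gives the
    extremal functions.

    Finally, a constant that is valid for the test functions is valid for every
    element of the closure, in particular for an extremal function
    ([constant_le_of_extremal]); this is the sharpness for the sum.  Sharpness
    for the product follows, for twice a constant of the product inequality is
    a constant of the sum inequality, by the inequality of the means. *)

(** * Lebesgue measure on R^n under dilations *)

Section leb.
Variable R : realType.
Implicit Types n : nat.
Local Notation mu1 := (@lebesgue_measure R).

Lemma continuous_rV_measurable n (f : 'rV[R]_n -> R) :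
  continuous f -> measurable_fun setT f.
Proof.
move=> cf; apply: (measurability _ (RGenOInfty.measurableE R)) => _ [_ [r ->] <-].
rewrite setTI; apply: rV_open_measurable; apply: open_comp; last exact: rray_open.
by move=> x _; exact: cf.
Qed.

Lemma rV_consl n (p : 'rV[R]_n * R) : rV_cons p ord0 ord0 = p.2.
Proof.
have -> : ord0 = lshift n (ord0 : 'I_1) by exact: val_inj.
by rewrite /rV_cons [LHS](row_mxEl _ _ _ _) mxE.
Qed.

Lemma rV_consr n (p : 'rV[R]_n * R) (i : 'I_n) :
  rV_cons p ord0 (lift ord0 i) = p.1 ord0 i.
Proof.
have -> : lift ord0 i = rshift 1 i by exact: val_inj.
by rewrite /rV_cons [LHS](row_mxEr _ _ _ _).
Qed.

Lemma ge0_integral_lebesgue_rVS n (f : 'rV[R]_n.+1 -> \bar R) :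
  measurable_fun setT f -> (forall x, 0 <= f x)%E ->
  (\int[lebesgue_rV R n.+1]_x f x =
   \int[lebesgue_rV R n \x mu1]_p f (rV_cons p))%E.
Proof.
move=> mf f0; rewrite [LHS](_ : _ =
  \int[pushforward (lebesgue_rV R n \x mu1)%E (@rV_cons R n)]_x f x)%E//.
by rewrite ge0_integral_pushforward//; exact: measurable_rV_cons.
Qed.

Definition box n (r : R) : set 'rV[R]_n := [set x | forall i, `|x ord0 i| <= r].

Lemma measurable_box n r : measurable (@box n r).
Proof.
rewrite (_ : @box n r = \bigcap_(i in [set: 'I_n])
   ((fun x : 'rV[R]_n => `|x ord0 i|) @^-1` `]-oo, r])); last first.
  apply/seteqP; split=> [x xr i _|x xr i] /=; first by rewrite in_itv/= xr.
  by have := xr i I; rewrite /= in_itv.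
apply: fin_bigcap_measurable; first exact: finite_finset.
move=> i _; rewrite -[X in measurable X]setTI.
have : measurable_fun setT (fun x : 'rV[R]_n => `|x ord0 i|).
  by apply: measurableT_comp => //; exact: measurable_rV_coord.
by apply.
Qed.

Lemma lebesgue_rV_box n (r : R) : 0 <= r ->
  lebesgue_rV R n (box r) = ((2 * r) ^+ n)%:E.
Proof.
move=> r0; elim: n => [|n IH].
  by rewrite /= diracE mem_set// => -[].
rewrite [LHS](_ : _ = (lebesgue_rV R n \x mu1)%E (box r `*` `[- r, r]%classic)); last first.
  rewrite /= /lebesgue_rV_step /pushforward; congr product_measure1.
  apply/seteqP; split=> [[x t]/= xr|[x t]/= [xr tr] i].
    split=> [i|]; first by have := xr (lift ord0 i); rewrite rV_consr.
    by have := xr ord0; rewrite rV_consl/= in_itv/= ler_norml.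
  case: (unliftP ord0 i) => [j|] ->; first by rewrite rV_consr; exact: xr.
  by rewrite rV_consl/= ler_norml; move: tr; rewrite in_itv.
rewrite product_measure1E//; last exact: measurable_box.
rewrite IH /= lebesgue_measure_itv/= lte_fin; case: ifPn => [_|].
  by rewrite -EFinD -EFinM exprSr; congr (_ %:E); rewrite /=; ring.
rewrite -leNgt => r0'; have -> : r = 0 by lra.
by rewrite mulr0 mule0 exprS mul0r.
Qed.

Lemma lebesgue_rV_sigma_finite n : sigma_finite setT (lebesgue_rV R n).
Proof.
exists (fun k => @box n k%:R).
  apply/seteqP; split=> // x _.
  exists (\sum_(i < n) Num.bound (`|x ord0 i|))%N => // i /=.
  rewrite (le_trans (ltW (archi_boundP (normr_ge0 _))))// ler_nat.
  by rewrite (bigD1 i)//= leq_addr.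
by move=> k; split; [exact: measurable_box|rewrite lebesgue_rV_box ?ltry].
Qed.

(** The same measure under a name of its own, which carries the sigma-finite
    structure that Tonelli's theorem asks for. *)
Definition leb n : set 'rV[R]_n -> \bar R := lebesgue_rV R n.
HB.instance Definition _ n := Measure.on (@leb n).
HB.instance Definition _ n := @Measure_isSigmaFinite.Build _ _ _ (@leb n)
  (@lebesgue_rV_sigma_finite n).

Lemma ge0_integral_lebesgue_rVE n (f : 'rV[R]_n.+1 -> \bar R) :
  measurable_fun setT f -> (forall x, 0 <= f x)%E ->
  (\int[lebesgue_rV R n.+1]_x f x =
   \int[lebesgue_rV R n]_x \int[mu1]_t f (rV_cons (x, t)))%E.
Proof.
move=> mf f0; rewrite ge0_integral_lebesgue_rVS//.
rewrite (@fubini_tonelli1 _ _ _ _ _ (@leb n) mu1 (f \o @rV_cons R n))//.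
  exact: measurableT_comp mf (@measurable_rV_cons R n).
by move=> p; exact: f0.
Qed.

(** By uniqueness of Lebesgue measure: [l] times its image under the dilation
    by [l] gives intervals their length. *)
Lemma ge0_integral_scale1 (f : R -> \bar R) (l : R) : 0 < l ->
  measurable_fun setT f -> (forall x, 0 <= f x)%E ->
  (\int[mu1]_x f (l * x)%R = l^-1%:E * \int[mu1]_x f x)%E.
Proof.
move=> l0 mf f0.
have ml : measurable_fun [set: measurableTypeR R]
  ( *%R l : measurableTypeR R -> measurableTypeR R) by exact: mulrl_measurable.
pose pm : {measure set (measurableTypeR R) -> \bar R} :=
  measure_function_pushforward__canonical__measure_function_Measure mu1 ml.
pose m' : {measure set (measurableTypeR R) -> \bar R} :=
  mscale (NngNum (ltW l0)) pm.
have E (A : set R) : measurable A -> mu1 A = m' A.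
  move=> mA; apply: (@lebesgue_measure_unique R m') => [_ [[a b] _ <-]|//] /=.
  rewrite /m' /mscale/= /pushforward.
  have -> : ( *%R l) @^-1` `]a, b] = `](l^-1 * a), (l^-1 * b)]%classic.
    by apply/seteqP; split=> x/=; rewrite !in_itv/= -[l^-1 * a]mulrC
      -[l^-1 * b]mulrC ltr_pdivrMr// ler_pdivlMr// ![x * l]mulrC.
  rewrite !lebesgue_measure_itv/= !lte_fin ltr_pM2l ?invr_gt0//.
  case: ifPn => _; last by rewrite mule0.
  by rewrite -!EFinD -EFinM; congr (_ %:E); field; rewrite gt_eqF.
rewrite [in RHS](eq_measure_integral m'); last by move=> A mA _; exact: E.
rewrite ge0_integral_mscale// ge0_integral_pushforward//= muleA -EFinM.
by rewrite mulVf ?gt_eqF// mul1e.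
Qed.

End leb.

Section leb2.
Variable R : realType.
Implicit Types n : nat.
Local Notation mu1 := (@lebesgue_measure R).

Lemma rV_consZ n (l : R) (x : 'rV[R]_n) (t : R) :
  l *: rV_cons (x, t) = rV_cons (l *: x, l * t).
Proof.
apply/rowP => i; case: (unliftP ord0 i) => [j|] ->.
  by rewrite mxE !rV_consr mxE.
by rewrite mxE !rV_consl.
Qed.

Lemma dot_rV_cons n (x : 'rV[R]_n) (t : R) :
  dot (rV_cons (x, t)) (rV_cons (x, t)) = t ^+ 2 + dot x x.
Proof.
rewrite /dot big_ord_recl !rV_consl -expr2; congr (_ + _).
by apply: eq_bigr => i _; rewrite !rV_consr.
Qed.

Lemma measurable_rV_scale n (l : R) :
  measurable_fun setT (fun x : 'rV[R]_n => l *: x).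
Proof.
apply: measurable_rVP => i.
rewrite [X in measurable_fun _ X](_ : _ = fun x : 'rV[R]_n => l * x ord0 i); last first.
  by apply/funext => x; rewrite mxE.
by apply: measurable_funM => //; exact: measurable_rV_coord.
Qed.

Lemma measurable_rV_scaler n :
  measurable_fun setT (fun p : 'rV[R]_n * R => p.2 *: p.1).
Proof.
apply: measurable_rVP => i.
rewrite [X in measurable_fun _ X](_ : _ = fun p : 'rV[R]_n * R => p.2 * p.1 ord0 i); last first.
  by apply/funext => x; rewrite mxE.
apply: measurable_funM => //.
exact: (measurableT_comp (measurable_rV_coord i) measurable_fst).
Qed.

(** By induction on the dimension: Tonelli's theorem splits off one coordinate,
    and each coordinate contributes a factor [l^-1]. *)
Lemma ge0_integral_scale n (f : 'rV[R]_n -> \bar R) (l : R) : 0 < l ->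
  measurable_fun setT f -> (forall x, 0 <= f x)%E ->
  (\int[lebesgue_rV R n]_x f (l *: x)%R =
   (l ^- n)%:E * \int[lebesgue_rV R n]_x f x)%E.
Proof.
move=> l0; elim: n f => [f mf f0|n IH f mf f0].
  rewrite expr0 invr1 mul1e; apply: eq_integral => x _.
  by rewrite [l *: x]thinmx0 [x]thinmx0.
rewrite ge0_integral_lebesgue_rVE//; last first.
  by apply: measurableT_comp mf _; exact: measurable_rV_scale.
have mfc : measurable_fun setT (f \o @rV_cons R n).
  exact: measurableT_comp mf (@measurable_rV_cons R n).
have mfx x : measurable_fun setT (fun t => f (rV_cons (x, t))).
  exact: (measurableT_comp mfc (measurable_pair1 x)).
under eq_integral => x _.
  under eq_integral => t _ do rewrite rV_consZ.
  rewrite (@ge0_integral_scale1 _ (fun t => f (rV_cons (l *: x, t))))//.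
  over.
rewrite ge0_integralZl//; last 3 first.
- rewrite [X in measurable_fun _ X](_ : _ =
    (fun x => (\int[mu1]_t f (rV_cons (x, t)))%E) \o (fun x => l *: x))//.
  apply: measurableT_comp; last exact: measurable_rV_scale.
  by have := (@measurable_fun_fubini_tonelli_F _ _ _ _ _ mu1 _ mfc); apply => p; exact: f0.
- by move=> x _; apply: integral_ge0.
- by rewrite lee_fin invr_ge0 ltW.
rewrite (IH (fun x => \int[mu1]_t f (rV_cons (x, t)))%E).
- by rewrite [in RHS]ge0_integral_lebesgue_rVE// muleA -EFinM exprS invfM.
- by have := (@measurable_fun_fubini_tonelli_F _ _ _ _ _ mu1 _ mfc); apply => p; exact: f0.
- by move=> x; apply: integral_ge0.
Qed.

Lemma continuous_dot n : continuous (fun x : 'rV[R]_n => dot x x).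
Proof.
rewrite /dot; apply: continuous_big => [|i _ x]; first exact: add_continuous.
have c := @coord_continuous R 1 n ord0 i x.
exact: (@continuousM R 'rV[R]_n (fun y => y ord0 i) (fun y => y ord0 i) x c c).
Qed.

Lemma measurable_dot n : measurable_fun setT (fun x : 'rV[R]_n => dot x x).
Proof. by apply: continuous_rV_measurable; exact: continuous_dot. Qed.

Lemma gaussian_finite n (c : R) : 0 < c ->
  (\int[lebesgue_rV R n]_x (expR (- (c * dot x x)))%:E < +oo)%E.
Proof.
move=> c0; elim: n => [|n IH].
  rewrite /= integral_dirac//; first by rewrite ltry.
  apply: measurable_funTS.
  apply/measurable_EFinP; apply: (measurableT_comp (@measurable_expR R)).
  apply: measurableT_comp => //; apply: measurable_funM => //.
  exact: measurable_dot.
have me m : measurable_fun setT (fun x : 'rV[R]_m => (expR (- (c * dot x x)))%:E).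
  apply/measurable_EFinP; apply: (measurableT_comp (@measurable_expR R)).
  apply: measurableT_comp => //; apply: measurable_funM => //.
  exact: measurable_dot.
rewrite ge0_integral_lebesgue_rVE//.
have mg : measurable_fun setT (fun t : R => (expR (- (c * t ^+ 2)))%:E).
  apply/measurable_EFinP; apply: (measurableT_comp (@measurable_expR R)).
  apply: measurableT_comp => //; apply: measurable_funM => //.
pose G := (\int[mu1]_t (expR (- (c * t ^+ 2)))%:E)%E.
have Goo : (G < +oo)%E.
  have s0 : 0 < Num.sqrt c by rewrite sqrtr_gt0.
  have -> : G = (\int[mu1]_t (EFin \o gauss_fun) (Num.sqrt c * t)%R)%E.
    by apply: eq_integral => t _; rewrite /= /gauss_fun exprMn sqr_sqrtr// ltW.
  rewrite (ge0_integral_scale1 s0)//.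
  - by rewrite /= integralT_gauss -EFinM ltry.
  - apply/measurable_EFinP; exact: measurable_gauss_fun.
  - by move=> x; rewrite /= lee_fin gauss_fun_ge0.
under eq_integral => x _.
  under eq_integral => t _.
    rewrite dot_rV_cons mulrDr opprD expRD EFinM muleC; over.
  rewrite ge0_integralZl//.
  rewrite -/G muleC; over.
rewrite ge0_integralZl//; last by apply: integral_ge0.
apply: lte_mul_pinfty => //; first exact: integral_ge0.
rewrite fin_numElt Goo andbT (lt_le_trans (ltNyr 0))//.
  exact: integral_ge0.
exact: me.
Qed.

Lemma measurable_rV_set0 n : measurable [set (0 : 'rV[R]_n)].
Proof.
rewrite (_ : [set 0] = box 0); first exact: measurable_box.
apply/seteqP; split=> [x -> i|x x0]; first by rewrite mxE normr0.
by apply/rowP => i; rewrite mxE; apply/eqP; rewrite -normr_le0; exact: x0.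
Qed.

Lemma lebesgue_rV_set0 n : (0 < n)%N -> lebesgue_rV R n [set 0] = 0%E.
Proof.
move=> n0; apply/eqP; rewrite eq_le measure_ge0 andbT.
apply: (@le_trans _ _ (lebesgue_rV R n (box 0))).
  apply: le_measure; rewrite ?inE; [exact: measurable_rV_set0|exact: measurable_box|].
  by move=> x -> i; rewrite mxE normr0.
by rewrite lebesgue_rV_box// mulr0 expr0n eqn0Ngt n0.
Qed.

Lemma ae_rV_neq0 n (P : 'rV[R]_n -> Prop) : (0 < n)%N ->
  (forall x, x != 0 -> P x) -> {ae lebesgue_rV R n, forall x, P x}.
Proof.
move=> n0 HP; exists [set 0]; split.
- exact: measurable_rV_set0.
- exact: lebesgue_rV_set0.
- move=> x nPx; apply: contrapT => x0; apply: nPx; apply: HP; exact/eqP.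
Qed.

Lemma integral_gt0_rV n (f : 'rV[R]_n -> \bar R) : (0 < n)%N ->
  measurable_fun setT f -> (forall x, 0 <= f x)%E ->
  (forall x : 'rV[R]_n, x != 0%R -> 0 < f x)%E -> (0 < \int[lebesgue_rV R n]_x f x)%E.
Proof.
move=> n0 mf f0 fgt0; rewrite lt_neqAle integral_ge0// andbT.
apply/eqP => /esym i0.
have /(ae_eq_integral_abs (lebesgue_rV R n) measurableT mf)[] :
    (\int[lebesgue_rV R n]_x `|f x| = 0)%E.
  by rewrite -[RHS]i0; apply: eq_integral => x _; rewrite gee0_abs.
move=> A [mA A0 fA].
have : (lebesgue_rV R n (box 1) <= lebesgue_rV R n (A `|` [set 0%R]))%E.
  apply: le_measure; rewrite ?inE; first exact: measurable_box.
    by apply: measurableU => //; exact: measurable_rV_set0.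
  move=> x _; have [->|x0] := eqVneq x 0; first by right.
  left; apply: fA => /= /(_ I) /= fx0.
  by have := fgt0 _ x0; rewrite fx0 ltxx.
rewrite measureU0//; [|exact: measurable_rV_set0|exact: lebesgue_rV_set0].
by rewrite [X in (_ <= X)%E]A0 lebesgue_rV_box// lee_fin leNgt exprn_gt0// mulr_gt0.
Qed.

End leb2.

Lemma measurable_invr (R : realType) : measurable_fun setT (@GRing.inv R).
Proof.
rewrite -(setvU [set 0]); apply/measurable_funU => //.
  exact: measurableC.
split; last exact: measurable_fun_set1.
apply: open_continuous_measurable_fun; first exact/closed_openC/closed_eq.
by move=> x; rewrite inE /= => /eqP x0; exact: inv_continuous.
Qed.

(** * The Minkowski functional *)

Section gauge.
Variables (R : realType) (N : nat) (K : set 'rV[R]_N).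
Hypothesis K_Kss : Kss_o K.
Local Notation h := (minkowski_functional K).

Let scales (x : 'rV[R]_N) := [set l : R | 0 <= l /\ exists2 y, K y & x = l *: y].

Lemma gauge_convex x y (t : R) : 0 <= t <= 1 -> K x -> K y ->
  K (t *: x + (1 - t) *: y).
Proof.
have [[_ cK _] _ _ _] := K_Kss; move=> /andP[t0 t1] Kx Ky.
have := cK x y (Itv01 t0 t1); rewrite !inE => /(_ Kx Ky).
by [].
Qed.

Lemma gauge_ball : exists2 r : R, 0 < r & forall x, `|x| <= r -> K x.
Proof.
have [_ /nbhs_ballP[e /= e0 eK] _ _] := K_Kss.
exists (e / 2); first by rewrite divr_gt0.
move=> x xe; apply: eK; rewrite -ball_normE/= sub0r normrN.
by apply: le_lt_trans xe _; rewrite ltr_pdivrMr// ltr_pMr// ltr1n.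
Qed.

Lemma gauge_bounded : exists2 M : R, 0 < M & forall x, K x -> `|x| <= M.
Proof.
have [[/compact_bounded bK _ _] _ _ _] := K_Kss.
have [M M0 HM] := pinfty_ex_gt0 bK.
by exists M.
Qed.

Lemma gauge_closed : closed K.
Proof.
by have [[cK _ _] _ _ _] := K_Kss; apply: compact_closed => //; exact: norm_hausdorff.
Qed.

Lemma gauge0_in : K 0.
Proof. by have [_ /interior_subset] := K_Kss. Qed.

Lemma scales_lb x : lbound (scales x) 0.
Proof. by move=> l []. Qed.

Lemma scales_ge x (r : R) : (forall y, `|y| <= r -> K y) -> 0 < r ->
  scales x (`|x| / r).
Proof.
move=> rK r0; split; first by rewrite divr_ge0// ltW.
have [->|x0] := eqVneq x 0.
  by exists 0; [exact: gauge0_in|rewrite scaler0].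
exists ((r / `|x|) *: x).
  by apply: rK; rewrite normrZ normrM normfV normr_id mulfVK ?normr_eq0// gtr0_norm.
by rewrite scalerA mulrA divfK ?gt_eqF// divff ?normr_eq0// scale1r.
Qed.

Lemma scales_neq0 x : scales x !=set0.
Proof.
by have [r r0 rK] := gauge_ball; exists (`|x| / r); exact: scales_ge.
Qed.

Lemma scales_up x l l' : scales x l -> l <= l' -> scales x l'.
Proof.
move=> [l0 [y Ky ->]] ll'; split; first exact: le_trans ll'.
have [l'0|l'0] := eqVneq l' 0.
  exists y => //; congr (_ *: _); apply/eqP; rewrite eq_le ll' l'0//.
exists ((l / l') *: y); last by rewrite scalerA mulrC divfK.
have l'gt0 : 0 < l' by rewrite lt_neqAle eq_sym l'0 (le_trans l0).
rewrite -[_ *: y]addr0 -(scaler0 _ (1 - l / l')).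
apply: gauge_convex => //; last exact: gauge0_in.
by rewrite divr_ge0//= ?ler_pdivrMr ?mul1r// ltW.
Qed.

Lemma gauge_le x l : scales x l -> h x <= l.
Proof. by move=> xl; apply: ge_inf => //; exists 0; exact: scales_lb. Qed.

Lemma gauge_lt x l : h x < l -> scales x l.
Proof.
move=> hxl; have [m Sm ml] := inf_lt (scales_neq0 x) hxl.
by apply: scales_up Sm _; exact: ltW.
Qed.

Lemma gauge_ge0 x : 0 <= h x.
Proof. by apply: lb_le_inf; [exact: scales_neq0|exact: scales_lb]. Qed.

Lemma gauge_upper : exists2 c : R, 0 < c & forall x, h x <= c * `|x|.
Proof.
have [r r0 rK] := gauge_ball; exists r^-1; first by rewrite invr_gt0.
by move=> x; apply: gauge_le; rewrite mulrC; exact: scales_ge.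
Qed.

Lemma gauge_lower : exists2 c : R, 0 < c & forall x, c * `|x| <= h x.
Proof.
have [M M0 KM] := gauge_bounded; exists M^-1; first by rewrite invr_gt0.
move=> x; apply: lb_le_inf; first exact: scales_neq0.
move=> l [l0 [y /KM yM ->]]; rewrite normrZ ger0_norm//.
by rewrite mulrCA ler_piMr// mulrC ler_pdivrMr// mul1r.
Qed.

Lemma gauge0 : h 0 = 0.
Proof.
apply/eqP; rewrite eq_le gauge_ge0 andbT.
by have [c c0 /(_ 0)] := gauge_upper; rewrite normr0 mulr0.
Qed.

Lemma gauge_gt0 x : x != 0 -> 0 < h x.
Proof.
move=> x0; have [c c0 /(_ x)] := gauge_lower.
by apply: lt_le_trans; rewrite mulr_gt0// normr_gt0.
Qed.

Lemma gaugeZ l x : 0 < l -> h (l *: x) = l * h x.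
Proof.
have H m y : 0 < m -> h (m *: y) <= m * h y.
  move=> m0; rewrite -ler_pdivrMl//; apply: lb_le_inf; first exact: scales_neq0.
  move=> k [k0 [z Kz ->]]; rewrite ler_pdivrMl//; apply: gauge_le.
  by split; [rewrite mulr_ge0// ltW|exists z => //; rewrite scalerA].
move=> l0; apply/eqP; rewrite eq_le H//=.
have := H _ (l *: x) (_ : 0 < l^-1).
rewrite invr_gt0 scalerA mulVf ?gt_eqF// scale1r => /(_ l0).
by rewrite ler_pdivlMl.
Qed.

(** The infimum that defines [h x] is a limit of admissible scales; that it is
    itself admissible comes from [K] being closed. *)
Lemma gauge_le1 x : (h x <= 1) <-> K x.
Proof.
split=> [hx|Kx]; last by apply: gauge_le; split=> //; exists x; rewrite ?scale1r.
have H (n : nat) : K ((1 + n.+1%:R^-1)^-1 *: x).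
  have e0 : (0 : R) < n.+1%:R^-1 by rewrite invr_gt0.
  have [|e1 [y Ky ->]] := @gauge_lt x (1 + n.+1%:R^-1).
    by rewrite (le_lt_trans hx)// ltrDl.
  by rewrite scalerA mulVf ?scale1r// gt_eqF// addr_gt0.
apply: (@closed_cvg _ _ \oo _ (fun n : nat => (1 + n.+1%:R^-1)^-1 *: x) K
  gauge_closed (nearW _ H)).
rewrite -[X in _ --> X]scale1r; apply: cvgZr_tmp.
rewrite -[X in _ --> X]invr1; apply: cvgV => //.
rewrite -[X in _ --> X]addr0; apply: cvgD; first exact: cvg_cst.
exact: cvg_harmonic.
Qed.

(** The sublevel sets of [h] are dilates of the closed set [K]. *)
Lemma measurable_gauge : measurable_fun setT h.
Proof.
apply: (measurability _ (RGenOInfty.measurableE R)) => _ [_ [r ->] <-].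
rewrite setTI -[X in measurable X]setCK; apply: measurableC.
rewrite (_ : ~` _ = [set x | h x <= r]); last first.
  by apply/seteqP; split=> x /=; rewrite in_itv/= andbT leNgt => /negP.
have [r0|r0|->] := ltgtP r 0.
- rewrite (_ : [set _ | _] = set0)//; apply/seteqP; split=> // x /= hx.
  by have := le_lt_trans hx r0; rewrite ltNge gauge_ge0.
- rewrite (_ : [set _ | _] = (fun x => r^-1 *: x) @^-1` K); last first.
    apply/seteqP; split=> x /=; rewrite -gauge_le1 gaugeZ ?invr_gt0//;
    by rewrite ler_pdivrMl// mulr1.
  rewrite -[X in measurable X]setTI; apply: measurable_rV_scale => //.
  rewrite -[K]setCK; apply: measurableC; apply: rV_open_measurable.
  by rewrite openC; exact: gauge_closed.
- rewrite (_ : [set _ | _] = [set 0]); first exact: measurable_rV_set0.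
  apply/seteqP; split=> [x /= hx|x -> /=]; last by rewrite gauge0.
  by apply/eqP; apply: contraLR hx => x0; rewrite -ltNge gauge_gt0.
Qed.

(** If [h x < 1] then [x = m *: y] with [y] in [K] and [m < 1], and by convexity
    [K] contains the ball around [x] of radius [(1 - m) * r] as soon as it
    contains the ball around 0 of radius [r]: [x] is an interior point. *)
Lemma gauge_frontier x : frontier K x -> h x = 1.
Proof.
move=> [clx nix]; have Kx : K x by exact: gauge_closed.
apply/eqP; rewrite eq_le; apply/andP; split; first exact/gauge_le1.
rewrite leNgt; apply/negP => hx; apply: nix.
have [m [Sm hxm m1]] : exists m, [/\ scales x m, h x < m & m < 1].
  exists ((h x + 1) / 2); have hm : h x < (h x + 1) / 2 by lra.
  by split=> //; [exact: gauge_lt|lra].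
have [m0 [y Ky xE]] := Sm.
have [r r0 rK] := gauge_ball.
apply/nbhs_ballP; exists ((1 - m) * r); first by rewrite /= mulr_gt0// subr_gt0.
move=> z; rewrite -ball_normE/= => xz.
have n0 : 1 - m != 0 by rewrite gt_eqF// subr_gt0.
have -> : z = m *: y + (1 - m) *: ((1 - m)^-1 *: (z - x)).
  by rewrite scalerA divff// scale1r -xE addrC subrK.
apply: gauge_convex => //; first by rewrite m0 ltW.
apply: rK; rewrite normrZ gtr0_norm ?invr_gt0 ?subr_gt0// ler_pdivrMl ?subr_gt0//.
by rewrite distrC ltW.
Qed.

Lemma gauge_sigma x : x != 0 -> h (sigma K x) = 1.
Proof.
by move=> x0; rewrite gaugeZ ?invr_gt0 ?gauge_gt0// mulVf// gt_eqF// gauge_gt0.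
Qed.

Lemma frontier_gauge x : h x = 1 -> frontier K x.
Proof.
move=> hx; have x0 : x != 0.
  by apply/eqP => x0; move: hx; rewrite x0 gauge0 => /esym/eqP; rewrite oner_eq0.
split; first by apply: subset_closure; apply/gauge_le1; rewrite hx.
move=> /nbhs_ballP[e /= e0 eK].
have x1 : 0 < `|x| by rewrite normr_gt0.
pose d := e / 2 / `|x|; have d0 : 0 < d by rewrite !divr_gt0.
have /gauge_le1 : K ((1 + d) *: x).
  apply: eK; rewrite -ball_normE/= scalerDl scale1r opprD addrA subrr sub0r.
  rewrite normrN normrZ gtr0_norm// divfK ?gt_eqF//; lra.
by rewrite gaugeZ ?addr_gt0// hx mulr1 leNgt ltrDl d0.
Qed.

Lemma frontier_sigma x : x != 0 -> frontier K (sigma K x).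
Proof. by move=> x0; apply: frontier_gauge; exact: gauge_sigma. Qed.

Lemma sigmaZ l x : 0 < l -> sigma K (l *: x) = sigma K x.
Proof.
move=> l0; rewrite /sigma gaugeZ// scalerA invfM mulrAC mulVf ?mul1r//.
by rewrite gt_eqF.
Qed.

Lemma sigma_frontier x : frontier K x -> sigma K x = x.
Proof. by move=> /gauge_frontier hx; rewrite /sigma hx invr1 scale1r. Qed.

Lemma measurable_sigma : measurable_fun setT (sigma K).
Proof.
apply: measurable_rVP => i.
rewrite [X in measurable_fun _ X](_ : _ = (fun x : 'rV[R]_N => (h x)^-1 * x ord0 i)).
  apply: measurable_funM; last exact: measurable_rV_coord.
  apply: (measurableT_comp (@measurable_invr R)); exact: measurable_gauge.
by apply/funext => x; rewrite mxE.
Qed.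

End gauge.

(** * Directional derivatives *)

Lemma is_deriveP (R : realType) (V : normedModType R) (u : V -> R) x v d :
  is_derive x v u d <->
  h^-1 * (u (h *: v + x) - u x) @[h --> 0^'] --> d.
Proof.
split=> [[du <-]|ud]; first exact: du.
by split; [apply/cvg_ex; exists d|exact: cvg_lim].
Qed.

Section line_derivative.
Variables (R : realType) (V : normedModType R).
Implicit Types (u : V -> R) (x v : V).

(** Reduces a directional derivative to the derivative of a function of one real
    variable, to which the chain rule and the mean value theorem apply. *)
Lemma is_derive_line u x v (s d : R) :
  is_derive s 1 (fun t => u (t *: v + x)) d <-> is_derive (s *: v + x) v u d.
Proof.
rewrite [X in X <-> _](_ : _ =
    (h^-1 * (u (h *: v + (s *: v + x)) - u (s *: v + x)) @[h --> 0^'] --> d)).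
  exact: iff_sym (is_deriveP _ _ _ _).
rewrite propeqE; split=> [[du <-]|ud].
  move: du; rewrite /derivable /derive.
  rewrite (_ : (fun h => h^-1 *: _) =
    (fun h => h^-1 * (u (h *: v + (s *: v + x)) - u (s *: v + x))))//.
  by apply/funext => h /=; rewrite [h *: 1]mulr1 scalerDl addrA.
have E : (fun h => h^-1 *: (((fun t => u (t *: v + x)) \o shift s) (h *: 1) - u (s *: v + x))) =
    (fun h => h^-1 * (u (h *: v + (s *: v + x)) - u (s *: v + x))).
  by apply/funext => h /=; rewrite [h *: 1]mulr1 scalerDl addrA.
split; first by apply/cvg_ex; exists d; rewrite E.
by rewrite /derive E; exact: cvg_lim.
Qed.

Lemma is_derive_line0 u x v (d : R) :
  is_derive (0 : R) 1 (fun t => u (t *: v + x)) d <-> is_derive x v u d.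
Proof. by rewrite is_derive_line scale0r add0r. Qed.

Lemma MVT_origin (f df : R -> R) (t : R) :
  (forall s : R, is_derive s 1 f (df s)) ->
  exists2 c, `|c| <= `|t| & f t - f 0 = df c * t.
Proof.
move=> fd.
have cf a b : {within `[a, b], continuous f}.
  by apply: derivable_within_continuous => x _; exact: ex_derive.
have [t0|t0] := leP 0 t.
  have [c /itvP ct ->] := @MVT_segment R f df 0 t t0 _ (cf _ _).
  by exists c; [rewrite !ger0_norm ?ct|rewrite subr0].
have [c /itvP ct E] := @MVT_segment R f df t 0 (ltW t0) _ (cf _ _).
exists c; first by rewrite !ler0_norm ?ct ?(ltW t0)// lerN2 ct.
by rewrite -opprB E sub0r mulrN opprK.
Qed.

(** By the mean value theorem, the increment along [c *: e] is the length of the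
    step times a value of [c * b] nearby, and [b] is continuous at [x].  Adding
    the coordinate directions one at a time, continuous partial derivatives give
    all directional derivatives. *)
Lemma is_derive_dirD u x v e (a c : R) (b : V -> R) :
  (forall y, is_derive y e u (b y)) -> {for x, continuous b} ->
  is_derive x v u a -> is_derive x (v + c *: e) u (a + c * b x).
Proof.
move=> ub cb ua; apply/is_deriveP.
pose w h : V := h *: v + x.
pose q h := h^-1 * (u (h *: (v + c *: e) + x) - u (w h)).
rewrite [X in X @ _ --> _](_ : _ = (fun h => h^-1 * (u (w h) - u x) + q h)); last first.
  by apply/funext => h; rewrite /q /=; ring.
apply: cvgD; first exact/is_deriveP.
apply/cvgrPdist_le => /= eps eps0.
have [C C0 cC] : exists2 C : R, 0 < C & `|c| <= C by exists (`|c| + 1); [rewrite ltr_wpDl|rewrite lerDl].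
have eC0 : 0 < eps / C by rewrite divr_gt0.
have /cvgrPdist_le/(_ _ eC0)/nbhs_ballP[d /= d0 db] := cb.
pose M := `|v| + C * `|e| + 1.
have M0 : 0 < M by rewrite /M ltr_wpDl// addr_ge0// mulr_ge0// ltW.
near=> h.
have h0 : h != 0 by near: h; exact: nbhs_dnbhs_neq.
pose g s := u (s *: e + w h).
have gd (s : R) : is_derive s 1 g (b (s *: e + w h)) by apply/is_derive_line.
have [s sl E] := MVT_origin (h * c) gd.
have -> : q h = c * b (s *: e + w h).
  rewrite /q; have -> : u (h *: (v + c *: e) + x) = g (h * c).
    by rewrite /g /w scalerDr scalerA addrAC addrC.
  have -> : u (w h) = g 0 by rewrite /g scale0r add0r.
  by rewrite E; field.
rewrite -mulrBr normrM (le_trans (ler_wpM2r (normr_ge0 _) cC))//.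
rewrite -ler_pdivlMl// mulrC; apply: db.
rewrite -ball_normE/= /w addrA opprD addrCA subrr addr0 normrN.
have hM : `|h| * M < d.
  by rewrite -ltr_pdivlMr//; near: h; apply: dnbhs0_lt; exact: divr_gt0.
apply: le_lt_trans hM.
rewrite (le_trans (ler_normD _ _))// !normrZ /M.
have : `|s| * `|e| <= `|h| * (C * `|e|).
  by rewrite mulrA ler_wpM2r// (le_trans sl)// normrM ler_wpM2l.
have := normr_ge0 h; lra.
Unshelve. all: by end_near. Qed.

End line_derivative.

(** * Calculus of smooth functions *)

Section smooth.
Variables (R : realType) (N : nat).
Local Notation E := 'rV[R]_N.
Implicit Types (u v : E -> R) (x y : E).

Lemma class_C_continuous k u : class_C k u -> continuous u.
Proof. by case: k => [|k] []. Qed.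

Lemma class_CS k u : class_C k.+1 u -> class_C k u.
Proof.
elim: k u => [|k IH] u [cu du]; first by split.
by split => // i; have [dui /IH cui] := du i.
Qed.

Lemma class_C_partial k u i : class_C k.+1 u -> class_C k (partial i u).
Proof. by move=> [_ /(_ i)[]]. Qed.

Lemma class_C_is_derive k u i x : class_C k.+1 u ->
  is_derive x (delta_mx ord0 i : E) u (partial i u x).
Proof. by move=> [_ /(_ i)[du _]]; exact: derivableP. Qed.

Lemma class_C1_is_derive u x y : class_C 1 u ->
  is_derive x y u (dot (gradient u x) y).
Proof.
move=> cu; rewrite {1}[y]row_sum_delta /dot.
elim: (index_enum _) => [|i s IH]; first by rewrite !big_nil; exact: is_derive0.
rewrite !big_cons [_ *: _ + _]addrC [_ * _ + _]addrC mxE [partial _ _ _ * _]mulrC.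
apply: is_derive_dirD => //; first by move=> z; exact: class_C_is_derive cu.
exact/class_C_continuous/class_C_partial/cu.
Qed.

(** The partial derivatives are given by formulas [d], so that the regularity of
    a compound function can be proved by induction on [k]. *)
Lemma class_C_intro k u (d : 'I_N -> E -> R) : continuous u ->
  (forall i x, is_derive x (delta_mx ord0 i : E) u (d i x)) ->
  (forall i, class_C k (d i)) -> class_C k.+1 u.
Proof.
move=> cu du cd; split=> // i; split=> [x|]; first by have [] := du i x.
have E1 : partial i u = d i by apply/funext => x; have [] := du i x.
by move: (cd i); rewrite -E1.
Qed.

Let contD u v : continuous u -> continuous v -> continuous (fun x => u x + v x).
Proof. by move=> cu cv x; exact: (continuousD (cu x) (cv x)). Qed.

Let contM u v : continuous u -> continuous v -> continuous (fun x => u x * v x).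
Proof. by move=> cu cv x; exact: (continuousM (cu x) (cv x)). Qed.

Lemma class_C_cst k (c : R) : class_C k (fun _ : E => c).
Proof.
elim: k c => [|k IH] c; first by split=> //; exact: cst_continuous.
apply: (@class_C_intro _ _ (fun _ _ => 0)) => //.
exact: cst_continuous.
Qed.

Lemma class_C_coord k (j : 'I_N) : class_C k (fun x : E => x ord0 j).
Proof.
case: k => [|k]; first by split=> // x; exact: coord_continuous.
apply: (@class_C_intro _ _ (fun i _ => (delta_mx ord0 i : E) ord0 j)) => //.
- by move=> x; exact: coord_continuous.
- move=> i x; apply/is_deriveP; apply: cvg_near_cst.
  near=> h; have h0 : h != 0 by near: h; exact: nbhs_dnbhs_neq.
  by rewrite !mxE addrK mulrA mulVf// mul1r.
- by move=> i; exact: class_C_cst.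
Unshelve. all: by end_near. Qed.

Lemma class_CD k u v : class_C k u -> class_C k v ->
  class_C k (fun x => u x + v x).
Proof.
elim: k u v => [|k IH] u v cu cv.
  by split=> //; apply: contD; [exact: class_C_continuous cu|exact: class_C_continuous cv].
apply: (@class_C_intro _ _ (fun i x => partial i u x + partial i v x)).
- by apply: contD; [exact: class_C_continuous cu|exact: class_C_continuous cv].
- by move=> i x; apply: is_deriveD; [exact: class_C_is_derive cu|exact: class_C_is_derive cv].
- by move=> i; apply: IH; exact: class_C_partial.
Qed.

Lemma class_CM k u v : class_C k u -> class_C k v ->
  class_C k (fun x => u x * v x).
Proof.
elim: k u v => [|k IH] u v cu cv.
  by split=> //; apply: contM; [exact: class_C_continuous cu|exact: class_C_continuous cv].
apply: (@class_C_intro _ _ (fun i x => u x * partial i v x + v x * partial i u x)).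
- by apply: contM; [exact: class_C_continuous cu|exact: class_C_continuous cv].
- by move=> i x; apply: (@is_deriveM _ _ u v); [exact: class_C_is_derive cu|exact: class_C_is_derive cv].
- move=> i; apply: class_CD; apply: IH; do ?[exact: class_CS|exact: class_C_partial].
Qed.

Definition smooth u := forall k, class_C k u.

Lemma smooth_cst c : smooth (fun _ : E => c).
Proof. by move=> k; exact: class_C_cst. Qed.

Lemma smooth_coord j : smooth (fun x : E => x ord0 j).
Proof. by move=> k; exact: class_C_coord. Qed.

Lemma smoothD u v : smooth u -> smooth v -> smooth (fun x => u x + v x).
Proof. by move=> cu cv k; exact: class_CD. Qed.

Lemma smoothM u v : smooth u -> smooth v -> smooth (fun x => u x * v x).
Proof. by move=> cu cv k; exact: class_CM. Qed.

Lemma smoothB u v : smooth u -> smooth v -> smooth (fun x => u x - v x).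
Proof.
move=> cu cv; rewrite (_ : (fun _ => _) = fun x => u x + -1 * v x).
  by apply: smoothD => //; apply: smoothM => //; exact: smooth_cst.
by apply/funext => x; rewrite mulN1r.
Qed.

Lemma smooth_sum (I : Type) (s : seq I) (F : I -> E -> R) :
  (forall i, smooth (F i)) -> smooth (fun x => \sum_(i <- s) F i x).
Proof.
move=> cF; elim: s => [|i s IH].
  by rewrite (_ : (fun _ => _) = fun=> 0); [exact: smooth_cst|apply/funext => x; rewrite big_nil].
rewrite (_ : (fun _ => _) = fun x => F i x + \sum_(j <- s) F j x).
  exact: smoothD.
by apply/funext => x; rewrite big_cons.
Qed.

Lemma smooth_prod (I : Type) (s : seq I) (F : I -> E -> R) :
  (forall i, smooth (F i)) -> smooth (fun x => \prod_(i <- s) F i x).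
Proof.
move=> cF; elim: s => [|i s IH].
  by rewrite (_ : (fun _ => _) = fun=> 1); [exact: smooth_cst|apply/funext => x; rewrite big_nil].
rewrite (_ : (fun _ => _) = fun x => F i x * \prod_(j <- s) F j x).
  exact: smoothM.
by apply/funext => x; rewrite big_cons.
Qed.

Lemma smooth_dot : smooth (fun x : E => dot x x).
Proof.
by apply: smooth_sum => i; apply: smoothM; exact: smooth_coord.
Qed.

(** The list of the successive derivatives is part of the data, because the
    induction in [smooth_comp] is about all of them at once. *)
Definition smooth_on (D : set R) (f : R -> R) := exists2 g : nat -> R -> R,
  g 0%N = f & forall j (t : R), D t -> is_derive t 1 (g j) (g j.+1 t).

Lemma is_derive_comp_dir (f : R -> R) u x y (a b : R) :
  is_derive (u x) 1 f a -> is_derive x y u b -> is_derive x y (f \o u) (a * b).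
Proof.
move=> fa ub; apply/is_derive_line0.
apply: (@is_derive1_comp _ f (fun t => u (t *: y + x))).
  by rewrite scale0r add0r.
exact/is_derive_line0.
Qed.

Lemma smooth_comp D f u : smooth_on D f -> smooth u -> (forall x, D (u x)) ->
  smooth (fun x => f (u x)).
Proof.
move=> [g <- dg] cu Du k.
have cg j : continuous (fun x => g j (u x)).
  move=> x; apply: continuous_comp; first exact: class_C_continuous (cu 0%N) _.
  apply/differentiable_continuous/derivable1_diffP.
  by have [] := dg j _ (Du x).
suff H : forall j, class_C k (fun x => g j (u x)) by exact: H.
elim: k => [|k IH] j; first by split.
apply: (@class_C_intro _ _ (fun i x => g j.+1 (u x) * partial i u x)) => //.
  move=> i x; apply: is_derive_comp_dir; first exact: dg.
  exact: class_C_is_derive (cu 1%N).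
by move=> i; apply: class_CM => //; exact: class_C_partial (cu k.+1).
Qed.

Lemma smooth_on_expR : smooth_on setT (@expR R).
Proof. by exists (fun _ => expR) => // j t _; exact: is_derive_expR. Qed.

Lemma smooth_on_inv_shift (c0 : R) : exists2 c : nat -> R, c 0%N = c0 &
  forall j (t : R), t != 0 ->
  is_derive t 1 (fun t => c j * t^-1 ^+ j.+1) (c j.+1 * t^-1 ^+ j.+2).
Proof.
exists (fun j => iteri j (fun i c => - (i.+1%:R * c)) c0) => // j t t0 /=.
set c := iteri _ _ _.
have dV : is_derive t 1 (fun t : R => t^-1) (- t ^- 2).
  by have := is_deriveV t0 (is_derive_id t 1); rewrite [_ *: 1]mulr1.
have E : c \*: (GRing.inv ^+ j.+1 : R -> R) = (fun t => c * t^-1 ^+ j.+1).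
  by apply/funext => s /=; rewrite exprfctE.
have := is_deriveZ c (is_deriveX j.+1 dV); rewrite E => dE.
apply: is_derive_eq dE _.
by rewrite /= /GRing.scale/= !exprS; field.
Qed.

Lemma smooth_on_inv : smooth_on [set t | t != 0] (@GRing.inv R).
Proof.
have [c c0 dc] := smooth_on_inv_shift 1.
exists (fun j t => c j * t^-1 ^+ j.+1); last exact: dc.
by apply/funext => t; rewrite c0 mul1r expr1.
Qed.

Lemma smooth_on_ln : smooth_on [set t | 0 < t] (@ln R).
Proof.
have [c c0 dc] := smooth_on_inv_shift 1.
exists (fun j => if j is j'.+1 then fun t => c j' * t^-1 ^+ j'.+1 else @ln R) => //.
case=> [|j] t t0; last by apply: dc; rewrite gt_eqF.
by rewrite c0 mul1r expr1; exact: is_derive1_ln.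
Qed.

End smooth.

(** * A smooth transition function *)

Section flat.
Variable R : realType.
Implicit Types (p : {poly R}) (t y : R).

Lemma exprn_le_expR (n : nat) y : 0 <= y -> y ^+ n <= n`!%:R * expR y.
Proof.
case: n => [|n] y0; first by rewrite expr0 mul1r -expR0 ler_expR.
have f0 : (0 : R) < n.+1`!%:R by rewrite ltr0n fact_gt0.
rewrite mulrC -ler_pdivrMr//; apply: le_trans (expR_ge1Dxn n y0).
by rewrite lerDr.
Qed.

Lemma poly_le_expR p : exists2 C : R, 0 <= C &
  forall y, 0 <= y -> `|p.[y]| <= C * expR y.
Proof.
exists (\sum_(i < size p) `|p`_i| * i`!%:R).
  by apply: sumr_ge0 => i _; rewrite mulr_ge0.
move=> y y0; rewrite horner_coef (le_trans (ler_norm_sum _ _ _))// mulr_suml.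
apply: ler_sum => i _; rewrite normrM -mulrA ler_wpM2l//.
by rewrite ger0_norm ?exprn_ge0// exprn_le_expR.
Qed.

(** With a polynomial factor in [1/t], the functions derived from [exp (- 1/t)]
    form a family closed under differentiation, and one computation proves the
    smoothness of all of them. *)
Definition flat p t : R := if 0 < t then p.[t^-1] * expR (- t^-1) else 0.

Lemma flat_bounded p : exists2 C : R, 0 <= C & forall t, `|flat p t| <= C.
Proof.
have [C C0 pC] := poly_le_expR p; exists C => // t; rewrite /flat.
case: ifPn => [t0|_]; last by rewrite normr0.
rewrite normrM (ger0_norm (expR_ge0 _)) expRN ler_pdivrMr ?expR_gt0//.
by apply: pC; rewrite invr_ge0 ltW.
Qed.

(** At 0 the difference quotient of [flat p] is [h * flat ('X^2 * p) h], which is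
    at most a constant times [`|h|]. *)
Lemma is_derive_flat p t :
  is_derive t 1 (flat p) (flat ('X^2 * (p - p^`())) t).
Proof.
have [t0|t0|->] := ltgtP t 0.
- rewrite {2}/flat ltNge (ltW t0)/=.
  apply: (@near_eq_is_derive _ _ _ (cst 0)).
  near=> s; rewrite /flat ltNge; suff -> : s <= 0 by [].
  by apply: ltW; near: s; exact: lt_nbhsl.
- have dV : is_derive t 1 (fun t : R => t^-1) (- t ^- 2).
    have tn0 : t != 0 by rewrite gt_eqF.
    by have := is_deriveV tn0 (is_derive_id t 1); rewrite [_ *: 1]mulr1.
  have dP := is_derive1_comp (is_derive_poly p t^-1) dV.
  have dN := is_deriveN dV.
  have dE := @is_derive1_comp _ expR (- (@GRing.inv R)) t _ _
    (is_derive_expR (- t^-1)) dN.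
  have dM := is_deriveM dP dE.
  rewrite {2}/flat t0.
  apply: (@near_eq_is_derive _ _ _ ((horner p \o GRing.inv) * (expR \o (- GRing.inv)))).
    near=> s; rewrite /flat; suff -> : 0 < s by [].
    by near: s; exact: lt_nbhsr.
  apply: is_derive_eq dM _.
  rewrite !hornerE /= /GRing.scale/=.
  have -> : (- GRing.inv : R -> R) t = - t^-1 by [].
  by field; rewrite gt_eqF.
- rewrite {2}/flat ltxx; apply/(@is_deriveP R R^o).
  have [C C0 pC] := flat_bounded ('X^2 * p).
  have C1 : 0 < C + 1 by lra.
  apply/cvgrPdist_le => /= e e0; near=> h.
  have h0 : h != 0 by near: h; exact: nbhs_dnbhs_neq.
  rewrite sub0r normrN addr0 [h *: 1]mulr1 {2}/flat ltxx subr0.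
  apply: (@le_trans _ _ (`|h| * C)); last first.
    have : `|h| < e / (C + 1) by near: h; apply: dnbhs0_lt; rewrite divr_gt0.
    rewrite ltr_pdivlMr// mulrDr mulr1 => /ltW; apply: le_trans.
    by rewrite lerDl.
  have -> : h^-1 * flat p h = h * flat ('X^2 * p) h.
    rewrite /flat; case: ifPn => _; rewrite ?mulr0// hornerM hornerXn.
    by field.
  by rewrite normrM ler_wpM2l.
Unshelve. all: by end_near. Qed.

Lemma smooth_on_flat p : smooth_on setT (flat p).
Proof.
exists (fun j => flat (iter j (fun q => 'X^2 * (q - q^`())) p)) => // j t _.
exact: is_derive_flat.
Qed.

End flat.

Section step.
Variable R : realType.
Implicit Types (s t e : R).

Definition expinv t : R := flat 1 t.

Lemma expinvE t : expinv t = if 0 < t then expR (- t^-1) else 0.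
Proof. by rewrite /expinv /flat hornerE; case: ifPn => // _; rewrite mul1r. Qed.

Lemma expinv_ge0 t : 0 <= expinv t.
Proof. by rewrite expinvE; case: ifPn. Qed.

Lemma expinv_gt0 t : 0 < t -> 0 < expinv t.
Proof. by rewrite expinvE => ->; exact: expR_gt0. Qed.

Lemma expinv_eq0 t : t <= 0 -> expinv t = 0.
Proof. by rewrite expinvE ltNge => ->. Qed.

Lemma expinv_le1 t : expinv t <= 1.
Proof.
rewrite expinvE; case: ifPn => // t0.
by rewrite -expR0 ler_expR oppr_le0 invr_ge0 ltW.
Qed.

Lemma expinv_den_gt0 t : 0 < expinv t + expinv (1 - t).
Proof.
have [t0|t0] := leP t 0.
  by rewrite ltr_wpDl ?expinv_ge0// expinv_gt0// subr_gt0 (le_lt_trans t0).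
by rewrite ltr_pwDl ?expinv_ge0// expinv_gt0.
Qed.

Definition step t : R := expinv t * (expinv t + expinv (1 - t))^-1.

Lemma step_ge0 t : 0 <= step t.
Proof. by rewrite mulr_ge0 ?expinv_ge0// invr_ge0 ltW// expinv_den_gt0. Qed.

Lemma step_le1 t : step t <= 1.
Proof.
by rewrite ler_pdivrMr ?expinv_den_gt0// mul1r lerDl expinv_ge0.
Qed.

Lemma step_eq0 t : t <= 0 -> step t = 0.
Proof. by move=> t0; rewrite /step expinv_eq0// mul0r. Qed.

Lemma step_eq1 t : 1 <= t -> step t = 1.
Proof.
move=> t1; rewrite /step (@expinv_eq0 (1 - t)) ?subr_le0// addr0 divff//.
by rewrite gt_eqF// expinv_gt0// (lt_le_trans ltr01).
Qed.

(** Positive everywhere and equal to the identity above [e]: composed with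
    [lift_above e], a function that is smooth on the positive reals only, such as
    the logarithm, becomes smooth on the whole line, without any change above
    [e].  Test functions vanish near the origin, so [|x|^2] may be lifted. *)
Definition lift_above e s : R := e + (s - e) * step (s * e^-1).

Lemma lift_above_id e s : 0 < e -> e <= s -> lift_above e s = s.
Proof.
by move=> e0 es; rewrite /lift_above step_eq1 ?mulr1 ?subrKC// ler_pdivlMr ?mul1r.
Qed.

Lemma lift_above_le e s : 0 < e -> s <= e -> lift_above e s <= e.
Proof.
move=> e0 es; rewrite /lift_above gerDl mulr_le0_ge0 ?step_ge0//.
by rewrite subr_le0.
Qed.

Lemma lift_above_gt0 e s : 0 < e -> 0 < lift_above e s.
Proof.
move=> e0; have [s0|s0] := leP s 0.
  by rewrite /lift_above step_eq0 ?mulr0 ?addr0// mulr_le0_ge0// invr_ge0 ltW.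
have [es|/ltW es] := leP e s; first by rewrite lift_above_id.
apply: (lt_le_trans s0); rewrite /lift_above -lerBlDl.
by rewrite ler_niMr ?subr_le0// step_le1.
Qed.

Variable N : nat.
Implicit Types u v : 'rV[R]_N -> R.

Lemma smooth_expinv u : smooth u -> smooth (fun x => expinv (u x)).
Proof. by move=> cu; apply: (smooth_comp (smooth_on_flat 1)). Qed.

Lemma smooth_step u : smooth u -> smooth (fun x => step (u x)).
Proof.
move=> cu; apply: smoothM; first exact: smooth_expinv.
apply: (smooth_comp (@smooth_on_inv R)) => [|x /=]; last by rewrite gt_eqF// expinv_den_gt0.
apply: smoothD; first exact: smooth_expinv.
by apply: smooth_expinv; apply: smoothB => //; exact: smooth_cst.
Qed.

Lemma smooth_lift_above e u : smooth u -> smooth (fun x => lift_above e (u x)).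
Proof.
move=> cu; apply: smoothD; first exact: smooth_cst.
apply: smoothM; first by apply: smoothB => //; exact: smooth_cst.
by apply: smooth_step; apply: smoothM => //; exact: smooth_cst.
Qed.

Lemma smooth_expR u : smooth u -> smooth (fun x => expR (u x)).
Proof. by move=> cu; apply: (smooth_comp (@smooth_on_expR R)). Qed.

Lemma smooth_ln_lift_above e u : 0 < e -> smooth u ->
  smooth (fun x => ln (lift_above e (u x))).
Proof.
move=> e0 cu; apply: (smooth_comp (@smooth_on_ln R)); first exact: smooth_lift_above.
by move=> x /=; exact: lift_above_gt0.
Qed.

End step.

(** * Test functions *)

Section support.
Variables (R : realType) (N : nat).
Local Notation E := 'rV[R]_N.
Implicit Types (u v : E -> R) (x : E).

Lemma dot_ge0 x : 0 <= dot x x.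
Proof. by apply: sumr_ge0 => i _; rewrite -expr2 sqr_ge0. Qed.

Lemma coord_sqr_le_dot x i : x ord0 i ^+ 2 <= dot x x.
Proof.
rewrite /dot (bigD1 i)//= expr2 lerDl.
by apply: sumr_ge0 => j _; rewrite -expr2 sqr_ge0.
Qed.

Lemma coord_le_norm x i : `|x ord0 i| <= `|x|.
Proof.
rewrite [leRHS]mx_normrE; exact: (le_bigmax _ (fun ij => `|x ij.1 ij.2|) (ord0, i)).
Qed.

Lemma norm_sqr_le_dot x : `|x| ^+ 2 <= dot x x.
Proof.
have [->|x0] := eqVneq `|x| 0; first by rewrite expr0n/= dot_ge0.
have [[i j] /= E1] := mx_norm_neq0 x0.
rewrite [`|x|]E1 (ord1 i) -normrX ger0_norm ?sqr_ge0//; exact: coord_sqr_le_dot.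
Qed.

Lemma dot_le_norm_sqr x : dot x x <= N%:R * `|x| ^+ 2.
Proof.
rewrite [leRHS](_ : _ = \sum_(i < N) `|x| ^+ 2); last first.
  by rewrite sumr_const card_ord mulr_natl.
apply: ler_sum => i _; rewrite -expr2 -[leLHS]ger0_norm ?sqr_ge0// normrX.
by rewrite lerXn2r ?nnegrE// coord_le_norm.
Qed.

Lemma dotZ l x : dot (l *: x) (l *: x) = l ^+ 2 * dot x x.
Proof.
by rewrite /dot mulr_sumr; apply: eq_bigr => i _; rewrite !mxE; ring.
Qed.

Lemma dot_gt0 x : x != 0 -> 0 < dot x x.
Proof.
move=> x0; apply: lt_le_trans (norm_sqr_le_dot x).
by rewrite exprn_gt0// normr_gt0.
Qed.

Lemma dot00 : dot (0 : E) 0 = 0.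
Proof. by rewrite /dot big1// => i _; rewrite mxE mul0r. Qed.

Lemma Cc_infty_intro u (a b : R) : smooth u -> 0 < a ->
  (forall x, u x != 0 -> a <= dot x x <= b) -> Cc_infty u.
Proof.
move=> cu a0 ab; pose T := [set x : E | a <= dot x x <= b].
have clT : closed T.
  rewrite (_ : T = (fun x => dot x x) @^-1` `[a, b]%classic); last first.
    by apply/seteqP; split=> x /=; rewrite in_itv.
  apply: closed_comp; last exact: itv_closed.
  by move=> x _; exact: continuous_dot.
have ST : closure [set x | u x != 0] `<=` T.
  by rewrite [X in _ `<=` X](closure_id _).1//; apply: closure_subset => x /ab.
split=> //; last by move=> /ST; rewrite /T/= dot00 leNgt a0.
apply: bounded_closed_compact; last exact: closed_closure.
exists (`|b| + 1); split; first by rewrite num_real.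
move=> M bM x /ST /andP[_ xb].
have M1 : 1 <= M by rewrite (le_trans _ (ltW bM))// lerDr.
have := le_trans (norm_sqr_le_dot x) xb; have := normr_ge0 x.
have : b <= M by rewrite (le_trans (ler_norm b))// (le_trans _ (ltW bM))// lerDl.
move=> bM' x0 xb'; suff : `|x| <= M by [].
by rewrite leNgt; apply/negP => Mx; nra.
Qed.

Lemma Cc_infty_smooth u : Cc_infty u -> smooth u.
Proof. by case. Qed.

Lemma Cc_infty_away u : Cc_infty u ->
  exists2 e : R, 0 < e & forall x, u x != 0 -> e <= dot x x.
Proof.
move=> [_ _ n0]; have : nbhs (0 : E) (~` closure [set x | u x != 0]).
  by apply: open_nbhs_nbhs; split => //; rewrite openC; exact: closed_closure.
move=> /nbhs_ballP[r /= r0 rS]; exists (r ^+ 2); first by rewrite exprn_gt0.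
move=> x ux; rewrite leNgt; apply/negP => xr; apply: (rS x); last exact: subset_closure.
rewrite -ball_normE/= sub0r normrN -(ltr_pXn2r (_ : 0 < 2)%N) ?nnegrE ?(ltW r0)//.
exact: le_lt_trans (norm_sqr_le_dot x) xr.
Qed.

Lemma Cc_infty_bounded u : Cc_infty u ->
  exists2 M : R, 0 < M & forall x, u x != 0 -> `|x| <= M.
Proof.
move=> [_ /compact_bounded bK _]; have [M M0 HM] := pinfty_ex_gt0 bK.
by exists M => // x ux; apply: HM; exact: subset_closure.
Qed.

Lemma Cc_inftyM u m : Cc_infty u -> smooth m -> Cc_infty (fun x => u x * m x).
Proof.
move=> cu cm; have [e e0 ue] := Cc_infty_away cu.
have [M M0 uM] := Cc_infty_bounded cu.
apply: (@Cc_infty_intro _ e (N%:R * M ^+ 2)) => //.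
  by apply: smoothM => //; exact: Cc_infty_smooth.
move=> x; rewrite mulf_eq0 negb_or => /andP[ux _]; rewrite ue//=.
apply: le_trans (dot_le_norm_sqr x) _.
by rewrite ler_wpM2l// lerXn2r ?nnegrE ?uM// ltW.
Qed.

End support.

(** * Domination by gaussians *)

Section domination.
Variables (R : realType) (N : nat).
Local Notation E := 'rV[R]_N.
Local Notation L := (lebesgue_rV R N).
Implicit Types (f : E -> R) (x : E).

Definition gaussian (c : R) x : R := expR (- (c * dot x x)).

Lemma measurable_gaussian (c : R) : measurable_fun setT (gaussian c).
Proof.
apply: (measurableT_comp (@measurable_expR R)); apply: measurableT_comp => //.
by apply: measurable_funM => //; exact: measurable_dot.
Qed.

Lemma gaussian_ge0 (c : R) x : 0 <= gaussian c x. Proof. exact: expR_ge0. Qed.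

Lemma integrable_gaussian (c : R) : 0 < c -> L.-integrable setT (EFin \o gaussian c).
Proof.
move=> c0; apply/integrableP; split.
  by apply/measurable_EFinP; exact: measurable_gaussian.
under eq_integral => x _ do rewrite /= ger0_norm ?gaussian_ge0//.
exact: gaussian_finite.
Qed.

Lemma integrable_le_gaussian f (C : R) : measurable_fun setT f ->
  (forall x, `|f x| <= C * gaussian 1 x) -> L.-integrable setT (EFin \o f).
Proof.
move=> mf fC.
apply: (le_integrable measurableT) (integrableZl measurableT C (integrable_gaussian ltr01)).
  exact/measurable_EFinP.
move=> x _ /=; rewrite lee_fin; apply: le_trans (fC x) _.
exact: ler_norm.
Qed.

(** Gaussians are the dominating functions of all the limits below; this covers
    the test functions. *)
Lemma bounded_support_le_gaussian f (M C : R) : 0 <= C ->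
  (forall x, `|x| <= M -> `|f x| <= C) -> (forall x, M < `|x| -> f x = 0) ->
  forall x, `|f x| <= C * expR (N%:R * M ^+ 2) * gaussian 1 x.
Proof.
move=> C0 fC f0 x; have [xM|Mx] := leP `|x| M; last first.
  by rewrite f0// normr0 !mulr_ge0 ?expR_ge0.
apply: le_trans (fC _ xM) _; rewrite -mulrA ler_peMr// /gaussian mul1r -expRD -[leLHS]expR0 ler_expR.
rewrite subr_ge0; apply: le_trans (dot_le_norm_sqr x) _.
by rewrite ler_wpM2l// lerXn2r ?nnegrE// (le_trans _ xM).
Qed.

Lemma continuous_bounded_ball f (M : R) : continuous f ->
  exists2 C : R, 0 <= C & forall x, `|x| <= M -> `|f x| <= C.
Proof.
move=> cf; have cB : compact [set x : E | `|x| <= M].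
  apply: bounded_closed_compact.
    exists M; split; first by rewrite num_real.
    by move=> m Mm x /= xM; rewrite (le_trans xM)// ltW.
  apply: (@closed_comp _ _ (@Num.norm R E) [set y | y <= M]).
    by move=> x _; exact: norm_continuous.
  exact: closed_le.
have /compact_bounded/pinfty_ex_gt0[C C0 HC] : compact (f @` [set x : E | `|x| <= M]).
  by apply: continuous_compact => //; exact: continuous_subspaceT.
by exists C; [exact: ltW|move=> x xM; apply: HC; exists x].
Qed.

End domination.

(** * The derivative along dilations and its integral *)

Section euler.
Variables (R : realType) (N : nat).
Local Notation E := 'rV[R]_N.
Local Notation L := (lebesgue_rV R N).
Implicit Types (u v w : E -> R) (x : E).

(** The Euler operator, the infinitesimal generator of dilations. *)
Definition euler v x : R := dot (gradient v x) x.

Lemma is_derive_euler v x : smooth v -> is_derive x x v (euler v x).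
Proof. by move=> /(_ 1%N); exact: class_C1_is_derive. Qed.

Lemma smooth_euler v : smooth v -> smooth (euler v).
Proof.
move=> cv; apply: smooth_sum => i; apply: smoothM; last exact: smooth_coord.
rewrite (_ : (fun _ => _) = partial i v); last by apply/funext => x; rewrite mxE.
by move=> k; apply: class_C_partial; exact: cv.
Qed.

Lemma euler_unique v x d : smooth v -> is_derive x x v d -> euler v x = d.
Proof. by move=> cv [_ <-]; have [_ <-] := is_derive_euler x cv. Qed.

Lemma euler_near0 v x : smooth v -> (\near x, v x = 0) -> euler v x = 0.
Proof.
move=> cv v0; apply: euler_unique => //.
apply: (@near_eq_is_derive _ _ _ (cst 0)).
by near do apply/esym.
Unshelve. all: by end_near. Qed.

Lemma euler_sqr v x : smooth v -> euler (fun y => v y * v y) x = 2 * (v x * euler v x).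
Proof.
move=> cv; apply: euler_unique; first exact: smoothM.
have d := is_derive_euler x cv.
apply: is_derive_eq (is_deriveM d d) _.
by rewrite /GRing.scale/=; ring.
Qed.

Lemma euler_eq0_outside v (M : R) x : smooth v ->
  (forall y, v y != 0 -> `|y| <= M) -> M < `|x| -> euler v x = 0.
Proof.
move=> cv vM Mx; apply: euler_near0 => //.
have : \near x, M < `|x|.
  have /cvgr_gt := (@norm_continuous R E x); exact.
apply: filterS => y My; apply: contraTeq My => /vM; by rewrite leNgt.
Qed.

Lemma euler_eq0_inside v (e : R) x : smooth v ->
  (forall y, v y != 0 -> e <= dot y y) -> dot x x < e -> euler v x = 0.
Proof.
move=> cv ve xe; apply: euler_near0 => //.
have : \near x, dot x x < e.
  have /cvgr_lt := (@continuous_dot R N x); exact.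
apply: filterS => y ye; apply: contraTeq ye => /ve; by rewrite leNgt.
Qed.

Lemma smooth_measurable v : smooth v -> measurable_fun setT v.
Proof. by move=> /(_ 0%N)/class_C_continuous/continuous_rV_measurable. Qed.

Lemma cvg_EFin_seq (a : nat -> R) (l : R) : a @ \oo --> l ->
  (fun n => (a n)%:E) @ \oo --> l%:E.
Proof. by move=> al; apply: cvg_EFin => //; exact: nearW. Qed.

Lemma harmonic_dnbhs : (n.+1%:R^-1 : R) @[n --> \oo] --> 0^'.
Proof.
move=> A /= A0.
have : \forall n \near \oo, (@harmonic R n != 0 -> A (@harmonic R n)).
  exact: @cvg_harmonic R _ A0.
by apply: filterS => n /=; apply; rewrite /harmonic/= invr_eq0 pnatr_eq0.
Qed.

(** The integral of [x |-> w (l *: x)] is [l ^- N] times that of [w], and [- N] is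
    the derivative of [l ^- N] at [l = 1].  The derivative passes under the
    integral because the difference quotients, for [l = 1 + 1 / n.+1], are
    uniformly bounded by the mean value theorem and vanish outside a fixed
    ball. *)
Lemma integral_euler w : Cc_infty w -> (forall x, 0 <= w x) ->
  (\int[L]_x (euler w x)%:E = (- N%:R)%:E * \int[L]_x (w x)%:E)%E.
Proof.
move=> cw w0; have sw := Cc_infty_smooth cw.
have [M M0 wM] := Cc_infty_bounded cw.
pose l n : R := n.+1%:R^-1.
have l0 n : 0 < l n by rewrite invr_gt0.
have l1 n : l n <= 1 by rewrite invf_le1// ler1n.
pose f n x : R := n.+1%:R * (w (l n *: x + x) - w x).
have mw : measurable_fun setT w by exact: smooth_measurable.
have lE n x : l n *: x + x = (1 + l n) *: x by rewrite scalerDl scale1r addrC.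
have lp n : 0 < 1 + l n by rewrite addr_gt0.
have mf n : measurable_fun setT (f n).
  apply: measurable_funM => //; apply: measurable_funB => //.
  apply: (measurableT_comp mw); under eq_fun do rewrite lE.
  exact: measurable_rV_scale.
have [C1 C10 wC1] : exists2 C1 : R, 0 <= C1 &
    forall z x, `|z| <= 2 * M -> `|x| <= M -> `|dot (gradient w z) x| <= C1.
  have D i : exists C : R, 0 <= C /\ forall z, `|z| <= 2 * M -> `|partial i w z| <= C.
    have [C C0 HC] := @continuous_bounded_ball R N (partial i w) (2 * M)
      (class_C_continuous (class_C_partial i (sw 1%N))).
    by exists C.
  have [C HC] := choice D.
  exists (\sum_i C i * M).
    by apply: sumr_ge0 => i _; apply: mulr_ge0; [have [] := HC i|exact: ltW].
  move=> z x zM xM; apply: le_trans (ler_norm_sum _ _ _) _; apply: ler_sum => i _.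
  rewrite mxE normrM ler_pM//; first by have [_] := HC i; apply.
  exact: le_trans (coord_le_norm _ _) xM.
have fC n x : `|x| <= M -> `|f n x| <= C1.
  move=> xM; pose g t := w (t *: x + x).
  have gd (s : R) : is_derive s 1 g (dot (gradient w (s *: x + x)) x).
    by apply/is_derive_line; apply: class_C1_is_derive; exact: sw.
  have [s sl] := MVT_origin (l n) gd.
  rewrite /f /g scale0r add0r => ->; rewrite mulrCA mulfV ?mulr1 ?pnatr_eq0//.
  apply: wC1 => //; rewrite (le_trans (ler_normD _ _))// normrZ.
  have s1 : `|s| <= 1 by rewrite (le_trans sl)// gtr0_norm.
  have := normr_ge0 x; have := normr_ge0 s; nra.
have f0 n x : M < `|x| -> f n x = 0.
  move=> Mx; have w0' y : M < `|y| -> w y = 0.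
    by move=> My; apply: contraTeq My => /wM; rewrite leNgt.
  rewrite /f !w0' ?subrr ?mulr0// lE normrZ gtr0_norm// (lt_le_trans Mx)//.
  by rewrite ler_peMl// lerDl ltW.
have fG n := bounded_support_le_gaussian C10 (fC n) (f0 n).
set C2 := C1 * expR _ in fG.
have ff x : f n x @[n --> \oo] --> euler w x.
  have /is_deriveP H := is_derive_euler x sw.
  have := cvg_comp _ _ harmonic_dnbhs H.
  by apply: cvg_trans; apply: near_eq_cvg; near=> n; rewrite /= /f /l invrK.
have me : measurable_fun setT (euler w).
  by apply: smooth_measurable; exact: smooth_euler.
have [|||_ _ cvgf] := @dominated_convergence _ _ R L setT measurableT
  (fun n => EFin \o f n) (EFin \o euler w) (fun x => C2%:E * (EFin \o @gaussian R N 1) x)%E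
  (fun n => (measurable_EFinP _ _).2 (mf n)) ((measurable_EFinP _ _).2 me).
- by apply: aeW => x _; exact: cvg_EFin_seq.
- exact: (integrableZl measurableT C2 (integrable_gaussian N ltr01)).
- by apply: aeW => x n _; rewrite /= lee_fin; exact: fG.
have wint : L.-integrable setT (EFin \o w).
  have [C C0 wC] := continuous_bounded_ball M (class_C_continuous (sw 0%N)).
  apply: integrable_le_gaussian mw _.
  apply: bounded_support_le_gaussian C0 wC _ => y My.
  by apply: contraTeq My => /wM; rewrite leNgt.
pose I := fine (\int[L]_x (w x)%:E)%E.
have IE : (\int[L]_x (w x)%:E = I%:E)%E.
  by rewrite fineK//; exact: integrable_fin_num wint.
have swint n : (\int[L]_x (w (l n *: x + x))%:E = ((1 + l n) ^- N * I)%:E)%E.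
  under eq_integral => x _ do rewrite lE.
  rewrite (ge0_integral_scale (lp n) (f := EFin \o w)) ?IE ?EFinM//.
  exact/measurable_EFinP.
have intf n : (\int[L]_x (f n x)%:E = (n.+1%:R * (((1 + l n)^-1) ^+ N * I - I))%:E)%E.
  have swi : L.-integrable setT (fun x => (w (l n *: x + x))%:E).
    apply/integrableP; split.
      apply/measurable_EFinP; apply: (measurableT_comp mw).
      under eq_fun do rewrite lE.
      exact: measurable_rV_scale.
    under eq_integral => x _ do rewrite /= ger0_norm//.
    by rewrite swint ltry.
  under eq_integral => x _ do rewrite /f EFinM EFinB.
  rewrite integralZl//; last exact: integrableB.
  by rewrite integralB// swint IE -EFinB -EFinM exprVn.
have cvgI : (fun n => n.+1%:R * (((1 + l n)^-1) ^+ N * I - I)) @ \oo --> - N%:R * I.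
  have d0 : is_derive (0:R) 1 (fun t : R => 1 + t) 1.
    have := is_deriveD (is_derive_cst (1:R) (0:R) 1) (is_derive_id (0:R) 1).
    by rewrite add0r.
  have n0 : (fun t : R => 1 + t) 0 != 0 by rewrite /= addr0 oner_eq0.
  have := is_deriveZ I (is_deriveX N (is_deriveV n0 d0)).
  move=> /is_deriveP H; have := cvg_comp _ _ harmonic_dnbhs H.
  rewrite /= /GRing.scale/= !exprfctE/= addr0 invr1 !expr1n !mulr1.
  rewrite (_ : I * (N%:R * - 1^-1) = - N%:R * I); last by field.
  apply: cvg_trans; apply: near_eq_cvg; near=> n.
  by rewrite /= invrK mulr1 addr0 -/(l n); ring.
have E1 : (fun n => \int[L]_x (f n x)%:E)%E @ \oo --> (- N%:R * I)%:E.
  by under eq_fun do rewrite intf; exact: cvg_EFin_seq.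
rewrite IE -EFinM; exact: (cvg_unique _ cvgf E1).
Unshelve. all: by end_near. Qed.

End euler.

(** * The two inequalities *)

Section gauge_dot.
Variables (R : realType) (N : nat) (K : set 'rV[R]_N).
Hypothesis K_Kss : Kss_o K.
Local Notation h := (minkowski_functional K).

Lemma gauge_dot_lower : exists2 c : R, 0 < c & forall x, c * dot x x <= h x ^+ 2.
Proof.
have [c c0 hc] := gauge_lower K_Kss; exists (c ^+ 2 / N.+1%:R).
  by rewrite divr_gt0// exprn_gt0.
move=> x; apply: (@le_trans _ _ ((c * `|x|) ^+ 2)); last first.
  by rewrite lerXn2r ?nnegrE ?gauge_ge0// mulr_ge0// ltW.
rewrite exprMn -mulrA ler_wpM2l ?sqr_ge0// mulrC ler_pdivrMr// mulrC.
apply: le_trans (dot_le_norm_sqr x) _.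
by rewrite ler_wpM2r ?sqr_ge0// ler_nat.
Qed.

Lemma gauge_dot_upper : exists2 c : R, 0 < c & forall x, h x ^+ 2 <= c * dot x x.
Proof.
have [c c0 hc] := gauge_upper K_Kss; exists (c ^+ 2); first by rewrite exprn_gt0.
move=> x; apply: (@le_trans _ _ ((c * `|x|) ^+ 2)).
  by rewrite lerXn2r ?nnegrE ?gauge_ge0// mulr_ge0// ltW.
by rewrite exprMn ler_wpM2l ?sqr_ge0// norm_sqr_le_dot.
Qed.

End gauge_dot.

Section inequality.
Variables (R : realType) (N : nat) (K : set 'rV[R]_N).
Hypothesis K_Kss : Kss_o K.
Local Notation h := (minkowski_functional K).
Local Notation E := 'rV[R]_N.
Local Notation L := (lebesgue_rV R N).
Implicit Types (u v g : E -> R) (x : E).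

Lemma radial_derivativeE v x : radial_derivative K v x = (h x)^-1 * euler v x.
Proof.
rewrite /radial_derivative /euler /dot mulr_sumr; apply: eq_bigr => i _.
by rewrite !mxE mulrCA.
Qed.

Lemma euler_radial v x : euler v x = h x * radial_derivative K v x.
Proof.
rewrite radial_derivativeE; have [->|x0] := eqVneq x 0.
  by rewrite (gauge0 K_Kss) mul0r /euler /dot big1// => i _; rewrite !mxE mulr0.
by rewrite mulrA divff ?mul1r// gt_eqF// gauge_gt0.
Qed.

Lemma measurable_radial_derivative v : smooth v ->
  measurable_fun setT (radial_derivative K v).
Proof.
move=> cv; rewrite (_ : radial_derivative K v = fun x => (h x)^-1 * euler v x).
  apply: measurable_funM; last by apply: smooth_measurable; exact: smooth_euler.
  apply: (measurableT_comp (@measurable_invr R)); exact: measurable_gauge.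
by apply/funext => x; rewrite radial_derivativeE.
Qed.

Lemma sq_integralE g : sq_integral g = (\int[L]_x (g x ^+ 2)%:E)%E.
Proof. by apply: eq_integral => x _; rewrite real_normK ?num_real. Qed.

Lemma continuous_bounded_support_integrable (f : E -> R) (M : R) : continuous f ->
  (forall x, M < `|x| -> f x = 0) -> L.-integrable setT (EFin \o f).
Proof.
move=> cf f0; have [C C0 fC] := continuous_bounded_ball M cf.
apply: integrable_le_gaussian (continuous_rV_measurable cf) _.
exact: bounded_support_le_gaussian C0 fC f0.
Qed.

(** The last clause is the integral of the square of [R_K v + t h v], whose cross
    term [2 t v * euler v] is [t] times the Euler derivative of [v^2].  The
    integral of [(R_K v)^2] is finite because [euler v] vanishes near the origin,
    where [h^-1] is unbounded. *)
Lemma integral_sqr_family v : Cc_infty v -> exists A B S : R,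
  [/\ sq_integral (radial_derivative K v) = A%:E,
      weighted_sq_integral K v = B%:E, sq_integral v = S%:E,
      [/\ 0 <= A, 0 <= B & 0 <= S] &
      forall t : R, 0 <= A + t ^+ 2 * B - t * (N%:R * S)].
Proof.
move=> cv; have sv := Cc_infty_smooth cv.
have [M M0 vM] := Cc_infty_bounded cv.
have [e e0 ve] := Cc_infty_away cv.
have v0 y : M < `|y| -> v y = 0.
  by move=> My; apply: contraTeq My => /vM; rewrite leNgt.
have e0' y : M < `|y| -> euler v y = 0 by exact: euler_eq0_outside.
have cont f : smooth f -> continuous f by move=> /(_ 0%N)/class_C_continuous.
have mR := measurable_radial_derivative sv.
have mh := measurable_gauge K_Kss.
have mv := smooth_measurable sv.
have se := smooth_euler sv.
have iS : L.-integrable setT (EFin \o (fun x => v x * v x)).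
  apply: (@continuous_bounded_support_integrable _ M).
    by apply: cont; exact: smoothM.
  by move=> x Mx; rewrite v0// mul0r.
have iX : L.-integrable setT (EFin \o (fun x => v x * euler v x)).
  apply: (@continuous_bounded_support_integrable _ M).
    by apply: cont; exact: smoothM.
  by move=> x Mx; rewrite v0// mul0r.
have iA : L.-integrable setT (EFin \o (fun x => radial_derivative K v x ^+ 2)).
  have [c c0 hc] := gauge_dot_lower K_Kss.
  have iE : L.-integrable setT (EFin \o (fun x => euler v x * euler v x)).
    apply: (@continuous_bounded_support_integrable _ M).
      by apply: cont; exact: smoothM.
    by move=> x Mx; rewrite e0'// mul0r.
  apply: (le_integrable measurableT) (integrableZl measurableT (c * e)^-1 iE).
    by apply/measurable_EFinP; exact: measurable_funX.
  move=> x _ /=; rewrite lee_fin ger0_norm ?sqr_ge0//.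
  apply: le_trans (ler_norm _).
  rewrite radial_derivativeE exprMn -expr2.
  have [xe|ex] := ltP (dot x x) e.
    by rewrite (euler_eq0_inside sv ve xe) expr0n/= !mulr0.
  have hx0 : 0 < h x.
    by apply: gauge_gt0 => //; apply: contraTneq ex => ->; rewrite dot00 -ltNge.
  rewrite ler_wpM2r ?sqr_ge0// exprVn lef_pV2 ?posrE ?exprn_gt0 ?mulr_gt0//.
  by apply: le_trans (hc x); rewrite ler_wpM2l// ltW.
have iB : L.-integrable setT (EFin \o (fun x => h x ^+ 2 * v x ^+ 2)).
  have [c c0 hc] := gauge_dot_upper K_Kss.
  have iD : L.-integrable setT (EFin \o (fun x => dot x x * (v x * v x))).
    apply: (@continuous_bounded_support_integrable _ M).
      by apply: cont; apply: smoothM; [exact: smooth_dot|exact: smoothM].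
    by move=> x Mx; rewrite v0// !mulr0.
  apply: (le_integrable measurableT) (integrableZl measurableT c iD).
    by apply/measurable_EFinP; apply: measurable_funM; exact: measurable_funX.
  move=> x _ /=; rewrite lee_fin ger0_norm; last by rewrite mulr_ge0 ?sqr_ge0.
  apply: le_trans (ler_norm _).
  rewrite [leRHS](_ : _ = c * dot x x * v x ^+ 2); last by ring.
  by rewrite ler_wpM2r ?sqr_ge0.
pose A := fine (\int[L]_x (radial_derivative K v x ^+ 2)%:E)%E.
pose B := fine (\int[L]_x (h x ^+ 2 * v x ^+ 2)%:E)%E.
pose S := fine (\int[L]_x (v x * v x)%:E)%E.
have AE : (\int[L]_x (radial_derivative K v x ^+ 2)%:E = A%:E)%E.
  by rewrite fineK//; exact: integrable_fin_num iA.
have BE : (\int[L]_x (h x ^+ 2 * v x ^+ 2)%:E = B%:E)%E.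
  by rewrite fineK//; exact: integrable_fin_num iB.
have SE : (\int[L]_x (v x * v x)%:E = S%:E)%E.
  by rewrite fineK//; exact: integrable_fin_num iS.
have XE : (\int[L]_x (v x * euler v x)%:E = (- (N%:R * S) / 2)%:E)%E.
  have vv0 x : 0 <= v x * v x by rewrite -expr2 sqr_ge0.
  have H := integral_euler (Cc_inftyM cv sv) vv0.
  have {}H : (\int[L]_x (2%:E * (v x * euler v x)%:E) = (- N%:R * S)%:E)%E.
    rewrite EFinM -SE -H.
    by apply: eq_integral => x _; rewrite euler_sqr.
  rewrite integralZl// in H.
  have : (2^-1%:E * (2%:E * \int[L]_x (v x * euler v x)%:E) = 2^-1%:E * (- N%:R * S)%:E)%E.
    by rewrite H.
  by rewrite muleA -!EFinM mulVf// mul1e => ->; congr (_ %:E); lra.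
exists A, B, S; split.
- by rewrite sq_integralE.
- by [].
- by rewrite sq_integralE.
- split; rewrite -lee_fin -?AE -?BE -?SE; apply: integral_ge0 => x _; rewrite lee_fin.
  + exact: sqr_ge0.
  + by rewrite mulr_ge0 ?sqr_ge0.
  + by rewrite -expr2 sqr_ge0.
- move=> t.
  have : (0 <= \int[L]_x ((radial_derivative K v x + t * (h x * v x)) ^+ 2)%:E)%E.
    by apply: integral_ge0 => x _; rewrite lee_fin sqr_ge0.
  under eq_integral => x _.
    rewrite (_ : (_ ^+ 2)%:E = (radial_derivative K v x ^+ 2)%:E +
      ((t ^+ 2)%:E * (h x ^+ 2 * v x ^+ 2)%:E + (2 * t)%:E * (v x * euler v x)%:E))%E; last first.
      by rewrite -!EFinM -!EFinD (euler_radial v x); congr (_%:E); ring.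
    over.
  have iB' := integrableZl measurableT (t ^+ 2) iB.
  have iX' := integrableZl measurableT (2 * t) iX.
  rewrite integralD//; last exact: integrableD.
  rewrite integralD// !integralZl// AE BE XE -!EFinM -!EFinD lee_fin.
  by congr (_ <= _); field.
Qed.

Lemma heisenberg_sum v : Cc_infty v ->
  (N%:R%:E * sq_integral v <=
   sq_integral (radial_derivative K v) + weighted_sq_integral K v)%E.
Proof.
move=> /integral_sqr_family[A [B [S [-> -> -> _ /(_ 1)]]]].
rewrite -EFinM -EFinD lee_fin; lra.
Qed.

(** The polynomial of [integral_sqr_family] is evaluated at its minimum
    [t = N S / (2 B)]; if [B = 0] it is affine, and then its slope is 0. *)
Lemma heisenberg_product v : Cc_infty v ->
  ((N%:R / 2)%:E * sq_integral v <=
   sqrte (sq_integral (radial_derivative K v)) *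
   sqrte (weighted_sq_integral K v))%E.
Proof.
move=> /integral_sqr_family[A [B [S [-> -> -> [A0 B0 S0] H]]]].
rewrite /= -!EFinM lee_fin -sqrtrM//.
have NS0 : 0 <= N%:R / 2 * S by rewrite !mulr_ge0.
rewrite -[leLHS]ger0_norm// -sqrtr_sqr ler_sqrt ?mulr_ge0//.
have [B0'|B0'] := eqVneq B 0.
  have : N%:R * S = 0.
    have [//|NSn] := eqVneq (N%:R * S) 0.
    have := H ((A + 1) / (N%:R * S)).
    by rewrite divfK// B0' mulr0; lra.
  move=> E0; rewrite B0' mulr0 (_ : _ / 2 * S = (N%:R * S) / 2); last by ring.
  by rewrite E0 mul0r expr0n.
have Bp : 0 < B by rewrite lt_neqAle eq_sym B0'.
have := H (N%:R * S / (2 * B)).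
rewrite (_ : A + _ - _ = A - (N%:R / 2 * S) ^+ 2 / B); last by field.
by rewrite subr_ge0 ler_pdivrMr.
Qed.

End inequality.

(** * The closure of the test functions *)

Section closure.
Variables (R : realType) (N : nat) (K : set 'rV[R]_N).
Hypothesis K_Kss : Kss_o K.
Local Notation h := (minkowski_functional K).
Local Notation E := 'rV[R]_N.
Local Notation L := (lebesgue_rV R N).
Implicit Types (u v g m : E -> R) (x : E).

(** The norm of the completion with an additional [L^2] term.  By the inequality
    for the sum the two norms are equivalent on test functions; with the
    additional term the [L^2] norm is continuous by definition. *)
Definition energy_density u g x : R := (1 + h x ^+ 2) * u x ^+ 2 + g x ^+ 2.
Definition energy u g : \bar R := (\int[L]_x (energy_density u g x)%:E)%E.

Definition approximable u g : Prop :=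
  [/\ measurable_fun [set: E] u, measurable_fun [set: E] g &
      forall e : R, 0 < e -> exists2 v, Cc_infty v &
        (energy (fun x => v x - u x)%R (fun x => radial_derivative K v x - g x)%R <= e%:E)%E].

Lemma energy_density_ge0 u g x : 0 <= energy_density u g x.
Proof.
apply: addr_ge0; last exact: sqr_ge0.
apply: mulr_ge0; last exact: sqr_ge0.
by apply: addr_ge0 => //; exact: sqr_ge0.
Qed.

Lemma measurable_energy_density u g : measurable_fun setT u ->
  measurable_fun setT g -> measurable_fun setT (energy_density u g).
Proof.
move=> mu mg; apply: measurable_funD; last exact: measurable_funX.
apply: measurable_funM; last exact: measurable_funX.
by apply: measurable_funD => //; apply: measurable_funX; exact: measurable_gauge.
Qed.

Lemma energy_le (C : R) u g u' g' : 0 <= C ->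
  measurable_fun setT u -> measurable_fun setT g ->
  measurable_fun setT u' -> measurable_fun setT g' ->
  (forall x, energy_density u g x <= C * energy_density u' g' x) ->
  (energy u g <= C%:E * energy u' g')%E.
Proof.
move=> C0 mu mg mu' mg' H.
rewrite /energy -ge0_integralZl//.
- apply: ge0_le_integral => //.
  + by move=> x _; rewrite lee_fin energy_density_ge0.
  + by apply/measurable_EFinP; exact: measurable_energy_density.
  + apply/measurable_EFinP; apply: measurable_funM => //.
    exact: measurable_energy_density.
  + by move=> x _; rewrite -EFinM lee_fin.
- by apply/measurable_EFinP; exact: measurable_energy_density.
- by move=> x _; rewrite lee_fin energy_density_ge0.
Qed.

Lemma energy_triangle u1 g1 u2 g2 u3 g3 :
  measurable_fun setT u1 -> measurable_fun setT g1 ->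
  measurable_fun setT u2 -> measurable_fun setT g2 ->
  measurable_fun setT u3 -> measurable_fun setT g3 ->
  (forall x, u3 x = u1 x + u2 x) -> (forall x, g3 x = g1 x + g2 x) ->
  (energy u3 g3 <= 2%:E * energy u1 g1 + 2%:E * energy u2 g2)%E.
Proof.
move=> mu1 mg1 mu2 mg2 mu3 mg3 uE gE.
have m1 := measurable_energy_density mu1 mg1.
have m2 := measurable_energy_density mu2 mg2.
rewrite /energy -!ge0_integralZl//; [|
  by apply/measurable_EFinP|by move=> x _; rewrite lee_fin energy_density_ge0|
  by apply/measurable_EFinP|by move=> x _; rewrite lee_fin energy_density_ge0].
rewrite -ge0_integralD//; last 4 first.
- by move=> x _; rewrite -EFinM lee_fin mulr_ge0 ?energy_density_ge0.
- by apply/measurable_EFinP; apply: measurable_funM.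
- by move=> x _; rewrite -EFinM lee_fin mulr_ge0 ?energy_density_ge0.
- by apply/measurable_EFinP; apply: measurable_funM.
apply: ge0_le_integral => //.
- by move=> x _; rewrite lee_fin energy_density_ge0.
- by apply/measurable_EFinP; exact: measurable_energy_density.
- by apply/measurable_EFinP; apply: measurable_funD; apply: measurable_funM.
- move=> x _; rewrite -!EFinM -EFinD lee_fin /energy_density uE gE.
  have H1 : 0 <= 1 + h x ^+ 2 by apply: addr_ge0 => //; exact: sqr_ge0.
  have H2 : (1 + h x ^+ 2) * (u1 x + u2 x) ^+ 2 <=
      (1 + h x ^+ 2) * (2 * u1 x ^+ 2 + 2 * u2 x ^+ 2).
    by rewrite ler_wpM2l//; have := sqr_ge0 (u1 x - u2 x); nra.
  by have := sqr_ge0 (g1 x - g2 x); nra.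
Qed.

Lemma approximable_closed u g : measurable_fun setT u -> measurable_fun setT g ->
  (forall e : R, 0 < e -> exists u' g', approximable u' g' /\
    (energy (fun x => u' x - u x)%R (fun x => g' x - g x)%R <= e%:E)%E) ->
  approximable u g.
Proof.
move=> mu mg H; split=> // e e0.
have e4 : 0 < e / 4 by rewrite divr_gt0.
have [u' [g' [[mu' mg' Hv] Hu]]] := H _ e4.
have [v cv Qv] := Hv _ e4; exists v => //.
have mv := smooth_measurable (Cc_infty_smooth cv).
have mr := measurable_radial_derivative K_Kss (Cc_infty_smooth cv).
apply: le_trans (energy_triangle (u1 := fun x => v x - u' x)
  (g1 := fun x => radial_derivative K v x - g' x)
  (u2 := fun x => u' x - u x) (g2 := fun x => g' x - g x) _ _ _ _ _ _ _ _) _;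
  do ?exact: measurable_funB; do ?by move=> x; rewrite subrKA.
apply: (@le_trans _ _ (2%:E * (e / 4)%:E + 2%:E * (e / 4)%:E)%E).
  by apply: leeD; rewrite lee_wpmul2l.
by rewrite -!EFinM -EFinD lee_fin; lra.
Qed.

Lemma Cc_infty_approximable v : Cc_infty v -> approximable v (radial_derivative K v).
Proof.
move=> cv; have mv := smooth_measurable (Cc_infty_smooth cv).
have mr := measurable_radial_derivative K_Kss (Cc_infty_smooth cv).
split=> // e e0; exists v => //; rewrite /energy/energy_density.
under eq_integral => x _ do rewrite !subrr expr0n/= mulr0 addr0.
by rewrite integral0 lee_fin ltW.
Qed.

Lemma approximable0 : approximable (fun=> 0) (fun=> 0).
Proof.
have c0 : Cc_infty (fun _ : E => 0 : R).
  apply: (@Cc_infty_intro _ _ _ 1 1) => //; first exact: smooth_cst.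
  by move=> x; rewrite eqxx.
have := Cc_infty_approximable c0; congr approximable.
apply/funext => x; rewrite radial_derivativeE.
rewrite (@euler_near0 _ _ (fun=> 0)) ?mulr0//; first exact: smooth_cst.
by apply: (@filterE _ (nbhs x)).
Qed.

Lemma Cc_inftyD v w : Cc_infty v -> Cc_infty w -> Cc_infty (fun x => v x + w x).
Proof.
move=> cv cw.
have [e1 e10 ve1] := Cc_infty_away cv; have [e2 e20 we2] := Cc_infty_away cw.
have [M1 M10 vM] := Cc_infty_bounded cv; have [M2 M20 wM] := Cc_infty_bounded cw.
apply: (@Cc_infty_intro _ _ _ (Num.min e1 e2) (N%:R * (Num.max M1 M2) ^+ 2)).
- by apply: smoothD; exact: Cc_infty_smooth.
- by rewrite lt_min e10.
- move=> x vwx.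
  have H : `|x| <= Num.max M1 M2 -> dot x x <= N%:R * Num.max M1 M2 ^+ 2.
    move=> xM; apply: le_trans (dot_le_norm_sqr x) _.
    rewrite ler_wpM2l// lerXn2r ?nnegrE//.
    by rewrite (le_trans _ xM).
  have [vx|vx] := eqVneq (v x) 0; last first.
    by rewrite ge_min ve1//= H// le_max vM.
  have wx : w x != 0 by move: vwx; rewrite vx add0r.
  by rewrite ge_min we2// orbT/= H// le_max wM// orbT.
Qed.

Lemma radial_derivativeD v w x : smooth v -> smooth w ->
  radial_derivative K (fun x => v x + w x) x =
  radial_derivative K v x + radial_derivative K w x.
Proof.
move=> cv cw; rewrite !radial_derivativeE -mulrDr; congr (_ * _).
apply: euler_unique; first exact: smoothD.
by apply: is_deriveD; exact: is_derive_euler.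
Qed.

Lemma approximableD u g u' g' : approximable u g -> approximable u' g' ->
  approximable (fun x => u x + u' x) (fun x => g x + g' x).
Proof.
move=> [mu mg H] [mu' mg' H']; split; [exact: measurable_funD|exact: measurable_funD|].
move=> e e0; have e4 : 0 < e / 4 by rewrite divr_gt0.
have [v cv Qv] := H _ e4; have [w cw Qw] := H' _ e4.
exists (fun x => v x + w x); first exact: Cc_inftyD.
have sv := Cc_infty_smooth cv; have sw := Cc_infty_smooth cw.
have mv := smooth_measurable sv; have mw := smooth_measurable sw.
have mrv := measurable_radial_derivative K_Kss sv.
have mrw := measurable_radial_derivative K_Kss sw.
have mvw := measurable_radial_derivative K_Kss (smoothD sv sw).
apply: le_trans (energy_triangle (u1 := fun x => v x - u x)
  (g1 := fun x => radial_derivative K v x - g x)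
  (u2 := fun x => w x - u' x) (g2 := fun x => radial_derivative K w x - g' x)
  _ _ _ _ _ _ _ _) _;
  do ?exact: measurable_funB.
- by apply: measurable_funB; exact: measurable_funD.
- by apply: measurable_funB => //; exact: measurable_funD.
- by move=> x; ring.
- by move=> x; rewrite radial_derivativeD//; ring.
apply: (@le_trans _ _ (2%:E * (e / 4)%:E + 2%:E * (e / 4)%:E)%E).
  by apply: leeD; rewrite lee_wpmul2l.
by rewrite -!EFinM -EFinD lee_fin; lra.
Qed.

(** If [m] preserves the test functions and commutes with [R_K], multiplication
    by [m] multiplies the energy density of an error by [m^2], at most [B^2]. *)
Lemma approximableM (B : R) u g m : measurable_fun setT m ->
  (forall x, `|m x| <= B) ->
  (forall v, Cc_infty v -> Cc_infty (fun x => v x * m x) /\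
     forall x, radial_derivative K (fun x => v x * m x) x =
       radial_derivative K v x * m x) ->
  approximable u g -> approximable (fun x => u x * m x) (fun x => g x * m x).
Proof.
move=> mm mB Hm [mu mg H]; split; [exact: measurable_funM|exact: measurable_funM|].
have B0 : 0 <= B by exact: le_trans (mB 0).
have B1 : 0 < B ^+ 2 + 1 by rewrite ltr_wpDl ?sqr_ge0.
move=> e e0; have [v cv Qv] := H _ (divr_gt0 e0 B1).
have [cvm Rvm] := Hm v cv.
exists (fun x => v x * m x) => //.
have sv := Cc_infty_smooth cv.
have mv := smooth_measurable sv.
have mrv := measurable_radial_derivative K_Kss sv.
apply: le_trans (energy_le (C := B ^+ 2 + 1) (u' := fun x => v x - u x)
  (g' := fun x => radial_derivative K v x - g x) _ _ _ _ _ _) _ => //;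
  do ?exact: measurable_funB.
- exact: ltW.
- by apply: measurable_funB; exact: measurable_funM.
- apply: measurable_funB; last exact: measurable_funM.
  by apply: measurable_radial_derivative => //; exact: Cc_infty_smooth.
- move=> x; rewrite /energy_density Rvm -!mulrBl !exprMn.
  rewrite mulrA -mulrDl mulrC ler_wpM2r//.
    exact: (energy_density_ge0 (fun x => v x - u x) (fun x => radial_derivative K v x - g x)).
  apply: (@le_trans _ _ (B ^+ 2)); last by rewrite lerDl.
  by rewrite -[leLHS]ger0_norm ?sqr_ge0// normrX lerXn2r ?nnegrE.
- apply: le_trans (lee_wpmul2l _ Qv) _; first by rewrite lee_fin ltW.
  by rewrite -EFinM mulrC divfK// gt_eqF.
Qed.

Lemma approximableZ (c : R) u g : approximable u g ->
  approximable (fun x => u x * c) (fun x => g x * c).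
Proof.
apply: (@approximableM `|c|) => // v cv; split.
  by apply: Cc_inftyM => //; exact: smooth_cst.
move=> x; rewrite !radial_derivativeE -mulrA; congr (_ * _).
have sv := Cc_infty_smooth cv.
apply: euler_unique; first by apply: smoothM => //; exact: smooth_cst.
have := is_deriveM (is_derive_euler x sv) (is_derive_cst c x x).
by rewrite scaler0 add0r [_ *: _]mulrC.
Qed.

(** Dominated convergence for the energy.  The origin is excluded because many of
    the functions below have no limit there; it is a null set. *)
Lemma energy_dominated (un gn : nat -> E -> R) u g (G : E -> R) :
  (0 < N)%N -> measurable_fun setT u -> measurable_fun setT g ->
  (forall n, measurable_fun setT (un n)) -> (forall n, measurable_fun setT (gn n)) ->
  (forall x, x != 0 -> un n x @[n --> \oo] --> u x) ->
  (forall x, x != 0 -> gn n x @[n --> \oo] --> g x) ->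
  L.-integrable setT (EFin \o G) ->
  (forall n x, x != 0 -> energy_density (fun x => un n x - u x) (fun x => gn n x - g x) x <= G x) ->
  forall e : R, 0 < e -> \forall n \near \oo,
    (energy (fun x => un n x - u x)%R (fun x => gn n x - g x)%R < e%:E)%E.
Proof.
move=> N0 mu mg mun mgn cu cg iG dG e e0.
have md n : measurable_fun setT
   (energy_density (fun x => un n x - u x) (fun x => gn n x - g x)).
  by apply: measurable_energy_density; exact: measurable_funB.
have [||||_ _] := @dominated_convergence _ _ R L setT measurableT
  (fun n => EFin \o energy_density (fun x => un n x - u x) (fun x => gn n x - g x))
  (fun=> 0%E) (EFin \o G) (fun n => (measurable_EFinP _ _).2 (md n)).
- exact: measurable_cst.
- apply: ae_rV_neq0 => // x x0 _; apply: cvg_EFin_seq.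
  rewrite /energy_density -[X in _ --> X](_ : (1 + h x ^+ 2) * (u x - u x) ^+ 2 + (g x - g x) ^+ 2 = 0); last first.
    by rewrite !subrr expr0n/= mulr0 addr0.
  apply: cvgD.
    apply: cvgM; first exact: cvg_cst.
    by apply: cvgM; apply: cvgB; [exact: cu|exact: cvg_cst|exact: cu|exact: cvg_cst].
  by apply: cvgM; apply: cvgB; [exact: cg|exact: cvg_cst|exact: cg|exact: cvg_cst].
- exact: iG.
- apply: ae_rV_neq0 => // x x0 n _.
  by rewrite /= lee_fin ger0_norm ?energy_density_ge0// dG.
rewrite integral0 => H.
have e0' : nbhs (0 : \bar R) [set y | (y < e%:E)%E].
  by apply: open_nbhs_nbhs; split; [exact: open_ereal_lt_ereal|rewrite /= lte_fin].
exact: H e0'.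
Qed.

Lemma approximable_dominated (un gn : nat -> E -> R) u g (G : E -> R) :
  (0 < N)%N -> measurable_fun setT u -> measurable_fun setT g ->
  (forall n, approximable (un n) (gn n)) ->
  (forall x, x != 0 -> un n x @[n --> \oo] --> u x) ->
  (forall x, x != 0 -> gn n x @[n --> \oo] --> g x) ->
  L.-integrable setT (EFin \o G) ->
  (forall n x, x != 0 -> energy_density (fun x => un n x - u x) (fun x => gn n x - g x) x <= G x) ->
  approximable u g.
Proof.
move=> N0 mu mg aun cu cg iG dG; apply: approximable_closed => // e e0.
have mun n : measurable_fun setT (un n) by have [] := aun n.
have mgn n : measurable_fun setT (gn n) by have [] := aun n.
have [n _ /(_ _ (leqnn n)) /= Hn] := energy_dominated N0 mu mg mun mgn cu cg iG dG e0.
by exists (un n), (gn n); split => //; exact: ltW.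
Qed.

End closure.

(** * Functions of the direction as multipliers *)

Section direction.
Variables (R : realType) (N : nat).
Local Notation E := 'rV[R]_N.
Implicit Types (u v g m : E -> R) (x : E).

(** The inverse of 0 is 0, hence so is [direction 0]; this makes
    [homogeneous_direction] valid at the origin as well. *)
Definition direction x : E := (Num.sqrt (dot x x))^-1 *: x.

Lemma directionZ (l : R) x : 0 < l -> direction (l *: x) = direction x.
Proof.
move=> l0; rewrite /direction dotZ sqrtrM ?sqr_ge0// sqrtr_sqr gtr0_norm//.
by rewrite invfM scalerA mulrAC mulVf ?mul1r// gt_eqF.
Qed.

Lemma homogeneous_direction (T : Type) (m : E -> T) x :
  (forall l y, 0 < l -> m (l *: y) = m y) -> m (direction x) = m x.
Proof.
move=> mh; have [->|x0] := eqVneq x 0; first by rewrite /direction scaler0.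
by rewrite mh// invr_gt0 sqrtr_gt0 dot_gt0.
Qed.

Lemma measurable_direction : measurable_fun setT direction.
Proof.
apply: measurable_rVP => i.
rewrite [X in measurable_fun _ X](_ : _ = (fun x : E => (Num.sqrt (dot x x))^-1 * x ord0 i)).
  apply: measurable_funM; last exact: measurable_rV_coord.
  apply: (measurableT_comp (@measurable_invr R)).
  apply: measurableT_comp; last exact: measurable_dot.
  by apply: continuous_measurable_fun; exact: sqrt_continuous.
by apply/funext => x; rewrite mxE.
Qed.

(** On the ray through [x] the factor [m] is constant, so that only [v] is
    differentiated. *)
Lemma euler_mul_homogeneous v m x : smooth v -> smooth (fun y => v y * m y) ->
  (forall l y, 0 < l -> m (l *: y) = m y) ->
  euler (fun y => v y * m y) x = euler v x * m x.
Proof.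
move=> cv cvm mh; apply: euler_unique => //; apply/is_derive_line0.
have := is_deriveM ((is_derive_line0 _ _ _ _).2 (is_derive_euler x cv))
  (is_derive_cst (m x) (0 : R) 1).
rewrite scaler0 add0r [_ *: _]mulrC => H.
apply: near_eq_is_derive H; near=> t => /=.
have t1 : 0 < t + 1.
  by rewrite -ltrBlDr sub0r; near: t; apply: lt_nbhsr; rewrite oppr_lt0.
by congr (_ * _); rewrite -{3}[x]scale1r -scalerDl mh.
Unshelve. all: by end_near. Qed.

(** Smoothness of [F], in the form of stability under composition with smooth
    coordinates, which is all that multiplication by [F \o direction] uses. *)
Definition smooth_coords (F : E -> R) := forall G : 'I_N -> E -> R,
  (forall i, smooth (G i)) -> smooth (fun x => F (\row_i G i x)).

(** [direction] is singular at the origin; on the support of [v] it agrees with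
    [x / |x|] where [1 / |x|] is replaced by the globally smooth function
    [exp (- ln (lift_above e |x|^2) / 2)]. *)
Lemma Cc_infty_direction F v : smooth_coords F -> Cc_infty v ->
  Cc_infty (fun x => v x * F (direction x)).
Proof.
move=> cF cv; have [e e0 ve] := Cc_infty_away cv.
pose r x := expR (ln (lift_above e (dot x x)) * - 2^-1).
rewrite (_ : (fun _ => _) = fun x => v x * F (\row_i (r x * x ord0 i))).
  apply: Cc_inftyM => //; apply: cF => i; apply: smoothM; last exact: smooth_coord.
  apply: smooth_expR; apply: smoothM; last exact: smooth_cst.
  by apply: smooth_ln_lift_above => //; exact: smooth_dot.
apply/funext => x; have [->|vx] := eqVneq (v x) 0; first by rewrite !mul0r.
congr (_ * F _); apply/rowP => i; rewrite !mxE /r lift_above_id ?ve//; congr (_ * _).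
have d0 : 0 < dot x x by exact: lt_le_trans (ve _ vx).
rewrite mulrN expRN; congr (_^-1).
apply/eqP; rewrite -(@eqrXn2 _ 2)// ?sqrtr_ge0 ?expR_ge0//.
by rewrite sqr_sqrtr ?ltW// -expRM_natl mulrCA mulfV ?mulr1// lnK.
Qed.

(** The exponent [n (1 - n t)] tends to [- oo] for [t > 0] and to [+ oo] for
    [t <= 0]; thanks to the term 1 the limit at [t = 0] is 0, and the limit is the
    indicator function of the open half-line. *)
Definition sigmoid (n : nat) (t : R) : R := expR (- expR (n%:R * (1 - n%:R * t))).

Lemma sigmoid_ge0 n t : 0 <= sigmoid n t. Proof. exact: expR_ge0. Qed.

Lemma sigmoid_le1 n t : sigmoid n t <= 1.
Proof. by rewrite -expR0 ler_expR oppr_le0 expR_ge0. Qed.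

Lemma cvg_sigmoid t : sigmoid n t @[n --> \oo] --> ((0 < t)%R%:R : R).
Proof.
have cN : (expR (- n%:R) : R) @[n --> \oo] --> (0 : R).
  apply: (@squeeze_cvgr _ _ _ _ (fun=> 0) (@harmonic R)); last exact: cvg_harmonic.
    apply: nearW => n; rewrite expR_ge0/= expRN lef_pV2 ?posrE ?expR_gt0//.
    by rewrite -natr1 addrC; exact: expR_ge1Dx.
  exact: cvg_cst.
have [t0|t0] /= := ltP 0 t; last first.
  apply: (@squeeze_cvgr _ _ _ _ (fun=> 0) (fun n => expR (- n%:R))) => //; last exact: cvg_cst.
  apply: nearW => n; rewrite sigmoid_ge0/= ler_expR lerN2.
  apply: (@le_trans _ _ (n%:R * (1 - n%:R * t))).
    by rewrite ler_peMr// lerDl oppr_ge0 mulr_ge0_le0.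
  by apply: le_trans (expR_ge1Dx _); rewrite lerDr.
apply: (@squeeze_cvgr _ _ _ _ (fun n => 1 - expR (- n%:R)) (fun=> 1)); last 2 first.
- by rewrite -[X in _ --> X]subr0; apply: cvgB => //; exact: cvg_cst.
- exact: cvg_cst.
near=> n; rewrite sigmoid_le1 andbT.
apply: le_trans (expR_ge1Dx _); rewrite lerD2l lerN2 ler_expR.
rewrite -mulrN1 ler_wpM2l//.
have : 2 / t <= n%:R by near: n; exact: nbhs_infty_ger.
by rewrite ler_pdivrMr//; lra.
Unshelve. all: by end_near. Qed.

Definition upper_box (a : E) : set E := [set y | forall i, a ord0 i < y ord0 i].

Definition smooth_box (a : E) n (y : E) : R :=
  \prod_(i < N) sigmoid n (y ord0 i - a ord0 i).

Lemma smooth_box_coords a n : smooth_coords (smooth_box a n).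
Proof.
move=> G cG; apply: smooth_prod => i; apply: smooth_expR.
rewrite (_ : (fun _ => _) = fun x => (-1) * expR (n%:R * (1 - n%:R * (G i x - a ord0 i)))); last first.
  by apply/funext => x; rewrite mxE mulN1r.
apply: smoothM; first exact: smooth_cst.
apply: smooth_expR; apply: smoothM; first exact: smooth_cst.
apply: smoothB; first exact: smooth_cst.
apply: smoothM; first exact: smooth_cst.
by apply: smoothB => //; exact: smooth_cst.
Qed.

Lemma smooth_box_ge0 a n y : 0 <= smooth_box a n y.
Proof. by apply: prodr_ge0 => i _; exact: sigmoid_ge0. Qed.

Lemma smooth_box_le1 a n y : smooth_box a n y <= 1.
Proof. by apply: prodr_ile1 => i _; rewrite sigmoid_ge0 sigmoid_le1. Qed.

Lemma cvg_smooth_box a y : smooth_box a n y @[n --> \oo] --> (\1_(upper_box a) y : R).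
Proof.
rewrite (_ : \1_(upper_box a) y = \prod_(i < N) ((0 < y ord0 i - a ord0 i)%R%:R : R)).
  by apply: cvg_big => [|i _]; [exact: mul_continuous|exact: cvg_sigmoid].
rewrite indicE; have [/set_mem ay|/negP ay] := boolP (y \in upper_box a).
  by rewrite big1// => i _; rewrite subr_gt0 ay.
have [i ai] : exists i, ~ (a ord0 i < y ord0 i).
  by apply/existsNP => H; apply: ay; rewrite inE.
by rewrite (bigD1 i)//= subr_gt0 (negbTE (introN idP ai)) mul0r.
Qed.

Lemma measurable_upper_box a : measurable (upper_box a).
Proof.
rewrite (_ : upper_box a = \bigcap_(i in [set: 'I_N])
   ((fun x : E => x ord0 i) @^-1` `]a ord0 i, +oo[)); last first.
  apply/seteqP; split=> [x xr i _|x xr i] /=; first by rewrite in_itv/= xr.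
  by have := xr i I; rewrite /= in_itv/= andbT.
apply: fin_bigcap_measurable; first exact: finite_finset.
move=> i _; rewrite -[X in measurable X]setTI.
by have := @measurable_rV_coord R N i; apply.
Qed.

(** These boxes generate the Borel sets and, unlike the half-spaces, are stable
    under intersection, as Dynkin's theorem requires. *)
Lemma measurable_upper_boxE : @measurable _ E = <<s range upper_box >>.
Proof.
apply/seteqP; split; last first.
  apply: smallest_sub; first exact: sigma_algebra_measurable.
  by move=> _ [a _ <-]; exact: measurable_upper_box.
move=> A mA.
have : @measurable_fun _ _ (g_sigma_algebraType (range upper_box)) E setT id.
  apply: measurable_rVP => i.
  apply: (measurability _ (RGenOInfty.measurableE R)) => _ [_ [r ->] <-].
  rewrite setTI (_ : _ @^-1` _ = \bigcup_k upper_box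
      (\row_j (if j == i then r else - k%:R))).
    apply: bigcup_measurable => k _; apply: sub_sigma_algebra.
    by exists (\row_j (if j == i then r else - k%:R)).
  apply/seteqP; split=> [y /=|y [k _ /(_ i)]]; rewrite /= in_itv/= andbT; last first.
    by rewrite mxE eqxx.
  move=> ry; exists (\sum_(j < N) Num.bound (`|y ord0 j|))%N => // j.
  rewrite mxE; case: eqVneq => [->//|_].
  rewrite ltrNl (le_lt_trans (ler_norm _))// normrN.
  apply: (lt_le_trans (archi_boundP (normr_ge0 _))); rewrite ler_nat.
  by rewrite (bigD1 j)//= leq_addr.
by move=> /(_ measurableT A mA); rewrite setTI preimage_id.
Qed.

Lemma upper_box_setI_closed : setI_closed (range upper_box).
Proof.
move=> _ _ [a _ <-] [b _ <-].
exists (\row_i Num.max (a ord0 i) (b ord0 i)) => //.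
apply/seteqP; split=> [y H|y [Ha Hb] i].
  by split=> i; have := H i; rewrite mxE gt_max => /andP[].
by rewrite mxE gt_max Ha Hb.
Qed.

End direction.

Section multipliers.
Variables (R : realType) (N : nat) (K : set 'rV[R]_N).
Hypothesis K_Kss : Kss_o K.
Hypothesis N_gt0 : (0 < N)%N.
Local Notation E := 'rV[R]_N.
Local Notation L := (lebesgue_rV R N).
Local Notation approximable := (approximable K).
Local Notation energy := (energy K).
Implicit Types (u v g m : E -> R) (x : E).

Lemma integrable_energy u g : measurable_fun setT u -> measurable_fun setT g ->
  (energy u g < +oo)%E -> L.-integrable setT (EFin \o energy_density K u g).
Proof.
move=> mu mg fin; apply/integrableP; split.
  by apply/measurable_EFinP; exact: measurable_energy_density.
by under eq_integral => x _ do rewrite /= ger0_norm ?energy_density_ge0//.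
Qed.

Lemma energy_densityM u g m x : energy_density K (fun x => u x * m x) (fun x => g x * m x) x =
  m x ^+ 2 * energy_density K u g x.
Proof. by rewrite /energy_density; ring. Qed.

Lemma sqr_le1 (a : R) : `|a| <= 1 -> a ^+ 2 <= 1.
Proof. by move=> a1; rewrite -[leLHS]ger0_norm ?sqr_ge0// normrX exprn_ile1. Qed.

(** Dominated convergence, with the energy density of the pair [(u, g)] itself as
    dominating function. *)
Lemma approximableM_lim u g (mn : nat -> E -> R) m : 
  measurable_fun setT u -> measurable_fun setT g -> (energy u g < +oo)%E ->
  measurable_fun setT m ->
  (forall n, approximable (fun x => u x * mn n x) (fun x => g x * mn n x)) ->
  (forall n x, `|mn n x - m x| <= 1) ->
  (forall x, mn n x @[n --> \oo] --> m x) ->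
  approximable (fun x => u x * m x) (fun x => g x * m x).
Proof.
move=> mu mg fin mm amn bmn cmn.
apply: (@approximable_dominated _ _ _ K_Kss (fun n x => u x * mn n x)
  (fun n x => g x * mn n x) _ _ (energy_density K u g)) => //.
- exact: measurable_funM.
- exact: measurable_funM.
- by move=> x _; apply: cvgM; [exact: cvg_cst|exact: cmn].
- by move=> x _; apply: cvgM; [exact: cvg_cst|exact: cmn].
- exact: integrable_energy.
- move=> n x _.
  rewrite (_ : energy_density _ _ _ x = (mn n x - m x) ^+ 2 * energy_density K u g x).
    by rewrite ler_piMl ?energy_density_ge0// sqr_le1.
  by rewrite /energy_density; ring.
Qed.

(** Dynkin's theorem: the boxes are reached from smooth multipliers of the
    direction, complements by linearity, and countable disjoint unions because
    the partial sums of indicators are bounded by 1. *)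
Lemma approximable_indic u g (A : set E) : measurable A ->
  approximable u g -> (energy u g < +oo)%E ->
  approximable (fun x => u x * \1_A (direction x)) (fun x => g x * \1_A (direction x)).
Proof.
move=> mA aug fin; have [mu mg _] := aug.
have mI B : measurable B -> measurable_fun setT (fun x : E => \1_B (direction x) : R).
  by move=> mB; apply: (measurableT_comp (measurable_indic mB)); exact: measurable_direction.
pose P (B : set E) := approximable (fun x => u x * \1_B (direction x))
  (fun x => g x * \1_B (direction x)).
move: mA; rewrite measurable_upper_boxE.
apply: (@dynkin_induction _ E (range (@upper_box R N)) P).
- exact: measurable_upper_boxE.
- exact: upper_box_setI_closed.
- rewrite /P [X in approximable X](_ : _ = u).
    by rewrite [X in approximable _ X](_ : _ = g)//; apply/funext => x; rewrite indicT mulr1.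
  by apply/funext => x; rewrite indicT mulr1.
- move=> _ [a _ <-].
  have mS n : measurable_fun setT (fun x : E => smooth_box a n (direction x)).
    apply: (measurableT_comp _ (@measurable_direction R N)).
    rewrite (_ : smooth_box a n = fun x => smooth_box a n (\row_i (x ord0 i))).
      apply: smooth_measurable; apply: smooth_box_coords => i; exact: smooth_coord.
    by apply/funext => x; congr (smooth_box a n _); apply/rowP => i; rewrite mxE.
  apply: (@approximableM_lim _ _ (fun n x => smooth_box a n (direction x))) => //.
  + by apply: mI; exact: measurable_upper_box.
  + move=> n; apply: (@approximableM _ _ _ K_Kss 1) => //.
      by move=> x; rewrite ger0_norm ?smooth_box_ge0// smooth_box_le1.
    move=> v cv; have cvm := Cc_infty_direction (@smooth_box_coords R N a n) cv.
    split => // x; rewrite !radial_derivativeE -mulrA; congr (_ * _).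
    apply: (@euler_mul_homogeneous _ _ v (fun y => smooth_box a n (direction y))).
    * exact: Cc_infty_smooth.
    * exact: Cc_infty_smooth cvm.
    * by move=> l y l0; rewrite directionZ.
  + move=> n x; have := smooth_box_ge0 a n (direction x).
    have := smooth_box_le1 a n (direction x); rewrite indicE.
    by case: (_ \in _) => /= H1 H2; rewrite ler_norml; lra.
  + by move=> x; exact: cvg_smooth_box.
- move=> B mB PB; rewrite /P.
  have := approximableD K_Kss aug (approximableZ K_Kss (-1) PB).
  congr approximable; apply/funext => x; rewrite !indicE in_setC.
    by case: (_ \in _) => /=; ring.
  by case: (_ \in _) => /=; ring.
- move=> F mF tF PF.
  pose mn n x : R := \sum_(k < n) \1_(F k) (direction x).
  have mnE x : (forall n, mn n x = 0) /\ (\1_(\bigcup_k F k) (direction x) = 0 :> R) \/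
     exists k0, (forall n, mn n x = (k0 < n)%N%:R) /\ (\1_(\bigcup_k F k) (direction x) = 1 :> R).
    have [[k0 _ Fk0]|nF] := pselect ((\bigcup_k F k) (direction x)); [right|left].
      exists k0; split; last by rewrite indicE mem_set//; exists k0.
      elim=> [|n IH]; first by rewrite /mn big_ord0.
      rewrite /mn big_ord_recr/= -/(mn n x) IH ltnS.
      have [->|nk] := eqVneq n k0; first by rewrite indicE mem_set// ltnn leqnn add0r.
      rewrite indicE memNset ?addr0.
        by rewrite [in RHS]leq_eqVlt eq_sym (negbTE nk).
      move=> Fn; move/eqP: nk; apply; apply: tF => //.
      by exists (direction x).
    split; last by rewrite indicE memNset.
    move=> n; rewrite /mn big1// => k _; rewrite indicE memNset// => Fk.
    by apply: nF; exists k.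
  apply: (@approximableM_lim _ _ mn) => //.
  + by apply: mI; exact: bigcup_measurable.
  + elim=> [|n IH].
      have := approximable0 K_Kss; congr approximable; apply/funext => x;
      by rewrite /mn big_ord0 mulr0.
    have := approximableD K_Kss IH (PF n); congr approximable; apply/funext => x;
    by rewrite /mn big_ord_recr mulrDr.
  + move=> n x; have [[-> ->]|[k0 [-> ->]]] := mnE x; first by rewrite subrr normr0.
    by case: (k0 < n)%N; rewrite ?subrr ?normr0// sub0r normrN1.
  + move=> x; have [[H ->]|[k0 [H ->]]] := mnE x.
      by under eq_fun do rewrite H; exact: cvg_cst.
    under eq_fun do rewrite H.
    apply: cvg_near_cst; near=> n; suff -> : (k0 < n)%N by [].
    by near: n; exact: nbhs_infty_gt.
Unshelve. all: by end_near. Qed.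

Lemma approximable_sum (I : eqType) (s : seq I) (U G : I -> E -> R) :
  (forall i, i \in s -> approximable (U i) (G i)) ->
  approximable (fun x => \sum_(i <- s) U i x) (fun x => \sum_(i <- s) G i x).
Proof.
elim: s => [_|i s IH H].
  have := approximable0 K_Kss; congr approximable; apply/funext => x;
  by rewrite big_nil.
have := approximableD K_Kss (H i (mem_head _ _)) (IH _).
move=> /(_ _)/[dup]; have Hs : forall j, j \in s -> approximable (U j) (G j).
  by move=> j js; apply: H; rewrite in_cons js orbT.
move=> /(_ Hs) H1 _; move: H1; congr approximable; apply/funext => x;
by rewrite big_cons.
Qed.

(** The level sets of [f] cut the directions into finitely many Borel pieces, and
    the glued function is a finite sum of products with their indicators. *)
Lemma approximable_glue (f : E -> R) (U G : R -> E -> R) :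
  measurable_fun setT f -> finite_set (range f) ->
  (forall y, range f y -> approximable (U y) (G y) /\ (energy (U y) (G y) < +oo)%E) ->
  approximable (fun x => U (f (direction x)) x) (fun x => G (f (direction x)) x).
Proof.
move=> mf finf H.
pose s : seq R := finmap.enum_fset (fset_set (range f)).
have sE y : (y \in s) = (y \in range f) by rewrite -in_fset_set.
have E1 (W : R -> E -> R) x : W (f (direction x)) x =
    \sum_(y <- s) W y x * \1_(f @^-1` [set y]) (direction x).
  have fx : f (direction x) \in s by rewrite sE; apply: mem_set; exists (direction x).
  rewrite (bigD1_seq (f (direction x)))//=; last exact: finmap.fset_uniq.
  rewrite big1 => [|y yf]; first by rewrite addr0 indicE mem_set// mulr1.
  by rewrite indicE memNset ?mulr0// => /esym /eqP; rewrite (negbTE yf).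
rewrite [X in approximable X](funext (E1 U)) [X in approximable _ X](funext (E1 G)).
apply: (@approximable_sum _ _ (fun y x => U y x * \1_(f @^-1` [set y]) (direction x))
  (fun y x => G y x * \1_(f @^-1` [set y]) (direction x))) => y.
rewrite sE => /set_mem/H[aUG fin].
apply: approximable_indic => //.
rewrite -[X in measurable X]setTI; exact: mf.
Qed.

End multipliers.

(** * Logarithmic cutoffs *)

Section cutoff.
Variable R : realType.
Implicit Types t : R.

(** The value 1 is reached at 0 only, where [expR 2] normalises it: the cutoffs
    need to tend to 1 pointwise, not to be equal to 1 on an open set. *)
Definition bump t : R := expR 2 * (expinv (1 + t) * expinv (1 - t)).
Definition dexpinv t : R := flat ('X^2 * (1 - 1^`())) t.
Definition dbump t : R := expR 2 *
  (dexpinv (1 + t) * expinv (1 - t) - expinv (1 + t) * dexpinv (1 - t)).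

Lemma is_derive_bump t : is_derive t 1 bump (dbump t).
Proof.
have d1 : is_derive t 1 (fun t : R => 1 + t) 1.
  by have := is_deriveD (is_derive_cst (1:R) t 1) (is_derive_id t 1); rewrite add0r.
have d2 : is_derive t 1 (fun t : R => 1 - t) (- 1).
  by have := is_deriveB (is_derive_cst (1:R) t 1) (is_derive_id t 1); rewrite sub0r.
have e1 := @is_derive1_comp _ (@expinv R) (fun t => 1 + t) t _ _ (is_derive_flat 1 (1 + t)) d1.
have e2 := @is_derive1_comp _ (@expinv R) (fun t => 1 - t) t _ _ (is_derive_flat 1 (1 - t)) d2.
apply: is_derive_eq (is_deriveZ (expR 2) (is_deriveM e1 e2)) _.
by rewrite /GRing.scale/= /dbump /dexpinv; ring.
Qed.

Lemma bump_ge0 t : 0 <= bump t.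
Proof. by rewrite !mulr_ge0 ?expinv_ge0 ?expR_ge0. Qed.

Lemma bump_le t : bump t <= expR 2.
Proof. by rewrite ler_piMr ?expR_ge0// mulr_ile1 ?expinv_ge0 ?expinv_le1. Qed.

Lemma bump0 : bump 0 = 1.
Proof.
rewrite /bump addr0 subr0 expinvE ltr01 invr1 -!expRD.
by rewrite (_ : 2 + _ = 0) ?expR0//; ring.
Qed.

Lemma bump_eq0 t : 1 <= `|t| -> bump t = 0.
Proof.
rewrite ler_normr => /orP[t1|t1].
  by rewrite /bump (@expinv_eq0 _ (1 - t)) ?mulr0//; lra.
by rewrite /bump (@expinv_eq0 _ (1 + t)) ?mul0r ?mulr0//; lra.
Qed.

Lemma dbump_eq0 t : 1 <= `|t| -> dbump t = 0.
Proof.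
have d0 s : s <= 0 -> dexpinv s = 0 by rewrite /dexpinv /flat ltNge => ->.
rewrite ler_normr => /orP[t1|t1]; rewrite /dbump.
  by rewrite (@expinv_eq0 _ (1 - t)) ?(d0 (1 - t)) ?mulr0 ?subrr ?mulr0//; lra.
by rewrite (@expinv_eq0 _ (1 + t)) ?(d0 (1 + t)) ?mul0r ?subrr ?mulr0//; lra.
Qed.

Lemma dbump_bounded : exists2 D : R, 0 <= D & forall t, `|dbump t| <= D.
Proof.
have [C C0 HC] := flat_bounded ('X^2 * (1 - 1^`()) : {poly R}).
exists (expR 2 * (C + C)); first by rewrite mulr_ge0 ?expR_ge0// addr_ge0.
move=> t; rewrite normrM ger0_norm ?expR_ge0// ler_wpM2l ?expR_ge0//.
apply: (le_trans (ler_normB _ _)); rewrite !normrM !(ger0_norm (expinv_ge0 _)).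
have HC' s : `|dexpinv s| <= C by exact: HC.
apply: lerD.
  by rewrite -[leRHS]mulr1 ler_pM// ?expinv_ge0// expinv_le1.
by rewrite mulrC -[leRHS]mulr1 ler_pM// ?expinv_ge0// expinv_le1.
Qed.

Variable N : nat.
Local Notation E := 'rV[R]_N.
Implicit Types x : E.

(** The logarithm spreads the transition over the annulus where [|ln |x|^2|] is at
    most [n.+1], so that the derivative along [x] is of order [1 / n] instead of
    order 1. *)
Definition cutoff (n : nat) x : R :=
  bump (ln (lift_above (expR (- n.+1%:R)) (dot x x)) * n.+1%:R^-1).

Lemma smooth_cutoff n : smooth (cutoff n).
Proof.
have sl : smooth (fun x : E => ln (lift_above (expR (- n.+1%:R)) (dot x x)) * n.+1%:R^-1).
  apply: smoothM; last exact: smooth_cst.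
  by apply: smooth_ln_lift_above; [exact: expR_gt0|exact: smooth_dot].
apply: smoothM; first exact: smooth_cst.
apply: smoothM; apply: smooth_expinv.
  by apply: smoothD => //; exact: smooth_cst.
by apply: smoothB => //; exact: smooth_cst.
Qed.

Lemma cutoff_support n x : cutoff n x != 0 ->
  expR (- n.+1%:R) <= dot x x <= expR n.+1%:R.
Proof.
move=> cx; have e0 : 0 < expR (- n.+1%:R : R) by exact: expR_gt0.
set p := lift_above (expR (- n.+1%:R)) (dot x x).
have p0 : 0 < p by exact: lift_above_gt0.
have n0 : (0 : R) < n.+1%:R by [].
have : `|ln p * n.+1%:R^-1| < 1.
  by rewrite ltNge; apply: contra cx => H; rewrite /cutoff bump_eq0.
rewrite ltr_norml ltr_pdivrMr// ltr_pdivlMr// mul1r mulN1r => /andP[lp1 lp2].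
have pe : expR (- n.+1%:R) < p.
  by rewrite -[p]lnK ?posrE// ltr_expR.
have dp : expR (- n.+1%:R) < dot x x.
  by rewrite ltNge; apply/negP => /(lift_above_le e0); rewrite leNgt pe.
rewrite (ltW dp)/=.
have <- : p = dot x x by rewrite /p lift_above_id// ltW.
by rewrite -[p]lnK ?posrE// ler_expR ltW.
Qed.

(** Below the threshold of [lift_above] both sides vanish. *)
Lemma cutoffE n x : x != 0 -> cutoff n x = bump (ln (dot x x) * n.+1%:R^-1).
Proof.
move=> x0; have d0 := dot_gt0 x0; have e0 : 0 < expR (- n.+1%:R : R) by exact: expR_gt0.
have n0 : (0 : R) < n.+1%:R by [].
have [ed|de] := leP (expR (- n.+1%:R)) (dot x x); first by rewrite /cutoff lift_above_id.
have H p : 0 < p -> p <= expR (- n.+1%:R) -> bump (ln p * n.+1%:R^-1) = 0.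
  move=> p0 pe; apply: bump_eq0; rewrite ler_normr; apply/orP; right.
  rewrite -mulNr ler_pdivlMr// mul1r lerNr.
  by rewrite -ler_expR lnK// posrE.
by rewrite /cutoff !H ?lift_above_gt0 ?lift_above_le// ltW.
Qed.

Lemma cvg_cutoff x : x != 0 -> cutoff n x @[n --> \oo] --> (1 : R).
Proof.
move=> x0; under eq_fun do rewrite cutoffE//.
suff : bump (ln (dot x x) * n.+1%:R^-1) @[n --> \oo] --> bump 0 by rewrite bump0.
apply: continuous_cvg.
  by apply/differentiable_continuous/derivable1_diffP; have [] := is_derive_bump 0.
rewrite -[X in _ --> X](mulr0 (ln (dot x x))); apply: cvgM; first exact: cvg_cst.
exact: cvg_harmonic.
Qed.

Lemma euler_cutoff n x : x != 0 ->
  euler (cutoff n) x = dbump (ln (dot x x) * n.+1%:R^-1) * (2 * n.+1%:R^-1).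
Proof.
move=> x0; apply: euler_unique; first exact: smooth_cutoff.
have d0 := dot_gt0 x0.
apply/is_derive_line0.
pose f t := bump ((ln (dot x x) + 2 * ln (1 + t)) * n.+1%:R^-1).
have d1 : is_derive (0:R) 1 (fun t : R => 1 + t) 1.
  by have := is_deriveD (is_derive_cst (1:R) (0:R) 1) (is_derive_id (0:R) 1); rewrite add0r.
have p1 : 0 < (fun t : R => 1 + t) 0 by rewrite /= addr0.
have d2 := @is_derive1_comp _ (@ln R) (fun t => 1 + t) 0 _ _ (is_derive1_ln p1) d1.
have d3 := is_deriveZ n.+1%:R^-1 (is_deriveD (is_derive_cst (ln (dot x x)) (0:R) 1) (is_deriveZ 2 d2)).
have d4 := @is_derive1_comp _ bump _ 0 _ _ (is_derive_bump _) d3.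
have d5 : is_derive (0 : R) 1 f (dbump (ln (dot x x) * n.+1%:R^-1) * (2 * n.+1%:R^-1)).
  have -> : f = bump \o (n.+1%:R^-1 \*: (cst (ln (dot x x)) +
      2 \*: (@ln R \o (fun t => 1 + t)))).
    by apply/funext => t; rewrite /f /= mulrC.
  apply: is_derive_eq d4 _.
  rewrite /GRing.scale/= /cst /=.
  have -> : ((fun=> ln (dot x x)) + 2 \*: (@ln R \o [eta +%R 1])) 0 = ln (dot x x) + 2 * ln (1 + 0) by [].
  rewrite addr0 ln1 mulr0 addr0 invr1 !mulr1 add0r.
  by congr (dbump _ * _); rewrite mulrC.
apply: near_eq_is_derive d5; near=> t.
have t1 : 0 < 1 + t.
  by rewrite addrC -ltrBlDr sub0r; near: t; apply: lt_nbhsr; rewrite oppr_lt0.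
have -> : t *: x + x = (1 + t) *: x by rewrite scalerDl scale1r addrC.
rewrite cutoffE ?scaler_eq0 ?negb_or ?x0 ?gt_eqF//.
rewrite dotZ lnM ?posrE ?exprn_gt0// lnXn// /f; congr (bump (_ * _)).
by rewrite addrC mulr_natl.
Unshelve. all: by end_near. Qed.

End cutoff.

Section shells.
Variables (R : realType) (N : nat).
Local Notation E := 'rV[R]_N.
Local Notation L := (lebesgue_rV R N).
Implicit Types (x : E) (a b : R).

(** Up to a constant times [1 / n^2], a bound for the square of the radial derivative of
    the cutoffs on an annulus. *)
Definition shell a b x : R := if a <= dot x x <= b then (dot x x)^-1 else 0.

Lemma shell_ge0 a b x : 0 <= shell a b x.
Proof. by rewrite /shell; case: ifPn => // _; rewrite invr_ge0 dot_ge0. Qed.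

Lemma measurable_shell a b : measurable_fun setT (shell a b).
Proof.
have mA : measurable ((fun x : E => dot x x) @^-1` `[a, b]%classic).
  by rewrite -[X in measurable X]setTI; apply: measurable_dot.
rewrite (_ : shell a b = fun x => \1_((fun x : E => dot x x) @^-1` `[a, b]%classic) x * (dot x x)^-1).
  apply: measurable_funM; first exact: measurable_indic.
  by apply: (measurableT_comp (@measurable_invr R)); exact: measurable_dot.
apply/funext => x; rewrite /shell indicE; case: ifPn => H.
  by rewrite mem_set ?mul1r//= in_itv.
by rewrite memNset ?mul0r//= in_itv/=; exact/negP.
Qed.

Definition shell_integral a b : \bar R := (\int[L]_x (shell a b x)%:E)%E.

Lemma shell_integral_ge0 a b : (0 <= shell_integral a b)%E.
Proof. by apply: integral_ge0 => x _; rewrite lee_fin shell_ge0. Qed.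

Lemma shell_integral_fin a b : 0 < a -> (shell_integral a b < +oo)%E.
Proof.
move=> a0; apply: (@le_lt_trans _ _ (\int[L]_x ((a^-1 * expR b) * gaussian 1 x)%:E)%E).
  apply: ge0_le_integral => //.
  - by move=> x _; rewrite lee_fin shell_ge0.
  - by apply/measurable_EFinP; exact: measurable_shell.
  - by apply/measurable_EFinP; apply: measurable_funM => //; exact: measurable_gaussian.
  - move=> x _; rewrite lee_fin /shell; case: ifPn => [/andP[ax xb]|_]; last first.
      by rewrite !mulr_ge0 ?expR_ge0// invr_ge0 ltW.
    rewrite -mulrA -[leLHS]mulr1; apply: ler_pM => //.
    + by rewrite invr_ge0 dot_ge0.
    + by rewrite lef_pV2 ?posrE// (lt_le_trans a0).
    + by rewrite /gaussian mul1r -expRD -[leLHS]expR0 ler_expR subr_ge0.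
under eq_integral => x _ do rewrite EFinM.
rewrite integralZl//; last exact: integrable_gaussian.
rewrite -ge0_fin_numE; first by rewrite fin_numM// integrable_fin_num//; exact: integrable_gaussian.
rewrite mule_ge0 ?lee_fin ?mulr_ge0 ?invr_ge0 ?expR_ge0 ?(ltW a0)//.
by apply: integral_ge0 => x _; rewrite lee_fin expR_ge0.
Qed.

(** The integral of [|x|^-2] over an annulus is homogeneous of degree [N - 2], and
    the dilation here is by [l^-1 = expR (- 1 / 2)], which is less than 1. *)
Lemma shell_integral_scale a b : (2 <= N)%N ->
  (shell_integral (a * expR (- 1)) (b * expR (- 1)) <= shell_integral a b)%E.
Proof.
move=> N2; pose l : R := expR 2^-1.
have l0 : 0 < l by exact: expR_gt0.
have l2 : l ^+ 2 = expR 1 by rewrite /l -expRM_natl mulfV.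
have l1 : 1 <= l by rewrite -expR0 ler_expR.
have E1 : (\int[L]_x (shell a b (l *: x))%:E = (l ^- N)%:E * shell_integral a b)%E.
  rewrite (ge0_integral_scale l0 (f := EFin \o shell a b))//.
    by apply/measurable_EFinP; exact: measurable_shell.
  by move=> x; rewrite lee_fin shell_ge0.
have -> : shell_integral (a * expR (- 1)) (b * expR (- 1)) =
    ((expR 1)%:E * \int[L]_x (shell a b (l *: x))%:E)%E.
  rewrite -ge0_integralZl//; last 2 first.
  - apply/measurable_EFinP; apply: (measurableT_comp (measurable_shell a b)).
    exact: measurable_rV_scale.
  - by move=> x _; rewrite lee_fin shell_ge0.
  apply: eq_integral => x _; rewrite -EFinM /shell dotZ l2 expRN.
  rewrite ler_pdivrMr ?expR_gt0// ler_pdivlMr ?expR_gt0// [expR 1 * _]mulrC.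
  case: ifPn => _; last by rewrite mulr0.
  by rewrite [dot x x * _]mulrC invfM mulrA mulfV ?mul1r// gt_eqF // expR_gt0.
rewrite E1 muleA -EFinM -[leRHS]mul1e; apply: lee_wpmul2r.
  exact: shell_integral_ge0.
rewrite lee_fin -l2 ler_pdivrMr ?exprn_gt0// mul1r.
by rewrite ler_weXn2l.
Qed.

Lemma shell_integral_split a b c : (shell_integral a c <= shell_integral a b + shell_integral b c)%E.
Proof.
rewrite /shell_integral -ge0_integralD//.
- apply: ge0_le_integral => //.
  + by move=> x _; rewrite lee_fin shell_ge0.
  + by apply/measurable_EFinP; exact: measurable_shell.
  + by apply: emeasurable_funD; apply/measurable_EFinP; exact: measurable_shell.
  + move=> x _; rewrite -EFinD lee_fin.
    have := shell_ge0 a b x; have := shell_ge0 b c x; rewrite /shell.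
    have [ax|ax] := leP a (dot x x); have [xb|xb] := leP (dot x x) b;
    have [xc|xc] := leP (dot x x) c; have [bx|bx] := leP b (dot x x) => /=; lra.
- by move=> x _; rewrite lee_fin shell_ge0.
- by apply/measurable_EFinP; exact: measurable_shell.
- by move=> x _; rewrite lee_fin shell_ge0.
- by apply/measurable_EFinP; exact: measurable_shell.
Qed.

(** The annulus [expR (- n.+1) <= |x|^2 <= 1] is the union of [n.+1] dilates of
    [expR (- 1) <= |x|^2 <= 1]. *)
Lemma shell_integral_linear : (2 <= N)%N -> exists2 C : R, 0 <= C &
  forall n, (shell_integral (expR (- n.+1%:R)) 1 <= (n.+1%:R * C)%:E)%E.
Proof.
move=> N2; pose C := fine (shell_integral (expR (- 1)) 1).
have CE : shell_integral (expR (- 1)) 1 = C%:E.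
  rewrite fineK// ge0_fin_numE ?shell_integral_ge0//.
  by rewrite shell_integral_fin// expR_gt0.
exists C; first by rewrite -lee_fin -CE shell_integral_ge0.
elim=> [|n IH]; first by rewrite mul1r -CE.
apply: le_trans (shell_integral_split _ (expR (- 1)) _) _.
rewrite -natr1 mulrDl mul1r EFinD; apply: leeD; last by rewrite CE.
apply: le_trans IH.
have := shell_integral_scale (expR (- n.+1%:R)) 1 N2.
by rewrite mul1r -expRD -opprD natr1.
Qed.

End shells.

(** * Gaussians and their multiples *)

Section gaussians.
Variables (R : realType) (N : nat) (K : set 'rV[R]_N).
Hypothesis K_Kss : Kss_o K.
Hypothesis N_ge2 : (2 <= N)%N.
Local Notation h := (minkowski_functional K).
Local Notation E := 'rV[R]_N.
Local Notation L := (lebesgue_rV R N).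
Local Notation approximable := (approximable K).
Local Notation energy := (energy K).
Implicit Types (u v g m : E -> R) (x : E) (c : R).

Lemma integrable_poly_gaussian c : 0 < c ->
  L.-integrable setT (EFin \o (fun x => (1 + dot x x) * gaussian c x)).
Proof.
move=> c0; have c2 : 0 < c / 2 by rewrite divr_gt0.
apply: (le_integrable measurableT) (integrableZl measurableT (1 + 2 / c) (integrable_gaussian N c2)).
  apply/measurable_EFinP; apply: measurable_funM; last exact: measurable_gaussian.
  by apply: measurable_funD => //; exact: measurable_dot.
move=> x _ /=; rewrite lee_fin.
have d0 := dot_ge0 x.
rewrite ger0_norm; last by rewrite mulr_ge0 ?gaussian_ge0// addr_ge0.
apply: le_trans (ler_norm _).
have -> : gaussian c x = gaussian (c / 2) x * gaussian (c / 2) x.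
  by rewrite /gaussian -expRD; congr expR; field.
rewrite mulrA ler_wpM2r ?gaussian_ge0// /gaussian expRN ler_pdivrMr ?expR_gt0//.
apply: (@le_trans _ _ ((1 + 2 / c) * (1 + c / 2 * dot x x))); last first.
  by rewrite ler_wpM2l ?expR_ge1Dx// addr_ge0// divr_ge0// ltW.
have -> : (1 + 2 / c) * (1 + c / 2 * dot x x) = 1 + dot x x + (2 / c + c / 2 * dot x x).
  by field; rewrite gt_eqF.
by rewrite lerDl addr_ge0 ?mulr_ge0// ?invr_ge0 ltW.
Qed.

(** The common source of the dominating functions for gaussians and for their
    differences. *)
Lemma energy_density_le_gaussian : exists2 C : R, 0 <= C &
  forall a c u g x, `|u x| <= a * gaussian c x -> `|g x| <= a * h x * gaussian c x ->
  energy_density K u g x <= a ^+ 2 * C * ((1 + dot x x) * gaussian (2 * c) x).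
Proof.
have [C1 C10 hC] := gauge_dot_upper K_Kss.
exists (1 + 2 * C1); first by rewrite addr_ge0// mulr_ge0// ltW.
move=> a c u g x ux gx.
have sq (y z : R) : `|y| <= z -> y ^+ 2 <= z ^+ 2.
  move=> yz; rewrite -[leLHS]ger0_norm ?sqr_ge0// normrX lerXn2r ?nnegrE//.
  exact: le_trans yz.
have w2 : gaussian (2 * c) x = gaussian c x ^+ 2.
  by rewrite /gaussian -expRM_natl; congr expR; ring.
have H1 := sq _ _ ux; have H2 := sq _ _ gx.
have d0 := dot_ge0 x; have h1 : 0 <= 1 + h x ^+ 2 by rewrite addr_ge0 ?sqr_ge0.
rewrite /energy_density w2.
apply: (@le_trans _ _ ((1 + h x ^+ 2) * (a * gaussian c x) ^+ 2 + (a * h x * gaussian c x) ^+ 2)).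
  by apply: lerD => //; rewrite ler_wpM2l.
have -> : (1 + h x ^+ 2) * (a * gaussian c x) ^+ 2 + (a * h x * gaussian c x) ^+ 2 =
  (a * gaussian c x) ^+ 2 * (1 + 2 * h x ^+ 2) by ring.
have -> : a ^+ 2 * (1 + 2 * C1) * ((1 + dot x x) * gaussian c x ^+ 2) =
  (a * gaussian c x) ^+ 2 * ((1 + 2 * C1) * (1 + dot x x)) by ring.
rewrite ler_wpM2l ?sqr_ge0//; have := hC x; nra.
Qed.

Lemma energy_lt_pinfty (G : E -> R) u g : measurable_fun setT u -> measurable_fun setT g ->
  L.-integrable setT (EFin \o G) ->
  (forall x, energy_density K u g x <= G x) -> (energy u g < +oo)%E.
Proof.
move=> mu mg iG uG; have := integral_fune_lt_pinfty measurableT iG; apply: le_lt_trans.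
apply: ge0_le_integral => //.
- by move=> x _; rewrite lee_fin energy_density_ge0.
- by apply/measurable_EFinP; exact: measurable_energy_density.
- by have /integrableP[] := iG.
- by move=> x _; rewrite lee_fin.
Qed.

(** The radial derivative of [gaussian c] in closed form ([dgaussianE]). *)
Definition dgaussian c x : R := - (2 * c * dot x x * (h x)^-1) * gaussian c x.

Lemma measurable_dgaussian c : measurable_fun setT (dgaussian c).
Proof.
apply: measurable_funM; last exact: measurable_gaussian.
apply: measurableT_comp => //; apply: measurable_funM.
  by apply: measurable_funM => //; exact: measurable_dot.
by apply: (measurableT_comp (@measurable_invr R)); exact: measurable_gauge.
Qed.

Lemma dot_div_gauge : exists2 C : R, 0 < C & forall x, dot x x * (h x)^-1 <= C * h x.
Proof.
have [c0 c00 hc] := gauge_dot_lower K_Kss; exists c0^-1; first by rewrite invr_gt0.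
move=> x; have [->|x0] := eqVneq x 0.
  by rewrite dot00 mul0r (gauge0 K_Kss) mulr0.
have hx := gauge_gt0 K_Kss x0.
by rewrite ler_pdivrMr// -mulrA -expr2 mulrC ler_pdivlMr// mulrC.
Qed.

Lemma smooth_gaussian c : smooth (gaussian c : E -> R).
Proof.
rewrite (_ : gaussian c = fun x => expR ((- c) * dot x x)); last first.
  by apply/funext => y; rewrite /gaussian mulNr.
apply: smooth_expR; apply: smoothM; first exact: smooth_cst.
exact: smooth_dot.
Qed.

Lemma euler_gaussian c x : euler (gaussian c) x = - (2 * c * dot x x) * gaussian c x.
Proof.
have sg := smooth_gaussian c.
apply: euler_unique => //; apply/is_derive_line0.
have d1 : is_derive (0:R) 1 (fun t : R => t + 1) 1.
  by have := is_deriveD (is_derive_id (0:R) 1) (is_derive_cst (1:R) (0:R) 1); rewrite addr0.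
have d2 := is_deriveZ (- (c * dot x x)) (is_deriveX 2 d1).
have d3 := @is_derive1_comp _ expR _ 0 _ _ (is_derive_expR _) d2.
rewrite (_ : (fun t => _) = expR \o (- (c * dot x x) \*: (fun t : R => t + 1) ^+ 2)); last first.
  apply/funext => t /=; rewrite /gaussian.
  have -> : t *: x + x = (t + 1) *: x by rewrite scalerDl scale1r.
  by rewrite dotZ exprfctE/= /GRing.scale/=; congr expR; ring.
apply: is_derive_eq d3 _.
rewrite /= exprfctE/= /GRing.scale/= /gaussian add0r expr1n !mulr1.
by ring.
Qed.

(** The part of [R_K (cutoff n * gaussian c)] in which the cutoff is
    differentiated.  Its square is at most a constant times [1 / (n^2 |x|^2)];
    the integral over the annulus inside the unit ball grows at most linearly in
    [n] ([shell_integral_linear]), and the gaussian takes care of the outside. *)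
Lemma cutoff_remainder c : 0 < c -> exists2 C : R, 0 <= C & forall n,
  (energy (fun=> 0%R) (fun x => (h x)^-1 * euler (@cutoff R N n) x * gaussian c x)%R <=
    (C / n.+1%:R)%:E)%E.
Proof.
move=> c0; have [D D0 HD] := dbump_bounded R.
have [c1 c10 hc] := gauge_dot_lower K_Kss.
have [S S0 HS] := @shell_integral_linear R N N_ge2.
have Goo := integral_fune_lt_pinfty measurableT (integrable_gaussian N c0).
pose G := fine (\int[L]_x (EFin \o gaussian c) x)%E.
have GE : (\int[L]_x (gaussian c x)%:E = G%:E)%E.
  by rewrite fineK//; exact: integrable_fin_num (integrable_gaussian N c0).
have G0 : 0 <= G.
  by rewrite -lee_fin -GE; apply: integral_ge0 => x _; rewrite lee_fin gaussian_ge0.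
pose B := 4 * D ^+ 2 / c1.
have B0 : 0 <= B by rewrite divr_ge0 ?(ltW c10)// mulr_ge0 ?sqr_ge0.
exists (B * (S + G)); first by rewrite mulr_ge0// addr_ge0.
move=> n; have n0 : (0 : R) < n.+1%:R by [].
have E1 x : energy_density K (fun=> 0)
    (fun x => (h x)^-1 * euler (@cutoff R N n) x * gaussian c x) x <=
    (B / n.+1%:R ^+ 2) * (shell (expR (- n.+1%:R)) 1 x + gaussian c x).
  rewrite /energy_density expr0n/= mulr0 add0r.
  have RHS0 : 0 <= B / n.+1%:R ^+ 2 * (shell (expR (- n.+1%:R)) 1 x + gaussian c x).
    by rewrite mulr_ge0 ?addr_ge0 ?gaussian_ge0 ?shell_ge0// divr_ge0// sqr_ge0.
  have [->|x0] := eqVneq x 0.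
    by rewrite (gauge0 K_Kss) invr0 !mul0r expr0n/= mulr_ge0 ?addr_ge0 ?gaussian_ge0 ?shell_ge0// divr_ge0// sqr_ge0.
  have d0 := dot_gt0 x0; have hx := gauge_gt0 K_Kss x0.
  rewrite euler_cutoff//; set t := ln _ * _.
  have [t1|t1] := leP 1 `|t|; first by rewrite dbump_eq0// mul0r mulr0 mul0r expr0n.
  have w1 : gaussian c x <= 1.
    by rewrite -expR0 ler_expR oppr_le0 mulr_ge0// ltW.
  have w0 := gaussian_ge0 c x.
  have hinv : (h x)^-1 ^+ 2 <= (c1^-1) * (dot x x)^-1.
    by rewrite exprVn -invfM lef_pV2 ?posrE ?mulr_gt0 ?exprn_gt0.
  have db2 : dbump t ^+ 2 <= D ^+ 2.
    by rewrite -[leLHS]ger0_norm ?sqr_ge0// normrX lerXn2r ?nnegrE.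
  have sh : (dot x x)^-1 * gaussian c x ^+ 2 <= shell (expR (- n.+1%:R)) 1 x + gaussian c x.
    have di : 0 <= (dot x x)^-1 by rewrite invr_ge0 ltW.
    have w2 : gaussian c x ^+ 2 <= gaussian c x by rewrite expr2 ler_piMl.
    have [dx|dx] := leP (dot x x) 1; last first.
      have : (dot x x)^-1 <= 1 by rewrite invf_le1// ltW.
      have := shell_ge0 (expR (- n.+1%:R)) 1 x; nra.
    rewrite /shell dx andbT ifT; first nra.
    move: t1; rewrite ltr_norml /t => /andP[+ _].
    rewrite ltr_pdivlMr// mulN1r => /ltW.
    by rewrite -[X in _ -> _ <= X]lnK ?posrE// ler_expR.
  have -> : ((h x)^-1 * (dbump t * (2 / n.+1%:R)) * gaussian c x) ^+ 2 =
    (4 / n.+1%:R ^+ 2) * (dbump t ^+ 2 * ((h x)^-1 ^+ 2 * gaussian c x ^+ 2)) by field; rewrite gt_eqF// ?gt_eqF.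
  have -> : B / n.+1%:R ^+ 2 * (shell (expR (- n.+1%:R)) 1 x + gaussian c x) =
    (4 / n.+1%:R ^+ 2) * (D ^+ 2 * (c1^-1 * (shell (expR (- n.+1%:R)) 1 x + gaussian c x))).
    by rewrite /B; field; rewrite !gt_eqF.
  apply: ler_wpM2l; first by rewrite divr_ge0// sqr_ge0.
  apply: ler_pM; [exact: sqr_ge0|by apply: mulr_ge0; exact: sqr_ge0|exact: db2|].
  apply: (@le_trans _ _ (c1^-1 * (dot x x)^-1 * gaussian c x ^+ 2)).
    by rewrite ler_wpM2r ?sqr_ge0.
  by rewrite -mulrA ler_wpM2l// invr_ge0 ltW.
have mcut : measurable_fun setT (fun x : E => (h x)^-1 * euler (@cutoff R N n) x * gaussian c x).
  apply: measurable_funM; last exact: measurable_gaussian.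
  apply: measurable_funM; last by apply: smooth_measurable; apply: smooth_euler; exact: smooth_cutoff.
  by apply: (measurableT_comp (@measurable_invr R)); exact: measurable_gauge.
have Bn0 : 0 <= B / n.+1%:R ^+ 2 by rewrite divr_ge0// sqr_ge0.
have key : (energy (fun=> 0%R) (fun x => (h x)^-1 * euler (@cutoff R N n) x * gaussian c x)%R <=
   \int[L]_x ((B / n.+1%:R ^+ 2)%:E *
   ((shell (expR (- n.+1%:R)) 1 x)%:E + (gaussian c x)%:E)))%E.
  apply: ge0_le_integral => //.
  - by move=> x _; rewrite lee_fin energy_density_ge0.
  - by apply/measurable_EFinP; apply: measurable_energy_density.
  - apply: emeasurable_funM => //; apply: emeasurable_funD; apply/measurable_EFinP.
      exact: measurable_shell.
    exact: measurable_gaussian.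
  - by move=> x _; rewrite -EFinD -EFinM lee_fin.
apply: (le_trans key); rewrite ge0_integralZl//; last 2 first.
- apply: emeasurable_funD; apply/measurable_EFinP.
    exact: measurable_shell.
  exact: measurable_gaussian.
- by move=> x _; rewrite -EFinD lee_fin addr_ge0 ?shell_ge0 ?gaussian_ge0.
rewrite ge0_integralD//; last 4 first.
- by move=> x _; rewrite lee_fin shell_ge0.
- by apply/measurable_EFinP; exact: measurable_shell.
- by move=> x _; rewrite lee_fin gaussian_ge0.
- by apply/measurable_EFinP; exact: measurable_gaussian.
rewrite GE; apply: (@le_trans _ _ ((B / n.+1%:R ^+ 2)%:E * ((n.+1%:R * S)%:E + G%:E))%E).
  apply: lee_wpmul2l; first by rewrite lee_fin divr_ge0// sqr_ge0.
  by apply: leeD => //; exact: HS.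
rewrite -EFinD -EFinM lee_fin.
have -> : B * (S + G) / n.+1%:R = B / n.+1%:R ^+ 2 * (n.+1%:R * S + n.+1%:R * G).
  by field; rewrite gt_eqF.
apply: ler_wpM2l => //; rewrite lerD2l ler_peMl//.
by rewrite ler1n.
Qed.

End gaussians.

Section simple_approximation.
Import HBNNSimple.

Lemma simple_approximation d (T : measurableType d) (R : realType) (m : T -> R) :
  measurable_fun setT m -> (forall x, 0 <= m x) ->
  exists f : nat -> T -> R, forall n,
    [/\ measurable_fun setT (f n), finite_set (range (f n)),
        forall x, 0 <= f n x <= m x & forall x, f k x @[k --> \oo] --> m x].
Proof.
move=> mm m0.
have mE : measurable_fun setT (EFin \o m) by exact/measurable_EFinP.
pose f := nnsfun_approx measurableT mE.
have cf x : f k x @[k --> \oo] --> m x.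
  have mE0 y : setT y -> (0 <= (EFin \o m) y)%E by rewrite /= lee_fin.
  by have /fine_cvg := cvg_nnsfun_approx measurableT mE mE0 (I : setT x).
exists (fun n => f n) => n; split => //.
  move=> x; rewrite fun_ge0/=.
  have nd : nondecreasing_seq (fun k => f k x).
    by move=> i j ij; have /lefP := nd_nnsfun_approx measurableT mE ij; exact.
  rewrite -(cvg_lim _ (cf x))//.
  by apply: (nondecreasing_cvgn_le nd); apply/cvg_ex; exists (m x).
Qed.

End simple_approximation.

Section extremals.
Variables (R : realType) (N : nat) (K : set 'rV[R]_N).
Hypothesis K_Kss : Kss_o K.
Hypothesis N_ge2 : (2 <= N)%N.
Local Notation h := (minkowski_functional K).
Local Notation E := 'rV[R]_N.
Local Notation approximable := (approximable K).
Local Notation energy := (energy K).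
Implicit Types (u v g m : E -> R) (x : E) (c : R).

Let N_gt0 : (0 < N)%N. Proof. exact: leq_trans N_ge2. Qed.

Lemma dgaussian_le : exists2 C : R, 0 < C & forall c x, 0 <= c ->
  `|dgaussian K c x| <= c * C * h x * gaussian c x.
Proof.
have [C C0 hC] := dot_div_gauge K_Kss; exists (2 * C); first by rewrite mulr_gt0.
move=> c x c0; rewrite normrM (ger0_norm (gaussian_ge0 _ _)) ler_wpM2r ?gaussian_ge0//.
have d0 : 0 <= dot x x * (h x)^-1 by rewrite mulr_ge0 ?dot_ge0// invr_ge0 gauge_ge0.
rewrite normrN -mulrA ger0_norm; last by apply: mulr_ge0 => //; apply: mulr_ge0.
by have := hC x; have := gauge_ge0 K_Kss x; nra.
Qed.

Lemma energy_gaussian c : 0 < c -> (energy (gaussian c) (dgaussian K c) < +oo)%E.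
Proof.
move=> c0; have [C C0 HC] := energy_density_le_gaussian K_Kss.
have [D D0 HD] := dgaussian_le.
have c2 : 0 < 2 * c by rewrite mulr_gt0.
have iG := integrableZl measurableT ((1 + c * D) ^+ 2 * C) (integrable_poly_gaussian N c2).
apply: (energy_lt_pinfty K_Kss (G := fun x => (1 + c * D) ^+ 2 * C * ((1 + dot x x) * gaussian (2 * c) x))) => //.
- exact: measurable_gaussian.
- exact: measurable_dgaussian.
- have cD : 0 <= c * D by rewrite mulr_ge0// ltW.
  move=> x; apply: HC.
    by rewrite ger0_norm ?gaussian_ge0// ler_peMl ?gaussian_ge0// lerDl.
  apply: le_trans (HD c x (ltW c0)) _; rewrite ler_wpM2r ?gaussian_ge0//.
  by rewrite ler_wpM2r ?gauge_ge0// lerDr.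
Qed.

Lemma dgaussianE c x : dgaussian K c x = (h x)^-1 * euler (gaussian c) x.
Proof. by rewrite euler_gaussian /dgaussian; ring. Qed.

Lemma eulerM u v x : smooth u -> smooth v ->
  euler (fun y => u y * v y) x = u x * euler v x + v x * euler u x.
Proof.
move=> su sv; apply: euler_unique; first exact: smoothM.
exact: is_deriveM (is_derive_euler x su) (is_derive_euler x sv).
Qed.

(** The products with the cutoffs are test functions.  The error has two parts:
    what the cutoff removes, small by dominated convergence, and
    [cutoff_remainder]. *)
Lemma gaussian_approximable c : 0 < c -> approximable (gaussian c) (dgaussian K c).
Proof.
move=> c0; have mg := @measurable_gaussian R N c.
have mdg := measurable_dgaussian K_Kss c.
have sg := @smooth_gaussian R N c.
have scut n := @smooth_cutoff R N n.
have mcut n := smooth_measurable (scut n).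
split=> // e e0.
have [C C0 HC] := cutoff_remainder K_Kss N_ge2 c0.
have e4 : 0 < e / 4 by rewrite divr_gt0.
pose un n x := @cutoff R N n x * gaussian c x.
pose gn n x := @cutoff R N n x * dgaussian K c x.
have mun n : measurable_fun setT (un n) by exact: measurable_funM.
have mgn n : measurable_fun setT (gn n) by exact: measurable_funM.
have iG := integrable_energy K_Kss mg mdg (energy_gaussian c0).
have near1 : \forall n \near \oo, (energy (fun x => un n x - gaussian c x)%R
    (fun x => gn n x - dgaussian K c x)%R < (e / 4)%:E)%E.
  apply: (energy_dominated K_Kss N_gt0 mg mdg mun mgn _ _
    (integrableZl measurableT (expR 2 ^+ 2 + 1) iG)) => //.
  - move=> x x0; rewrite -[X in _ --> X]mul1r.
    by apply: cvgM; [exact: cvg_cutoff|exact: cvg_cst].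
  - move=> x x0; rewrite -[X in _ --> X]mul1r.
    by apply: cvgM; [exact: cvg_cutoff|exact: cvg_cst].
  - move=> n x x0 /=.
    rewrite (_ : energy_density _ _ _ _ = (@cutoff R N n x - 1) ^+ 2 * energy_density K (gaussian c) (dgaussian K c) x).
      rewrite ler_wpM2r ?energy_density_ge0//.
      have : 0 <= @cutoff R N n x by exact: bump_ge0.
      have : @cutoff R N n x <= expR 2 by exact: bump_le.
      nra.
    by rewrite /energy_density /un /gn; ring.
have near2 : \forall n \near \oo, C / n.+1%:R <= e / 4.
  near=> n; rewrite ler_pdivrMr// mulrC -ler_pdivrMr//.
  apply: (@le_trans _ _ n%:R); last by rewrite ler_nat.
  by near: n; exact: nbhs_infty_ger.
have [n _ /(_ _ (leqnn n)) /= [H1 H2]] := filterI near1 near2.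
have cv : Cc_infty (fun x => @cutoff R N n x * gaussian c x).
  apply: Cc_inftyM => //; apply: (@Cc_infty_intro _ _ _ (expR (- n.+1%:R)) (expR n.+1%:R)) => //.
  - exact: cutoff_support.
exists (fun x => @cutoff R N n x * gaussian c x) => //.
have mrv := measurable_radial_derivative K_Kss (Cc_infty_smooth cv).
apply: le_trans (energy_triangle K_Kss (u1 := fun x => un n x - gaussian c x)
  (g1 := fun x => gn n x - dgaussian K c x) (u2 := fun=> 0)
  (g2 := fun x => (h x)^-1 * euler (@cutoff R N n) x * gaussian c x) _ _ _ _ _ _ _ _) _.
- exact: measurable_funB.
- exact: measurable_funB.
- exact: measurable_cst.
- apply: measurable_funM => //; apply: measurable_funM.
    by apply: (measurableT_comp (@measurable_invr R)); exact: measurable_gauge.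
  by apply: smooth_measurable; exact: smooth_euler.
- by apply: measurable_funB => //; exact: (smooth_measurable (Cc_infty_smooth cv)).
- by apply: measurable_funB.
- by move=> x; rewrite addr0.
- move=> x; rewrite radial_derivativeE eulerM// dgaussianE /gn dgaussianE; ring.
apply: (@le_trans _ _ (2%:E * (e / 4)%:E + 2%:E * (e / 4)%:E)%E).
  apply: leeD; rewrite lee_wpmul2l//; first exact: ltW.
  by apply: le_trans (HC n) _; rewrite lee_fin.
by rewrite -!EFinM -EFinD lee_fin; lra.
Unshelve. all: by end_near. Qed.

(** A simple function [f] with [0 <= f <= m] is a multiplier by gluing, and the
    energy density of [u * m] dominates the errors. *)
Lemma approximable_ge0_homogeneous u g m : measurable_fun setT m ->
  (forall x, 0 <= m x) -> (forall l x, 0 < l -> m (l *: x) = m x) ->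
  approximable u g -> (energy u g < +oo)%E ->
  (energy (fun x => u x * m x)%R (fun x => g x * m x)%R < +oo)%E ->
  approximable (fun x => u x * m x) (fun x => g x * m x).
Proof.
move=> mm m0 mh aug fin finm; have [mu mg _] := aug.
have [f Hf] := simple_approximation mm m0.
have md := @measurable_direction R N.
have mum := measurable_funM mu mm; have mgm := measurable_funM mg mm.
apply: (@approximable_dominated _ _ _ K_Kss (fun n x => u x * f n (direction x))
  (fun n x => g x * f n (direction x)) _ _ (energy_density K (fun x => u x * m x) (fun x => g x * m x))) => //.
- move=> n; have [mf ff f0 _] := Hf n.
  apply: (approximable_glue K_Kss N_gt0 (U := fun y x => u x * y) (G := fun y x => g x * y) mf ff) => y _.
  split; first exact: approximableZ.
  have muy : measurable_fun setT (fun x => u x * y) by exact: measurable_funM.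
  have mgy : measurable_fun setT (fun x => g x * y) by exact: measurable_funM.
  apply: (energy_lt_pinfty K_Kss muy mgy (integrableZl measurableT (y ^+ 2) (integrable_energy K_Kss mu mg fin))).
  by move=> x; rewrite /energy_density le_eqVlt; apply/orP; left; apply/eqP; ring.
- move=> x _; rewrite -[m x](homogeneous_direction x mh).
  by apply: cvgM; [exact: cvg_cst|have [_ _ _] := Hf 0%N; exact].
- move=> x _; rewrite -[m x](homogeneous_direction x mh).
  by apply: cvgM; [exact: cvg_cst|have [_ _ _] := Hf 0%N; exact].
- exact: integrable_energy.
- move=> n x _; have [_ _ /(_ (direction x)) fm _] := Hf n.
  have {}fm : 0 <= f n (direction x) <= m x by rewrite -(homogeneous_direction x mh).
  rewrite (_ : energy_density _ _ _ _ = (f n (direction x) - m x) ^+ 2 * energy_density K u g x); last first.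
    by rewrite /energy_density; ring.
  rewrite energy_densityM ler_wpM2r ?energy_density_ge0//.
  by have /andP[] := fm; nra.
Qed.

Lemma approximable_homogeneous u g m : measurable_fun setT m ->
  (forall l x, 0 < l -> m (l *: x) = m x) ->
  approximable u g -> (energy u g < +oo)%E ->
  (energy (fun x => u x * m x)%R (fun x => g x * m x)%R < +oo)%E ->
  approximable (fun x => u x * m x) (fun x => g x * m x).
Proof.
move=> mm mh aug fin finm; have [mu mg _] := aug.
pose p x := Num.max (m x) 0; pose q x := Num.max (- m x) 0.
have mp : measurable_fun setT p by exact: measurable_funrpos.
have mq : measurable_fun setT q by exact: measurable_funrneg.
have mum := measurable_funM mu mm; have mgm := measurable_funM mg mm.
have H (r : E -> R) : measurable_fun setT r -> (forall x, 0 <= r x <= `|m x|) ->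
    (forall l x, 0 < l -> r (l *: x) = r x) ->
    approximable (fun x => u x * r x) (fun x => g x * r x).
  move=> mr rm rh; apply: approximable_ge0_homogeneous => //.
    by move=> x; have /andP[] := rm x.
  have mur := measurable_funM mu mr; have mgr := measurable_funM mg mr.
  apply: (energy_lt_pinfty K_Kss mur mgr (integrable_energy K_Kss mum mgm finm)) => x.
  rewrite !energy_densityM ler_wpM2r ?energy_density_ge0//.
  have /andP[r0 rmx] := rm x.
  by rewrite -[m x ^+ 2]ger0_norm ?sqr_ge0// normrX lerXn2r ?nnegrE.
have Hp := H p mp _ _; have Hq := H q mq _ _.
have {Hp}Hp : approximable (fun x => u x * p x) (fun x => g x * p x).
  apply: Hp => [x|l x l0]; last by rewrite /p mh.
  by rewrite /p le_max lexx orbT/= ge_max ler_norm normr_ge0.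
have {Hq}Hq : approximable (fun x => u x * q x) (fun x => g x * q x).
  apply: Hq => [x|l x l0]; last by rewrite /q mh.
  by rewrite /q le_max lexx orbT/= ge_max normr_ge0 andbT -normrN ler_norm.
have := approximableD K_Kss Hp (approximableZ K_Kss (-1) Hq).
have pq x : m x = p x - q x.
  by rewrite /p /q; case: (leP (m x) 0) => m1; case: (leP (- m x) 0) => m2; lra.
by congr approximable; apply/funext => x; rewrite (pq x); ring.
Qed.

End extremals.

Section gauge_gaussian.
Variables (R : realType) (N : nat) (K : set 'rV[R]_N).
Hypothesis K_Kss : Kss_o K.
Hypothesis N_ge2 : (2 <= N)%N.
Local Notation h := (minkowski_functional K).
Local Notation E := 'rV[R]_N.
Local Notation approximable := (approximable K).
Local Notation energy := (energy K).
Implicit Types (u v g m : E -> R) (x : E) (c : R).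

Let N_gt0 : (0 < N)%N. Proof. exact: leq_trans N_ge2. Qed.

Definition gauge_gaussian c x : R := expR (- (c * h x ^+ 2)).
Definition dgauge_gaussian c x : R := - (2 * c * h x) * gauge_gaussian c x.

Lemma measurable_gauge_gaussian c : measurable_fun setT (gauge_gaussian c).
Proof.
apply: (measurableT_comp (@measurable_expR R)); apply: measurableT_comp => //.
by apply: measurable_funM => //; apply: measurable_funX; exact: measurable_gauge.
Qed.

Lemma measurable_dgauge_gaussian c : measurable_fun setT (dgauge_gaussian c).
Proof.
apply: measurable_funM; last exact: measurable_gauge_gaussian.
by apply: measurableT_comp => //; apply: measurable_funM => //; exact: measurable_gauge.
Qed.

Lemma gauge_gaussian_ge0 c x : 0 <= gauge_gaussian c x.
Proof. exact: expR_ge0. Qed.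

Lemma gauge_gaussian_le_gaussian c c0 x : 0 <= c -> (forall x, c0 * dot x x <= h x ^+ 2) ->
  gauge_gaussian c x <= gaussian (c * c0) x.
Proof. by move=> c00 hc; rewrite ler_expR lerN2 -mulrA ler_wpM2l. Qed.

Lemma energy_gauge_gaussian c : 0 < c ->
  (energy (gauge_gaussian c) (dgauge_gaussian c) < +oo)%E.
Proof.
move=> c0; have [C C0 HC] := energy_density_le_gaussian K_Kss.
have [c1 c10 hc1] := gauge_dot_lower K_Kss.
have cc1 : 0 < 2 * (c * c1) by rewrite !mulr_gt0.
have iG := integrableZl measurableT ((1 + 2 * c) ^+ 2 * C) (integrable_poly_gaussian N cc1).
apply: (energy_lt_pinfty K_Kss (G := fun x => (1 + 2 * c) ^+ 2 * C * ((1 + dot x x) * gaussian (2 * (c * c1)) x))) => //.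
- exact: measurable_gauge_gaussian.
- exact: measurable_dgauge_gaussian.
- have c2 : 0 <= 2 * c by rewrite mulr_ge0// ltW.
  move=> x; have gg := gauge_gaussian_le_gaussian x (ltW c0) hc1.
  have hx := gauge_ge0 K_Kss x.
  apply: HC.
    rewrite ger0_norm ?gauge_gaussian_ge0//; apply: (le_trans gg).
    by rewrite ler_peMl ?gaussian_ge0// lerDl.
  rewrite normrM (ger0_norm (gauge_gaussian_ge0 _ _)) normrN ger0_norm ?mulr_ge0//; last exact: ltW.
  by apply: ler_pM => //; rewrite ?gauge_gaussian_ge0 ?mulr_ge0 ?(ltW c0)// ler_wpM2r// lerDr.
Qed.

(** On each ray [exp (- c h^2)] is the Euclidean gaussian of parameter [c * k],
    where [k = h^2 / |x|^2] depends on the direction only and stays between two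
    positive constants.  If [k] is replaced by simple functions that increase to
    it, the glued gaussians converge and are dominated by the gaussian with the
    smallest parameter. *)
Lemma gauge_gaussian_approximable c : 0 < c ->
  approximable (gauge_gaussian c) (dgauge_gaussian c).
Proof.
move=> c0.
have [k0 k00 hk0] := gauge_dot_lower K_Kss; have [k1 k10 hk1] := gauge_dot_upper K_Kss.
have [C C0 HC] := energy_density_le_gaussian K_Kss.
have [D D0 HD] := dgaussian_le K_Kss.
have md := @measurable_direction R N.
(* the maximum matters at the origin only, where the quotient is 0 *)
pose k x := Num.max (h x ^+ 2 * (dot x x)^-1) k0.
have kE x : x != 0 -> k x = h x ^+ 2 * (dot x x)^-1.
  move=> x0; rewrite /k; apply/max_idPl; rewrite ler_pdivlMr ?dot_gt0//.
have kh l x : 0 < l -> k (l *: x) = k x.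
  move=> l0; rewrite /k gaugeZ// dotZ exprMn invfM mulrACA divff ?mul1r//.
  by rewrite expf_neq0// gt_eqF.
have mk : measurable_fun setT k.
  apply: measurable_maxr => //; apply: measurable_funM.
    by apply: measurable_funX; exact: measurable_gauge.
  by apply: (measurableT_comp (@measurable_invr R)); exact: measurable_dot.
have mkk : measurable_fun setT (fun x => k x - k0) by exact: measurable_funB.
have kk0 x : 0 <= k x - k0 by rewrite subr_ge0 /k le_max lexx orbT.
have [f Hf] := simple_approximation mkk kk0.
have fk n x : x != 0 -> [/\ 0 <= f n (direction x), k0 + f n (direction x) <= k1 &
   k0 + f n (direction x) <= k x].
  move=> x0; have [_ _ /(_ (direction x)) /andP[f0 fk] _] := Hf n.
  have fk' : k0 + f n (direction x) <= k x.
    by rewrite -(homogeneous_direction x kh) -lerBrDl.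
  split => //; apply: (le_trans fk'); rewrite kE// ler_pdivrMr ?dot_gt0//.
have gE x : x != 0 -> gauge_gaussian c x = gaussian (c * k x) x.
  move=> x0; rewrite /gauge_gaussian /gaussian kE// -!mulrA mulVf ?mulr1//.
  by rewrite gt_eqF// dot_gt0.
have dgE x : x != 0 -> dgauge_gaussian c x = dgaussian K (c * k x) x.
  move=> x0; rewrite /dgauge_gaussian /dgaussian -gE// kE//.
  by congr (_ * _); field; rewrite !gt_eqF ?dot_gt0 ?gauge_gt0.
pose un n x := gaussian (c * (k0 + f n (direction x))) x.
pose gn n x := dgaussian K (c * (k0 + f n (direction x))) x.
have cf x : x != 0 -> c * (k0 + f n (direction x)) @[n --> \oo] --> c * k x.
  move=> x0; apply: cvgM; first exact: cvg_cst.
  rewrite -[k x](subrKC k0); apply: cvgD; first exact: cvg_cst.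
  rewrite -(homogeneous_direction x kh).
  by have [_ _ _] := Hf 0%N; exact.
have cg x : x != 0 -> un n x @[n --> \oo] --> gauge_gaussian c x.
  move=> x0; rewrite gE//; apply: continuous_cvg; first exact: continuous_expR.
  by apply: cvgN; apply: cvgM; [exact: cf|exact: cvg_cst].
have mg := measurable_gauge_gaussian c.
have mdg := measurable_dgauge_gaussian c.
have ck0 : 0 < c * k0 by rewrite mulr_gt0.
have ck02 : 0 < 2 * (c * k0) by rewrite mulr_gt0.
pose a := 2 + 2 * (c * k1 * D).
have iG := integrableZl measurableT (a ^+ 2 * C) (integrable_poly_gaussian N ck02).
apply: (@approximable_dominated _ _ _ K_Kss un gn _ _
  (fun x => a ^+ 2 * C * ((1 + dot x x) * gaussian (2 * (c * k0)) x))) => //.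
- move=> n; have [mf ff f0 _] := Hf n.
  apply: (approximable_glue K_Kss N_gt0 (U := fun y => gaussian (c * (k0 + y)))
    (G := fun y => dgaussian K (c * (k0 + y))) mf ff) => _ [z _ <-].
  have cz : 0 < c * (k0 + f n z).
    by rewrite mulr_gt0// ltr_pwDl//; have /andP[] := f0 z.
  by split; [exact: gaussian_approximable|exact: energy_gaussian].
- move=> x x0; rewrite dgE//; apply: cvgM; last by rewrite -gE//; exact: cg.
  apply: cvgN; apply: cvgM; last exact: cvg_cst.
  by apply: cvgM; [apply: cvgM; [exact: cvg_cst|exact: cf]|exact: cvg_cst].
- move=> n x x0; have [f0 f1 f2] := fk n x x0.
  have d0 := dot_ge0 x; have hx := gauge_ge0 K_Kss x.
  have mono b : k0 <= b -> gaussian (c * b) x <= gaussian (c * k0) x.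
    move=> kb; rewrite ler_expR lerN2 -!mulrA ler_wpM2l ?(ltW c0)//.
    by rewrite ler_wpM2r.
  have kx0 : k0 <= k x by rewrite /k le_max lexx orbT.
  have kx1 : k x <= k1 by rewrite kE// ler_pdivrMr ?dot_gt0.
  have kf0 : k0 <= k0 + f n (direction x) by rewrite lerDl.
  have ckD : 0 <= c * k1 * D by rewrite !mulr_ge0// ltW.
  have g0 := gaussian_ge0 (c * k0) x.
  have H1 : un n x <= gaussian (c * k0) x by exact: mono.
  have H2 : gauge_gaussian c x <= gaussian (c * k0) x by rewrite gE//; exact: mono.
  have dmono b : k0 <= b -> b <= k1 ->
      `|dgaussian K (c * b) x| <= c * k1 * D * (h x * gaussian (c * k0) x).
    move=> kb bk; have b0 : 0 <= b by exact: le_trans (ltW k00) kb.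
    apply: le_trans (HD _ x _) _; first by rewrite mulr_ge0// ltW.
    rewrite -!mulrA ler_wpM2l ?(ltW c0)//; apply: ler_pM => //.
      by rewrite mulr_ge0 ?(ltW D0)// mulr_ge0// gaussian_ge0.
    by rewrite ler_wpM2l ?(ltW D0)// ler_wpM2l// mono.
  apply: HC.
    apply: (@le_trans _ _ (gaussian (c * k0) x)).
      by have := gaussian_ge0 (c * (k0 + f n (direction x))) x;
        have := gauge_gaussian_ge0 c x; rewrite /un in H1 *; rewrite ler_norml; lra.
    by rewrite ler_peMl// /a; lra.
  apply: le_trans (ler_normB _ _) _; rewrite dgE//.
  apply: (le_trans (lerD (dmono _ kf0 f1) (dmono _ kx0 kx1))).
  have -> : a * h x * gaussian (c * k0) x = c * k1 * D * (h x * gaussian (c * k0) x) +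
    c * k1 * D * (h x * gaussian (c * k0) x) + 2 * (h x * gaussian (c * k0) x).
    by rewrite /a; ring.
  by rewrite lerDl mulr_ge0// mulr_ge0.
Qed.

End gauge_gaussian.

(** * The virial identity *)

Section virial.
Variables (R : realType) (N : nat) (K : set 'rV[R]_N).
Hypothesis K_Kss : Kss_o K.
Hypothesis N_gt0 : (0 < N)%N.
Local Notation h := (minkowski_functional K).
Local Notation E := 'rV[R]_N.
Local Notation L := (lebesgue_rV R N).
Local Notation mu1 := (@lebesgue_measure R).
Implicit Types (P : E -> R) (x : E) (b c l : R).

Lemma cvg_expRN_quadratic c : 0 < c -> expR (- (c * l ^+ 2)) @[l --> +oo] --> (0 : R).
Proof.
move=> c0; apply/cvgrPdist_le => /= e e0; near=> l.
rewrite sub0r normrN ger0_norm ?expR_ge0// expRN invf_ple ?posrE ?expR_gt0//.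
apply: le_trans (expR_ge1Dx _); rewrite -[leLHS]add0r lerD//.
have l1 : 1 <= l by near: l; exact: nbhs_pinfty_ge.
have : e^-1 / c <= l by near: l; apply: nbhs_pinfty_ge; rewrite num_real.
rewrite ler_pdivrMr// mulrC => /le_trans; apply.
by rewrite ler_wpM2l ?(ltW c0)// expr2 ler_peMl// (le_trans ler01).
Unshelve. all: by end_near. Qed.

(** The fundamental theorem of calculus for the function of [l] that is
    [- expR (- (c * l ^+ 2))]. *)
Lemma integral_gaussian_tail c : 0 < c ->
  (\int[mu1]_(l in `[1%R, +oo[) (2 * c * l * expR (- (c * l ^+ 2)))%:E = (expR (- c))%:E)%E.
Proof.
move=> c0; pose F l : R := - expR (- (c * l ^+ 2)).
have dF (l : R) : is_derive l 1 F (2 * c * l * expR (- (c * l ^+ 2))).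
  have d1 := is_deriveZ (- c) (is_deriveX 2 (is_derive_id l 1)).
  have d2 := is_deriveN (@is_derive1_comp _ expR _ l _ _ (is_derive_expR _) d1).
  rewrite (_ : F = - (expR \o (- c \*: (@id R) ^+ 2))); last first.
    apply/funext => t; rewrite /F; congr (- _); rewrite /= exprfctE/= /GRing.scale/=.
    by rewrite mulNr.
  apply: is_derive_eq d2 _; rewrite /= exprfctE/= /GRing.scale/= mulNr; ring.
have cF : continuous F.
  by move=> t; apply/differentiable_continuous/derivable1_diffP; have [] := dF t.
rewrite (@ge0_continuous_FTC2y _ _ F 1 0).
- by rewrite /F expr1n mulr1 sub0e -EFinN opprK.
- move=> x x1; have x0 : 0 <= x by exact: le_trans x1.
  by rewrite !mulr_ge0 ?expR_ge0// ltW.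
- apply: continuous_subspaceT => x; apply: cvgM.
    by apply: cvgM; [exact: cvg_cst|exact: cvg_id].
  have cE : continuous (fun l => expR (- (c * l ^+ 2))).
    rewrite (_ : (fun l => _) = fun l => - F l); last first.
      by apply/funext => y; rewrite /F opprK.
    by move=> y; apply: cvgN; exact: cF.
  exact: cE.
- by rewrite -oppr0; apply: cvgN; exact: cvg_expRN_quadratic.
- by move=> x _; have [] := dF x.
- by apply: cvg_at_right_filter; exact: cF.
- by move=> x _; rewrite derive1E; have [_ ->] := dF x.
Qed.

Lemma integral_power_tail (n : nat) : (0 < n)%N ->
  (\int[mu1]_(l in `[1%R, +oo[) (l^-1 ^+ n.+1)%:E = (n%:R^-1)%:E)%E.
Proof.
move=> n0; have nR : (n%:R : R) != 0 by rewrite pnatr_eq0 -lt0n.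
pose F l : R := - n%:R^-1 * l^-1 ^+ n.
have dF (l : R) : l != 0 -> is_derive l 1 F (l^-1 ^+ n.+1).
  move=> l0.
  have dV : is_derive l 1 (fun t : R => t^-1) (- l ^- 2).
    by have := is_deriveV l0 (is_derive_id l 1); rewrite [_ *: 1]mulr1.
  have d1 := is_deriveZ (- n%:R^-1) (is_deriveX n dV).
  rewrite (_ : F = - n%:R^-1 \*: (GRing.inv ^+ n : R -> R)); last first.
    by apply/funext => t; rewrite /F /= exprfctE.
  apply: is_derive_eq d1 _; rewrite /GRing.scale/=.
  have -> : l^-1 ^+ n.+1 = l^-1 ^+ n.-1 * l^-1 ^+ 2 by rewrite -exprD addn2 prednK.
  by set q := _ ^+ n.-1; field; rewrite l0.
have cont1 (x : R) : x != 0 -> {for x, continuous (fun l : R => l^-1 ^+ n.+1)}.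
  move=> x0; exact: (@continuous_comp R R R GRing.inv (fun t => t ^+ n.+1) x
    (inv_continuous x0) (@exprn_continuous R n.+1 _)).
rewrite (@ge0_continuous_FTC2y _ _ F 1 0).
- by rewrite /F invr1 expr1n mulr1 sub0e -EFinN opprK.
- by move=> x x1; rewrite exprn_ge0// invr_ge0 (le_trans ler01).
- apply: continuous_in_subspaceT => x; rewrite inE/= in_itv/= andbT => x1.
  have x0 : x != 0 by rewrite gt_eqF// (lt_le_trans ltr01).
  exact: cont1.
- apply/cvgrPdist_le => /= e e0; near=> l.
  have l1 : 1 <= l by near: l; exact: nbhs_pinfty_ge.
  have l0 : 0 < l by exact: lt_le_trans l1.
  have le : e^-1 <= l by near: l; apply: nbhs_pinfty_ge; rewrite num_real.
  have li : l^-1 <= e by rewrite invf_ple ?posrE.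
  have li1 : l^-1 <= 1 by rewrite invf_le1.
  have li0 : 0 <= l^-1 by rewrite invr_ge0 ltW.
  have ni1 : n%:R^-1 <= 1 :> R by rewrite invf_le1 ?ltr0n// ler1n.
  rewrite sub0r normrN /F mulNr normrN ger0_norm; last first.
    by rewrite mulr_ge0// ?exprn_ge0// invr_ge0.
  apply: (@le_trans _ _ (l^-1 ^+ n)); first by rewrite ler_piMl ?exprn_ge0.
  apply: le_trans li; case: n n0 nR {F dF ni1 cont1} => // n _ _.
  by rewrite exprS ler_piMr// exprn_ile1.
- move=> x x1; have x0 : x != 0 by rewrite gt_eqF// (lt_trans ltr01).
  by have [] := dF x x0.
- apply: cvg_at_right_filter.
  by apply/differentiable_continuous/derivable1_diffP; have [] := dF 1 (oner_neq0 _).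
- move=> x; rewrite in_itv/= andbT => x1; rewrite derive1E.
  have x0 : x != 0 by rewrite gt_eqF// (lt_trans ltr01).
  by have [_ ->] := dF x x0.
Unshelve. all: by end_near. Qed.

(** Let [W] be the integrand on the left and [V = h^2 W].  Since [P] is constant
    along rays, [integral_gaussian_tail] writes [W x] as the integral over
    [l >= 1] of [2 c / l * V (l *: x)].  The integral over [x] of [V (l *: x)] is
    [l ^- N] times that of [V], and the integral of [l ^- N.+1] over [l >= 1] is
    [1 / N].  All integrands are nonnegative, so that both sides may be
    infinite. *)
Lemma virial P c : 0 < c -> measurable_fun setT P -> (forall x, 0 <= P x) ->
  (forall l x, 0 < l -> P (l *: x) = P x) ->
  (N%:R%:E * \int[L]_x (P x * expR (- (c * h x ^+ 2)))%:E =
   (2 * c)%:E * \int[L]_x (h x ^+ 2 * (P x * expR (- (c * h x ^+ 2))))%:E)%E.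
Proof.
move=> c0 mP P0 Ph.
have mh := measurable_gauge K_Kss.
have NR : (N%:R : R) != 0 by rewrite pnatr_eq0 -lt0n.
pose W x := P x * expR (- (c * h x ^+ 2)).
pose V x := h x ^+ 2 * W x.
have W0 x : 0 <= W x by rewrite mulr_ge0// expR_ge0.
have V0 x : 0 <= V x by rewrite mulr_ge0// sqr_ge0.
have mW : measurable_fun setT W.
  apply: measurable_funM => //; apply: (measurableT_comp (@measurable_expR R)).
  apply: measurableT_comp => //; apply: measurable_funM => //; exact: measurable_funX.
have mV : measurable_fun setT V by apply: measurable_funM => //; exact: measurable_funX.
have mD : measurable [set` `[(1:R), +oo[ ] by exact: measurable_itv.
(* extended by 0 below l = 1, to apply the theorem of Tonelli on E x R *)
pose k (p : E * R) : R := \1_[set` `[(1:R), +oo[ ] p.2 * (2 * c * p.2^-1 * V (p.2 *: p.1)).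
have mk : measurable_fun setT k.
  apply: measurable_funM.
    exact: (measurableT_comp (measurable_indic mD) measurable_snd).
  apply: measurable_funM.
    apply: measurable_funM => //.
    exact: (measurableT_comp (@measurable_invr R) measurable_snd).
  exact: (measurableT_comp mV (@measurable_rV_scaler R N)).
have k0 p : 0 <= k p.
  rewrite /k indicE; case: (boolP (_ \in _)) => [|_]; last by rewrite mul0r.
  rewrite inE/= in_itv/= andbT => l1; have l0 : 0 < p.2 by exact: lt_le_trans l1.
  rewrite mul1r; apply: mulr_ge0 => //; apply: divr_ge0; last exact: ltW.
  by apply: mulr_ge0 => //; exact: ltW.
have E1 : (\int[L]_x (W x)%:E = \int[L]_x \int[mu1]_l (k (x, l))%:E)%E.
  apply: ae_eq_integral => //.
  - exact/measurable_EFinP.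
  - have := @measurable_fun_fubini_tonelli_F _ _ _ _ _ mu1 (EFin \o k)
      ((measurable_EFinP _ _).2 mk); apply => p; exact: k0.
  - apply: ae_rV_neq0 => // x x0 _.
    have ch : 0 < c * h x ^+ 2 by rewrite mulr_gt0// exprn_gt0// gauge_gt0.
    transitivity (\int[mu1]_(l in `[1%R, +oo[) ((P x)%:E *
        (2 * (c * h x ^+ 2) * l * expR (- ((c * h x ^+ 2) * l ^+ 2)))%:E))%E.
      rewrite ge0_integralZl//; last 3 first.
      - apply/measurable_EFinP; apply: measurable_funTS; apply: measurable_funM.
          by apply: measurable_funM.
        apply: (measurableT_comp (@measurable_expR R)); apply: measurableT_comp => //.
        by apply: measurable_funM => //; exact: measurable_funX.
      - move=> l /=; rewrite in_itv/= andbT => l1; rewrite lee_fin.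
        by rewrite mulr_ge0 ?expR_ge0// mulr_ge0 ?(le_trans ler01 l1)// mulr_ge0// ltW.
      - by rewrite lee_fin.
      by rewrite integral_gaussian_tail// -EFinM.
    rewrite integral_mkcond; apply: eq_integral => l _; rewrite patchE /k indicE /=.
    case: ifPn => lD; last by rewrite mul0r.
    rewrite mul1r -EFinM; congr (_%:E).
    have l0 : 0 < l.
      by move: lD; rewrite inE/= in_itv/= andbT; exact: lt_le_trans.
    rewrite /V /W Ph// (gaugeZ K_Kss)// exprMn.
    rewrite (_ : c * h x ^+ 2 * l ^+ 2 = c * (l ^+ 2 * h x ^+ 2)); last by ring.
    by field; rewrite gt_eqF.
have E2 : (\int[mu1]_l \int[L]_x (k (x, l))%:E = (2 * c / N%:R)%:E * \int[L]_x (V x)%:E)%E.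
  transitivity (\int[mu1]_(l in `[1%R, +oo[) ((2 * c)%:E * (l^-1 ^+ N.+1)%:E *
      \int[L]_x (V x)%:E))%E.
    rewrite [RHS]integral_mkcond; apply: eq_integral => l _; rewrite patchE.
    under eq_integral => x _ do rewrite /k /= indicE.
    case: ifPn => lD; last first.
      by under eq_integral => x _ do rewrite mul0r; rewrite integral0.
    have l0 : 0 < l.
      by move: lD; rewrite inE/= in_itv/= andbT; exact: lt_le_trans.
    under eq_integral => x _ do rewrite mul1r EFinM.
    have mVl : measurable_fun setT (fun x : E => (V (l *: x))%:E).
      by apply/measurable_EFinP; apply: (measurableT_comp mV); exact: measurable_rV_scale.
    have cl0 : (0 <= (2 * c / l)%:E)%E by rewrite lee_fin divr_ge0// ?mulr_ge0// ltW.
    rewrite (@ge0_integralZl _ _ _ L _ measurableT _ mVl _ (fun x _ => V0 (l *: x)) cl0).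
    rewrite (ge0_integral_scale l0 (f := EFin \o V))//; last exact/measurable_EFinP.
    by rewrite muleA -!EFinM exprS exprVn mulrA.
  have IV0 : (0 <= \int[L]_x (V x)%:E)%E by apply: integral_ge0 => x _; rewrite lee_fin.
  have mpow : measurable_fun (`[(1:R), +oo[)%classic (fun l : R => l^-1 ^+ N.+1).
    by apply: measurable_funTS; apply: measurable_funX; exact: measurable_invr.
  have pow0 (l : R) : (`[(1:R), +oo[)%classic l -> 0 <= l^-1 ^+ N.+1.
    by rewrite /= in_itv/= andbT => l1; rewrite exprn_ge0// invr_ge0 (le_trans ler01).
  rewrite ge0_integralZr//; last 2 first.
  - by apply/measurable_EFinP; apply: measurable_funM.
  - by move=> l lD; rewrite -EFinM lee_fin mulr_ge0 ?pow0// mulr_ge0// ltW.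
  rewrite ge0_integralZl//; last 2 first.
  - exact/measurable_EFinP.
  - by rewrite lee_fin mulr_ge0// ltW.
  by rewrite integral_power_tail// -EFinM.
rewrite -/W E1.
have := @fubini_tonelli _ _ _ _ _ (@leb R N) mu1 (EFin \o k)
  ((measurable_EFinP _ _).2 mk) (fun p => k0 p).
rewrite /= => ->.
rewrite [X in (_ * X)%E]E2 muleA -EFinM.
by congr (_%:E * _)%E; field.
Qed.

End virial.

(** * The completion and the constants *)

Section assembly.
Variables (R : realType) (N : nat) (K : set 'rV[R]_N).
Hypothesis K_Kss : Kss_o K.
Hypothesis N_ge2 : (2 <= N)%N.
Local Notation h := (minkowski_functional K).
Local Notation E := 'rV[R]_N.
Local Notation L := (lebesgue_rV R N).
Local Notation approximable := (approximable K).
Local Notation energy := (energy K).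
Implicit Types (u v g m : E -> R) (x : E) (c : R).

Let N_gt0 : (0 < N)%N. Proof. exact: leq_trans N_ge2. Qed.
Let mh : measurable_fun setT h. Proof. exact: measurable_gauge. Qed.
Let h1 x : 0 <= 1 + h x ^+ 2. Proof. by rewrite addr_ge0 ?sqr_ge0. Qed.

Let sq_integral_ge0 g : (0 <= sq_integral g)%E.
Proof. by apply: integral_ge0 => x _; rewrite lee_fin sqr_ge0. Qed.

Let weighted_ge0 g : (0 <= weighted_sq_integral K g)%E.
Proof. by apply: integral_ge0 => x _; rewrite lee_fin mulr_ge0 ?sqr_ge0. Qed.

Lemma integral_le_combination (F G H : E -> R) (a b : R) : 0 <= a -> 0 <= b ->
  measurable_fun setT F -> measurable_fun setT G -> measurable_fun setT H ->
  (forall x, 0 <= F x) -> (forall x, 0 <= G x) -> (forall x, 0 <= H x) ->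
  (forall x, F x <= a * G x + b * H x) ->
  (\int[L]_x (F x)%:E <= a%:E * \int[L]_x (G x)%:E + b%:E * \int[L]_x (H x)%:E)%E.
Proof.
move=> a0 b0 mF mG mH F0 G0 H0 FGH.
have -> : (a%:E * \int[L]_x (G x)%:E = \int[L]_x (a * G x)%:E)%E.
  by rewrite -ge0_integralZl//; [exact/measurable_EFinP|move=> x _; rewrite lee_fin].
have -> : (b%:E * \int[L]_x (H x)%:E = \int[L]_x (b * H x)%:E)%E.
  by rewrite -ge0_integralZl//; [exact/measurable_EFinP|move=> x _; rewrite lee_fin].
rewrite -ge0_integralD//.
- apply: ge0_le_integral => //.
  + by move=> x _; rewrite lee_fin.
  + exact/measurable_EFinP.
  + by apply: emeasurable_funD; apply/measurable_EFinP; exact: measurable_funM.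
  + by move=> x _; rewrite -EFinD lee_fin.
- by move=> x _; rewrite lee_fin mulr_ge0.
- by apply/measurable_EFinP; exact: measurable_funM.
- by move=> x _; rewrite lee_fin mulr_ge0.
- by apply/measurable_EFinP; exact: measurable_funM.
Qed.

Lemma weighted_sq_integral_le_energy u g : measurable_fun setT u -> measurable_fun setT g ->
  (weighted_sq_integral K u <= energy u g)%E.
Proof.
move=> mu mg; apply: ge0_le_integral => //.
- by move=> x _; rewrite lee_fin mulr_ge0 ?sqr_ge0.
- by apply/measurable_EFinP; apply: measurable_funM; exact: measurable_funX.
- by apply/measurable_EFinP; exact: measurable_energy_density.
- move=> x _; rewrite lee_fin /energy_density.
  by have := sqr_ge0 (u x); have := sqr_ge0 (g x); nra.
Qed.

Lemma sq_integral_le_energy u g : measurable_fun setT u -> measurable_fun setT g ->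
  (sq_integral u <= energy u g)%E.
Proof.
move=> mu mg; rewrite sq_integralE; apply: ge0_le_integral => //.
- by move=> x _; rewrite lee_fin sqr_ge0.
- by apply/measurable_EFinP; exact: measurable_funX.
- by apply/measurable_EFinP; exact: measurable_energy_density.
- move=> x _; rewrite lee_fin /energy_density mulrDl mul1r -addrA lerDl.
  by apply: addr_ge0; [apply: mulr_ge0|]; exact: sqr_ge0.
Qed.

Lemma radial_sq_integral_le_energy u g : measurable_fun setT u -> measurable_fun setT g ->
  (sq_integral g <= energy u g)%E.
Proof.
move=> mu mg; rewrite sq_integralE; apply: ge0_le_integral => //.
- by move=> x _; rewrite lee_fin sqr_ge0.
- by apply/measurable_EFinP; exact: measurable_funX.
- by apply/measurable_EFinP; exact: measurable_energy_density.
- move=> x _; rewrite lee_fin /energy_density lerDr.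
  by apply: mulr_ge0; [exact: h1|exact: sqr_ge0].
Qed.

Lemma in_completion_approximable u g : approximable u g -> in_completion K u g.
Proof.
move=> [mu mg H]; split=> //.
have H' (n : nat) : exists v, Cc_infty v /\
   (energy (fun x => v x - u x)%R (fun x => radial_derivative K v x - g x)%R <= (n.+1%:R^-1)%:E)%E.
  have n0 : (0 : R) < n.+1%:R^-1 by [].
  by have [v cv Hv] := H _ n0; exists v.
have [v Hv] := choice H'.
have c0 : (fun n : nat => (n.+1%:R^-1 : R)%:E) @ \oo --> (0 : \bar R)%E.
  exact: cvg_EFin_seq cvg_harmonic.
have mB n : measurable_fun setT (fun x => v n x - u x) /\
    measurable_fun setT (fun x => radial_derivative K (v n) x - g x).
  have [/Cc_infty_smooth sv _] := Hv n.
  split; apply: measurable_funB => //; first exact: smooth_measurable.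
  exact: measurable_radial_derivative.
exists v; split; first by move=> n; have [] := Hv n.
- apply: (@squeeze_cvge _ _ _ _ (fun=> 0%E) _ (fun n : nat => (n.+1%:R^-1 : R)%:E)) => //.
    apply: nearW => n; have [mv mr] := mB n; have [_ Hn] := Hv n.
    rewrite (le_trans (weighted_sq_integral_le_energy mv mr) Hn) andbT.
    by apply: integral_ge0 => x _; rewrite lee_fin mulr_ge0 ?sqr_ge0.
  exact: cvg_cst.
- apply: (@squeeze_cvge _ _ _ _ (fun=> 0%E) _ (fun n : nat => (n.+1%:R^-1 : R)%:E)) => //.
    apply: nearW => n; have [mv mr] := mB n; have [_ Hn] := Hv n.
    rewrite (le_trans (radial_sq_integral_le_energy mv mr) Hn) andbT.
    by apply: integral_ge0 => x _; rewrite lee_fin sqr_ge0.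
  exact: cvg_cst.
Qed.

(** The square of [s] compared with that of a nearby [t], at the price of a factor
    as close to 1 as desired. *)
Lemma young (s t e : R) : 0 < e ->
  s ^+ 2 <= (1 + e) * t ^+ 2 + (1 + e^-1) * (s - t) ^+ 2.
Proof.
move=> e0; rewrite -subr_ge0.
have -> : (1 + e) * t ^+ 2 + (1 + e^-1) * (s - t) ^+ 2 - s ^+ 2 =
   e^-1 * ((s - t) - e * t) ^+ 2 by field; rewrite gt_eqF.
by rewrite mulr_ge0 ?sqr_ge0// invr_ge0 ltW.
Qed.

(** The pair [(u, g)] is a limit of test functions in a norm that controls the
    three integrals, hence satisfies the inequality with constant [C]; and it
    satisfies the equality with constant [T]. *)
Lemma constant_le_of_extremal u g (S T C : R) : approximable u g ->
  (energy u g < +oo)%E -> sq_integral u = S%:E -> 0 < S -> 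
  (sq_integral g + weighted_sq_integral K u = (T * S)%:E)%E ->
  (forall v, Cc_infty v -> (C%:E * sq_integral v <=
     sq_integral (radial_derivative K v) + weighted_sq_integral K v)%E) ->
  C <= T.
Proof.
move=> [mu mg Hap] fin SE S0 TE HC.
have finR (X : \bar R) : (0 <= X)%E -> (X <= energy u g)%E ->
    exists2 r : R, X = r%:E & 0 <= r.
  move=> X0 XE; have Xf : X \is a fin_num by rewrite ge0_fin_numE// (le_lt_trans XE).
  by exists (fine X); [rewrite fineK|exact: fine_ge0].
have [Ag AgE Ag0] := finR _ (sq_integral_ge0 g) (radial_sq_integral_le_energy mu mg).
have [Bu BuE Bu0] := finR _ (weighted_ge0 u) (weighted_sq_integral_le_energy mu mg).
move: TE; rewrite AgE BuE -EFinD => -[TS].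
have T0 : 0 <= T by rewrite -(pmulr_lge0 _ S0) -TS addr_ge0.
have [C0|C0] := leP C 0; first exact: le_trans T0.
(* d bounds the energy of v - u, and is sent to 0 before the parameter e of
   [young] *)
have key (e d : R) : 0 < e -> 0 < d ->
    C * S <= (1 + e) ^+ 2 * (T * S) + (1 + e^-1) * (2 * (1 + e) + C) * d.
  move=> e0 d0; have [v cv Hv] := Hap d d0.
  have sv := Cc_infty_smooth cv.
  have mv := smooth_measurable sv.
  have mr := measurable_radial_derivative K_Kss sv.
  have mvu : measurable_fun setT (fun x => v x - u x) by exact: measurable_funB.
  have mrg : measurable_fun setT (fun x => radial_derivative K v x - g x) by exact: measurable_funB.
  have [A [B [Sv [AE BE SvE [A0 B0 Sv0] _]]]] := integral_sqr_family K_Kss cv.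
  have := HC v cv; rewrite AE BE SvE -EFinM -EFinD lee_fin => HCv.
  have e1 : 0 <= 1 + e by rewrite addr_ge0// ltW.
  have ei : 0 <= 1 + e^-1 by rewrite addr_ge0// invr_ge0 ltW.
  have comb (X Y Z : \bar R) (x y : R) : X = x%:E -> Y = y%:E ->
      (Z <= energy (fun x => v x - u x)%R (fun x => radial_derivative K v x - g x)%R)%E ->
      (X <= (1 + e)%:E * Y + (1 + e^-1)%:E * Z)%E -> x <= (1 + e) * y + (1 + e^-1) * d.
    move=> -> -> ZE H; rewrite -lee_fin EFinD !EFinM; apply: (le_trans H).
    by apply: leeD => //; rewrite lee_wpmul2l ?lee_fin//; exact: le_trans Hv.
  have HS : S <= (1 + e) * Sv + (1 + e^-1) * d.
    apply: (comb _ _ _ _ _ SE SvE (sq_integral_le_energy mvu mrg)).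
    rewrite !sq_integralE; apply: integral_le_combination => //;
      do ?[exact: measurable_funX|by move=> x; exact: sqr_ge0].
    by move=> x; rewrite -[(v x - u x) ^+ 2]sqrrN opprB; exact: young.
  have HA : A <= (1 + e) * Ag + (1 + e^-1) * d.
    apply: (comb _ _ _ _ _ AE AgE (radial_sq_integral_le_energy mvu mrg)).
    rewrite !sq_integralE; apply: integral_le_combination => //;
      do ?[exact: measurable_funX|by move=> x; exact: sqr_ge0].
    by move=> x; exact: young.
  have HB : B <= (1 + e) * Bu + (1 + e^-1) * d.
    apply: (comb _ _ _ _ _ BE BuE (weighted_sq_integral_le_energy mvu mrg)).
    apply: integral_le_combination => //;
      do ?[by apply: measurable_funM; exact: measurable_funX|
           by move=> x; rewrite mulr_ge0 ?sqr_ge0].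
    by move=> x; have := young (v x) (u x) e0; have := sqr_ge0 (h x); nra.
  apply: (@le_trans _ _ (C * ((1 + e) * Sv + (1 + e^-1) * d))).
    by rewrite ler_wpM2l// ltW.
  apply: (@le_trans _ _ ((1 + e) * (A + B) + C * ((1 + e^-1) * d))).
    by rewrite mulrDr lerD2r mulrCA ler_wpM2l.
  apply: (@le_trans _ _ ((1 + e) * ((1 + e) * (T * S) + 2 * ((1 + e^-1) * d)) + C * ((1 + e^-1) * d))).
    by rewrite lerD2r ler_wpM2l// -TS; lra.
  by rewrite le_eqVlt; apply/orP; left; apply/eqP; ring.
have key2 (e : R) : 0 < e -> C <= (1 + e) ^+ 2 * T.
  move=> e0; rewrite -(ler_pM2r S0) -mulrA; apply/ler_addgt0Pr => d d0.
  pose q := (1 + e^-1) * (2 * (1 + e) + C).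
  have q0 : 0 < q.
    by rewrite mulr_gt0 ?addr_gt0 ?mulr_gt0 ?addr_gt0 ?invr_gt0.
  have := key e (d / q) e0 (divr_gt0 d0 q0).
  by rewrite -/q [q * _]mulrCA mulfV ?mulr1// gt_eqF.
apply/ler_addgt0Pr => d d0.
have T1 : 0 < 3 * T + 1 by rewrite ltr_wpDl// mulr_ge0.
(* for e <= 1, (1 + e) ^+ 2 <= 1 + 3 * e *)
pose e := Num.min 1 (d / (3 * T + 1)).
have e0 : 0 < e by rewrite lt_min ltr01 divr_gt0.
have e1 : e <= 1 by rewrite ge_min lexx.
have ed : e * (3 * T + 1) <= d by rewrite -ler_pdivlMr// ge_min lexx orbT.
by apply: le_trans (key2 _ e0) _; nra.
Qed.

End assembly.

(** * The extremal functions *)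

Section extremal_family.
Variables (R : realType) (N : nat) (K : set 'rV[R]_N).
Hypothesis K_Kss : Kss_o K.
Hypothesis N_ge2 : (2 <= N)%N.
Local Notation h := (minkowski_functional K).
Local Notation E := 'rV[R]_N.
Local Notation L := (lebesgue_rV R N).
Local Notation approximable := (approximable K).
Local Notation energy := (energy K).
Local Notation gg := (gauge_gaussian K).
Local Notation dgg := (dgauge_gaussian K).
Implicit Types (u v g m : E -> R) (x : E).

Let N_gt0 : (0 < N)%N. Proof. exact: leq_trans N_ge2. Qed.
Let mh : measurable_fun setT h. Proof. exact: measurable_gauge. Qed.

Section fixed.
Variables (c : R) (m : E -> R).
Hypothesis c0 : 0 < c.
Hypothesis mm : measurable_fun setT m.
Hypothesis m_homogeneous : forall l x, 0 < l -> m (l *: x) = m x.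

Definition extremal x : R := m x * gg c x.
Definition dextremal x : R := m x * dgg c x.

Lemma measurable_extremal : measurable_fun setT extremal.
Proof. by apply: measurable_funM => //; exact: measurable_gauge_gaussian. Qed.

Lemma measurable_dextremal : measurable_fun setT dextremal.
Proof. by apply: measurable_funM => //; exact: measurable_dgauge_gaussian. Qed.

Lemma extremal_virial :
  (N%:R%:E * sq_integral extremal = (4 * c)%:E * weighted_sq_integral K extremal)%E.
Proof.
have c2 : 0 < 2 * c by rewrite mulr_gt0.
have mm2 : measurable_fun setT (fun x => m x ^+ 2) by exact: measurable_funX.
have := virial K_Kss N_gt0 c2 mm2 (fun x => sqr_ge0 (m x)) _.
have sqE x : extremal x ^+ 2 = m x ^+ 2 * expR (- (2 * c * h x ^+ 2)).
  rewrite /extremal exprMn /gauge_gaussian -expRM_natl; congr (_ * expR _); ring.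
rewrite sq_integralE (_ : 2 * (2 * c) = 4 * c); last by ring.
move=> H; under eq_integral => x _ do rewrite sqE.
rewrite H => [|l x l0]; last by rewrite m_homogeneous.
by congr (_ * _)%E; apply: eq_integral => x _; rewrite -sqE.
Qed.

Lemma dextremal_sqr x : dextremal x ^+ 2 = 4 * c ^+ 2 * (h x ^+ 2 * extremal x ^+ 2).
Proof. by rewrite /dextremal /dgauge_gaussian /extremal; ring. Qed.

Lemma dextremal_integral :
  (sq_integral dextremal = (4 * c ^+ 2)%:E * weighted_sq_integral K extremal)%E.
Proof.
rewrite sq_integralE -ge0_integralZl//.
- by apply: eq_integral => x _; rewrite dextremal_sqr -EFinM.
- apply/measurable_EFinP; apply: measurable_funM; first exact: measurable_funX.
  by apply: measurable_funX; exact: measurable_extremal.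
- by move=> x _; rewrite lee_fin mulr_ge0 ?sqr_ge0.
- by rewrite lee_fin mulr_ge0 ?sqr_ge0.
Qed.

Hypothesis fin : (sq_integral extremal < +oo)%E.

(** By the virial identity the weighted integral is finite as soon as the [L^2]
    norm is, and the radial derivative is a multiple of the weighted function. *)
Lemma extremal_energy : (energy extremal dextremal < +oo)%E.
Proof.
have me := measurable_extremal.
have W0 : (0 <= weighted_sq_integral K extremal)%E.
  by apply: integral_ge0 => x _; rewrite lee_fin mulr_ge0 ?sqr_ge0.
have Wfin : (weighted_sq_integral K extremal < +oo)%E.
  have c4 : 0 < 4 * c by rewrite mulr_gt0.
  have : ((4 * c)%:E * weighted_sq_integral K extremal < +oo)%E.
    by rewrite -extremal_virial lte_mul_pinfty.
  move: W0; case: (weighted_sq_integral K extremal) => [r _ _|_|//].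
    exact: ltry.
  by rewrite gt0_muley ?lte_fin.
apply: (@le_lt_trans _ _ (1%:E * sq_integral extremal +
   (1 + 4 * c ^+ 2)%:E * weighted_sq_integral K extremal)%E); last first.
  rewrite mul1e lte_add_pinfty// lte_mul_pinfty// lee_fin addr_ge0//.
  by rewrite mulr_ge0 ?sqr_ge0.
rewrite sq_integralE; apply: integral_le_combination => //.
- by rewrite addr_ge0// mulr_ge0 ?sqr_ge0.
- by apply: measurable_energy_density => //; exact: measurable_dextremal.
- exact: measurable_funX.
- by apply: measurable_funM; exact: measurable_funX.
- by move=> x; exact: energy_density_ge0.
- by move=> x; exact: sqr_ge0.
- by move=> x; rewrite mulr_ge0 ?sqr_ge0.
- move=> x; rewrite /energy_density dextremal_sqr le_eqVlt; apply/orP; left.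
  by apply/eqP; ring.
Qed.

Lemma extremal_approximable : approximable extremal dextremal.
Proof.
have E1 : extremal = fun x => gg c x * m x by apply/funext => x; rewrite mulrC.
have E2 : dextremal = fun x => dgg c x * m x by apply/funext => x; rewrite mulrC.
have := extremal_energy; rewrite E1 E2 => fin'.
apply: approximable_homogeneous => //.
  exact: gauge_gaussian_approximable.
exact: energy_gauge_gaussian.
Qed.

End fixed.

Lemma extremal_product c m : 0 < c -> measurable_fun setT m ->
  (forall l x, 0 < l -> m (l *: x) = m x) ->
  (sqrte (sq_integral (dextremal c m)) * sqrte (weighted_sq_integral K (extremal c m)) =
   (N%:R / 2)%:E * sq_integral (extremal c m))%E.
Proof.
move=> c0 mm mhom.
have W0 : (0 <= weighted_sq_integral K (extremal c m))%E.
  by apply: integral_ge0 => x _; rewrite lee_fin mulr_ge0 ?sqr_ge0.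
rewrite dextremal_integral// sqrteM; last by rewrite lee_fin mulr_ge0 ?sqr_ge0.
rewrite -muleA -expe2 sqr_sqrte//.
have -> : sqrte (4 * c ^+ 2)%:E = (2 * c)%:E.
  rewrite /= (_ : 4 * c ^+ 2 = (2 * c) ^+ 2); last by ring.
  by rewrite sqrtr_sqr ger0_norm// mulr_ge0// ltW.
have := extremal_virial c0 mm mhom => /(congr1 (fun X => (2^-1)%:E * X)%E).
rewrite !muleA -!EFinM => H.
rewrite (_ : N%:R / 2 = 2^-1 * N%:R); last by ring.
by rewrite H; congr (_%:E * _)%E; field.
Qed.

Lemma extremal_sum m : measurable_fun setT m ->
  (forall l x, 0 < l -> m (l *: x) = m x) ->
  (sq_integral (dextremal 2^-1 m) + weighted_sq_integral K (extremal 2^-1 m) =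
   N%:R%:E * sq_integral (extremal 2^-1 m))%E.
Proof.
move=> mm mhom; have c0 : (0 : R) < 2^-1 by [].
have W0 : (0 <= weighted_sq_integral K (extremal 2^-1 m))%E.
  by apply: integral_ge0 => x _; rewrite lee_fin mulr_ge0 ?sqr_ge0.
rewrite extremal_virial// dextremal_integral//.
rewrite (_ : 4 * 2^-1 ^+ 2 = 1 :> R); last by field.
rewrite (_ : 4 * 2^-1 = 1 + 1 :> R); last by field.
by rewrite EFinD ge0_muleDl ?lee_fin// mul1e.
Qed.

(** On the ray of direction [sigma K x], [h (x + t *: sigma K x) = h x + t] and
    [m] is constant. *)
Lemma is_derive_extremal c m x : (forall l y, 0 < l -> m (l *: y) = m y) ->
  x != 0 -> is_derive x (sigma K x) (extremal c m) (dextremal c m x).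
Proof.
move=> mhom x0; have hx := gauge_gt0 K_Kss x0.
apply/is_derive_line0.
have d1 : is_derive (0:R) 1 (fun t : R => t + h x) 1.
  by have := is_deriveD (is_derive_id (0:R) 1) (is_derive_cst (h x) (0:R) 1); rewrite addr0.
have d2 := is_deriveZ (- c) (is_deriveX 2 d1).
have d3 := @is_derive1_comp _ expR _ 0 _ _ (is_derive_expR _) d2.
have d4 := is_deriveZ (m x) d3.
have d5 : is_derive (0 : R) 1 (m x \*: (expR \o (- c \*: (fun t : R => t + h x) ^+ 2))) (dextremal c m x).
  apply: is_derive_eq d4 _.
  rewrite /= exprfctE/= /GRing.scale/= add0r !mulr1 expr1 /dextremal /dgauge_gaussian /gauge_gaussian.
  by rewrite !mulNr; ring.
apply: near_eq_is_derive d5; near=> t.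
have t0 : 0 < t * (h x)^-1 + 1.
  have : - h x < t by near: t; apply: lt_nbhsr; rewrite oppr_lt0.
  by rewrite -ltrBlDr sub0r ltr_pdivlMr// mulN1r.
have -> : t *: sigma K x + x = (t * (h x)^-1 + 1) *: x.
  by rewrite /sigma scalerA scalerDl scale1r.
rewrite /extremal mhom// /gauge_gaussian (gaugeZ K_Kss)//= exprfctE/= /GRing.scale/=.
by congr (_ * expR _); field; rewrite gt_eqF.
Unshelve. all: by end_near. Qed.

End extremal_family.

(** * Square-integrability from the polar formula *)

Section polar.
Variables (R : realType) (N : nat) (K : set 'rV[R]_N).
Hypothesis K_Kss : Kss_o K.
Hypothesis N_ge2 : (2 <= N)%N.
Variable mu : {finite_measure set 'rV[R]_N -> \bar R}.
Hypothesis polar_mu : polar_measure K mu.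
Local Notation h := (minkowski_functional K).
Local Notation E := 'rV[R]_N.
Local Notation L := (lebesgue_rV R N).

Lemma measurable_frontier : measurable (frontier K).
Proof.
apply: measurableD; last by apply: rV_open_measurable; exact: open_interior.
rewrite -[closure K]setCK; apply: measurableC; apply: rV_open_measurable.
by rewrite openC; exact: closed_closure.
Qed.

(** [Phi] is only measurable on the boundary, to which [sigma K 0] does not belong;
    hence the separate treatment of the origin. *)
Lemma measurable_comp_sigma (Phi : E -> R) : measurable_fun (frontier K) Phi ->
  measurable_fun setT (fun x => Phi (sigma K x)).
Proof.
move=> mPhi; rewrite -(setvU [set 0]); apply/measurable_funU.
- by apply: measurableC; exact: measurable_rV_set0.
- exact: measurable_rV_set0.
split.
  apply: (measurable_comp measurable_frontier _ mPhi).
    by move=> _ [x /= /eqP x0 <-]; exact: frontier_sigma.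
  by apply: measurable_funTS; exact: measurable_sigma.
move=> mD Y mY; have [PY|nPY] := pselect (Y (Phi (sigma K 0))).
  rewrite (_ : _ `&` _ = [set 0])//; apply/seteqP; split=> [x []//|x ->]; split => //.
by rewrite (_ : _ `&` _ = set0)//; apply/seteqP; split=> // x [-> /nPY].
Qed.

Lemma polar_integral (P : E -> R) (c : R) : measurable_fun setT P ->
  (forall x, 0 <= P x) -> (forall l x, 0 < l -> P (l *: x) = P x) ->
  (\int[L]_x (P x * expR (- (c * h x ^+ 2)))%:E =
   (\int[@lebesgue_measure R]_(r in `]0%R, +oo[) (r ^+ N.-1 * expR (- (c * r ^+ 2)))%:E) *
   \int[mu]_(s in frontier K) (P s)%:E)%E.
Proof.
move=> mP P0 Ph; have [_ polar] := polar_mu.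
have mh := measurable_gauge K_Kss.
have mf : measurable_fun setT (fun x => (P x * expR (- (c * h x ^+ 2)))%:E).
  apply/measurable_EFinP; apply: measurable_funM => //.
  apply: (measurableT_comp (@measurable_expR R)); apply: measurableT_comp => //.
  by apply: measurable_funM => //; exact: measurable_funX.
rewrite polar//; last by move=> x; rewrite lee_fin mulr_ge0 ?expR_ge0.
have J0 : (0 <= \int[mu]_(s in frontier K) (P s)%:E)%E.
  by apply: integral_ge0 => s _; rewrite lee_fin.
rewrite -ge0_integralZr//; last 2 first.
- apply/measurable_EFinP; apply: measurable_funTS; apply: measurable_funM.
    exact: measurable_funX.
  apply: (measurableT_comp (@measurable_expR R)); apply: measurableT_comp => //.
  by apply: measurable_funM => //; exact: measurable_funX.
- move=> r /=; rewrite in_itv/= andbT => r0; rewrite lee_fin mulr_ge0 ?expR_ge0//.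
  by rewrite exprn_ge0// ltW.
apply: eq_integral => r; rewrite inE/= in_itv/= andbT => r0.
rewrite -ge0_integralZl//; last 4 first.
- exact: measurable_frontier.
- by apply/measurable_EFinP; exact: measurable_funTS.
- by move=> s _; rewrite lee_fin.
- by rewrite lee_fin mulr_ge0 ?expR_ge0// exprn_ge0// ltW.
apply: eq_integral => s; rewrite inE => Ks.
rewrite Ph// (gaugeZ K_Kss)// (gauge_frontier K_Kss Ks) mulr1 -!EFinM.
by congr (_%:E); ring.
Qed.

(** The radial factor in [polar_integral] is the same for every [P].  For [P = 1]
    the product is finite and positive, hence the radial factor is finite. *)
Lemma polar_finite (P : E -> R) (c : R) : 0 < c -> measurable_fun setT P ->
  (forall x, 0 <= P x) -> (forall l x, 0 < l -> P (l *: x) = P x) ->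
  (\int[mu]_(s in frontier K) (P s)%:E < +oo)%E ->
  (\int[L]_x (P x * expR (- (c * h x ^+ 2)))%:E < +oo)%E.
Proof.
move=> c0 mP P0 Ph Pfin; rewrite polar_integral//.
set I := (\int[@lebesgue_measure R]_(r in _) _)%E.
have I0 : (0 <= I)%E.
  apply: integral_ge0 => r /=; rewrite in_itv/= andbT => r0.
  by rewrite lee_fin mulr_ge0 ?expR_ge0// exprn_ge0// ltW.
have J0 : (0 <= \int[mu]_(s in frontier K) (P s)%:E)%E.
  by apply: integral_ge0 => s _; rewrite lee_fin.
have Ifin : (I < +oo)%E.
  have N_gt0 : (0 < N)%N by exact: leq_trans N_ge2.
  have mg := measurable_gauge_gaussian K_Kss c.
  have E1 : (\int[L]_x (gauge_gaussian K c x)%:E = I * \int[mu]_(s in frontier K) (1%R)%:E)%E.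
    rewrite -(@polar_integral (fun=> 1))//.
    by apply: eq_integral => x _; rewrite mul1r.
  have pos : (0 < \int[L]_x (gauge_gaussian K c x)%:E)%E.
    apply: integral_gt0_rV => //; first exact/measurable_EFinP.
      by move=> x; rewrite lee_fin expR_ge0.
    by move=> x _; rewrite lte_fin expR_gt0.
  have [k k0 hk] := gauge_dot_lower K_Kss.
  have ck : 0 < c * k by rewrite mulr_gt0.
  have Gfin : (\int[L]_x (gauge_gaussian K c x)%:E < +oo)%E.
    apply: le_lt_trans (gaussian_finite N ck).
    apply: ge0_le_integral => //.
    - by move=> x _; rewrite lee_fin expR_ge0.
    - exact/measurable_EFinP.
    - by apply/measurable_EFinP; exact: measurable_gaussian.
    - move=> x _; rewrite lee_fin; apply: gauge_gaussian_le_gaussian => //; exact: ltW.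
  move: pos Gfin; rewrite E1; set J := (\int[mu]_(s in _) _)%E.
  have J1 : (0 <= J)%E by apply: integral_ge0 => s _; rewrite lee_fin.
  move: I0; case: I {E1} => [r _|_|//]; first by rewrite ltry.
  have [->|Jn] := eqVneq J 0%E; first by rewrite mule0 ltxx.
  by rewrite gt0_mulye// lt_neqAle eq_sym Jn.
by apply: lte_mul_pinfty => //; rewrite ge0_fin_numE.
Qed.

End polar.

(** * Sharpness of the constants and conclusion *)

Section extremal_instances.
Variables (R : realType) (N : nat) (K : set 'rV[R]_N).
Hypothesis K_Kss : Kss_o K.
Hypothesis N_ge2 : (2 <= N)%N.
Local Notation E := 'rV[R]_N.

Lemma extremal_cst_fin (c : R) : 0 < c ->
  (sq_integral (extremal K c (fun=> 1%R)) < +oo)%E.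
Proof.
move=> c0; have mg := measurable_gauge_gaussian K_Kss c.
have md := measurable_dgauge_gaussian K_Kss c.
apply: le_lt_trans (energy_gauge_gaussian K_Kss c0).
rewrite (_ : extremal K c (fun=> 1) = gauge_gaussian K c); last first.
  by apply/funext => x; rewrite /extremal mul1r.
exact: sq_integral_le_energy.
Qed.

Lemma extremal_cst_gt0 (c : R) : (0 < sq_integral (extremal K c (fun=> 1%R)))%E.
Proof.
rewrite sq_integralE; apply: integral_gt0_rV.
- exact: leq_trans N_ge2.
- apply/measurable_EFinP; apply: measurable_funX.
  by apply: measurable_extremal => //.
- by move=> x; rewrite lee_fin sqr_ge0.
- by move=> x _; rewrite lte_fin exprn_gt0// mulr_gt0// expR_gt0.
Qed.

Lemma constant_sum_sharp (C : R) :
  (forall v : E -> R, Cc_infty v -> (C%:E * sq_integral v <=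
     sq_integral (radial_derivative K v) + weighted_sq_integral K v)%E) ->
  C <= N%:R.
Proof.
have c0 : (0 : R) < 2^-1 by [].
have fin := extremal_cst_fin c0; have pos := extremal_cst_gt0 2^-1.
have mm : measurable_fun [set: E] (fun=> 1 : R) by [].
have hom (l : R) (x : E) : 0 < l -> (fun _ : E => 1 : R) (l *: x) = 1 by [].
pose S := fine (sq_integral (extremal K 2^-1 (fun=> 1))).
have SE : sq_integral (extremal K 2^-1 (fun=> 1)) = S%:E.
  by rewrite fineK// ge0_fin_numE// ltW.
apply: (constant_le_of_extremal K_Kss (extremal_approximable K_Kss N_ge2 c0 mm hom fin)
  (extremal_energy K_Kss N_ge2 c0 mm hom fin) SE).
  by rewrite -lte_fin -SE.
by rewrite extremal_sum// SE EFinM.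
Qed.

(** By the inequality of the means, the product of the square roots is at most
    half of the sum, so that [2 * C] is a constant for the sum. *)
Lemma constant_product_sharp (C : R) :
  (forall v : E -> R, Cc_infty v -> (C%:E * sq_integral v <=
     sqrte (sq_integral (radial_derivative K v)) *
     sqrte (weighted_sq_integral K v))%E) ->
  C <= N%:R / 2.
Proof.
move=> HC; rewrite ler_pdivlMr//; apply: constant_sum_sharp => v cv.
have := HC v cv.
have [A [B [S [-> -> -> [A0 B0 S0] _]]]] := integral_sqr_family K_Kss cv.
rewrite /= -!EFinM -EFinD !lee_fin => H.
have := sqr_ge0 (Num.sqrt A - Num.sqrt B).
rewrite sqrrB !sqr_sqrtr//; lra.
Qed.

Lemma extremal_Phi_fin (mu : {finite_measure set E -> \bar R}) (Phi : E -> R) (c : R) :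
  polar_measure K mu -> 0 < c -> measurable_fun (frontier K) Phi ->
  (\int[mu]_(s in frontier K) (Phi s ^+ 2)%:E < +oo)%E ->
  (sq_integral (extremal K c (fun x => Phi (sigma K x))) < +oo)%E.
Proof.
move=> polar_mu c0 mPhi Pfin.
have mm := measurable_comp_sigma K_Kss mPhi.
have c2 : 0 < 2 * c by rewrite mulr_gt0.
rewrite sq_integralE.
under eq_integral => x _.
  rewrite (_ : extremal _ _ _ _ ^+ 2 = Phi (sigma K x) ^+ 2 *
    expR (- (2 * c * minkowski_functional K x ^+ 2))); last first.
    by rewrite /extremal exprMn /gauge_gaussian -expRM_natl; congr (_ * expR _); ring.
  over.
apply: (@polar_finite _ _ _ K_Kss N_ge2 _ polar_mu (fun x => Phi (sigma K x) ^+ 2)) => //.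
- exact: measurable_funX.
- by move=> x; exact: sqr_ge0.
- by move=> l x l0; rewrite sigmaZ.
move: Pfin; congr (_ < _)%E; apply: eq_integral => s; rewrite inE => Ks.
by rewrite sigma_frontier.
Qed.

End extremal_instances.

Theorem corollary5p1 (R : realType) (N : nat) (K : set 'rV[R]_N)
    (N_ge2 : (2 <= N)%N) (K_Kss : Kss_o K) :
  [/\ (* inequality (1), and sharpness of its constant *)
      (forall u : 'rV[R]_N -> R, Cc_infty u ->
        (N%:R%:E * sq_integral u <=
         sq_integral (radial_derivative K u) + weighted_sq_integral K u)%E) /\
      (forall C : R,
        (forall u : 'rV[R]_N -> R, Cc_infty u ->
          (C%:E * sq_integral u <=
           sq_integral (radial_derivative K u) + weighted_sq_integral K u)%E) ->
        C <= N%:R),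
      (* inequality (2), and sharpness of its constant *)
      (forall u : 'rV[R]_N -> R, Cc_infty u ->
        ((N%:R / 2)%:E * sq_integral u <=
         sqrte (sq_integral (radial_derivative K u)) *
         sqrte (weighted_sq_integral K u))%E) /\
      (forall C : R,
        (forall u : 'rV[R]_N -> R, Cc_infty u ->
          (C%:E * sq_integral u <=
           sqrte (sq_integral (radial_derivative K u)) *
           sqrte (weighted_sq_integral K u))%E) ->
        C <= N%:R / 2),
      (* both constants are achieved in the completion, by a nonzero element *)
      (exists u g : 'rV[R]_N -> R,
        [/\ in_completion K u g, (0 < sq_integral u)%E &
            (sq_integral g + weighted_sq_integral K u =
             N%:R%:E * sq_integral u)%E]) /\
      (exists u g : 'rV[R]_N -> R,
        [/\ in_completion K u g, (0 < sq_integral u)%E &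
            (sqrte (sq_integral g) * sqrte (weighted_sq_integral K u) =
             (N%:R / 2)%:E * sq_integral u)%E]) &
      (* the extremal functions; g is both the radial derivative of u as an
         element of the completion and its pointwise derivative along rays *)
      forall mu : {finite_measure set 'rV[R]_N -> \bar R},
        polar_measure K mu ->
      forall Phi : 'rV[R]_N -> R,
        measurable_fun (frontier K) Phi ->
        (\int[mu]_(s in frontier K) (Phi s ^+ 2)%:E < +oo)%E ->
        (let u := fun x : 'rV[R]_N =>
           Phi (sigma K x) * expR (- (2^-1 * minkowski_functional K x ^+ 2)) in
         exists g : 'rV[R]_N -> R,
           [/\ in_completion K u g,
               forall x, x != 0 -> is_derive x (sigma K x) u (g x) &
               (sq_integral g + weighted_sq_integral K u =
                N%:R%:E * sq_integral u)%E]) /\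
        (forall lambda : R, 0 < lambda ->
         let u := fun x : 'rV[R]_N =>
           Phi (sigma K x) *
           expR (- ((2 * lambda ^+ 2)^-1 * minkowski_functional K x ^+ 2)) in
         exists g : 'rV[R]_N -> R,
           [/\ in_completion K u g,
               forall x, x != 0 -> is_derive x (sigma K x) u (g x) &
               (sqrte (sq_integral g) * sqrte (weighted_sq_integral K u) =
                (N%:R / 2)%:E * sq_integral u)%E])].
Proof.
have half0 : (0 : R) < 2^-1 by [].
have fin := extremal_cst_fin K_Kss half0.
have mm : measurable_fun [set: 'rV[R]_N] (fun=> 1 : R) by [].
have hom (l : R) (x : 'rV[R]_N) : 0 < l -> (fun _ : 'rV[R]_N => 1 : R) (l *: x) = 1 by [].
have comp := in_completion_approximable K_Kss
  (extremal_approximable K_Kss N_ge2 half0 mm hom fin).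
split.
- by split; [exact: heisenberg_sum|exact: constant_sum_sharp].
- by split; [exact: heisenberg_product|exact: constant_product_sharp].
- split; exists (extremal K 2^-1 (fun=> 1)), (dextremal K 2^-1 (fun=> 1)).
    by split => //; [exact: extremal_cst_gt0|exact: extremal_sum].
  by split => //; [exact: extremal_cst_gt0|exact: extremal_product].
- move=> mu polar_mu Phi mPhi Pfin.
  have mP := measurable_comp_sigma K_Kss mPhi.
  have homP (l : R) (x : 'rV[R]_N) : 0 < l ->
      (fun x => Phi (sigma K x)) (l *: x) = Phi (sigma K x).
    by move=> l0 /=; rewrite sigmaZ.
  have finP c : 0 < c -> (sq_integral (extremal K c (fun x => Phi (sigma K x))) < +oo)%E.
    by move=> c0; exact: (extremal_Phi_fin K_Kss N_ge2 polar_mu).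
  split.
    exists (dextremal K 2^-1 (fun x => Phi (sigma K x))); split.
    + apply: in_completion_approximable => //.
      exact: (extremal_approximable K_Kss N_ge2 half0 mP homP (finP _ half0)).
    + move=> x x0; exact: (is_derive_extremal K_Kss _ homP x0).
    + exact: extremal_sum.
  move=> lambda l0 /=.
  have c0 : 0 < (2 * lambda ^+ 2)^-1 by rewrite invr_gt0 mulr_gt0// exprn_gt0.
  exists (dextremal K (2 * lambda ^+ 2)^-1 (fun x => Phi (sigma K x))); split.
  + apply: in_completion_approximable => //.
    exact: (extremal_approximable K_Kss N_ge2 c0 mP homP (finP _ c0)).
  + by move=> x x0; exact: (is_derive_extremal K_Kss _ homP x0).
  + exact: extremal_product.
Qed.
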